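(* Let $n\ge 2$, $1\le k\le n-1$, $1\le p\le\infty$, $1/p+1/p'=1$, let $\mu\in\mathbb{R}$ satisfy $\mu>k-n/p$, and put $\nu=\mu-k/p'$. Then the $k$-plane transform $R_k$ is a linear bounded operator from $L^p_\mu(\mathbb{R}^n)$ to $L^p_\nu(\Pi_{n,k})$ with operator norm $$\|R_k\|=\pi^{k/2}\left(\frac{\sigma_{n-k-1}}{\sigma_{n-1}}\right)^{1/p}\frac{\Gamma\big((\mu+n/p-k)/2\big)}{\Gamma\big((\mu+n/p)/2\big)}.$$
   Context: $G_{n,k}$ is the Grassmann manifold of $k$-dimensional linear subspaces $\xi$ of $\mathbb{R}^n$, with its $O(n)$-invariant probability measure $d\xi$. $\Pi_{n,k}$ is the manifold of all non-oriented affine $k$-planes $\tau$ in $\mathbb{R}^n$; each $\tau$ is parameterized by a pair $(\xi,u)$ with $\xi\in G_{n,k}$, $u\in\xi^\perp$ (so $\tau=\xi+u$), and $\Pi_{n,k}$ carries the measure $d\tau=d\xi\,du$, where $du$ is Lebesgue measure on $\xi^\perp$. $|\tau|=|u|$ is the Euclidean distance from $\tau$ to the origin. $L^p_\nu(\Pi_{n,k})$ is the space of measurable functions $\varphi$ with $\|\varphi\|_{p,\nu}=\|\,|\tau|^\nu\varphi\,\|_{L^p(\Pi_{n,k},d\tau)}<\infty$. Likewise $L^p_\mu(\mathbb{R}^n)$ is the space of measurable $f$ with $\|f\|_{p,\mu}=\|\,|x|^\mu f\,\|_{L^p(\mathbb{R}^n)}<\infty$. The $k$-plane transform is $$(R_kf)(\xi,u)=\int_\xi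 f(y+u)\,dy,$$ where $dy$ is Lebesgue measure on $\xi$. $\sigma_{m-1}=2\pi^{m/2}/\Gamma(m/2)$ is the area of the unit sphere $S^{m-1}$ in $\mathbb{R}^m$ ($\sigma_0=2$). Convention: $1/\infty=0$. *)

(* Defs.v *)
From HB Require Import structures.
From mathcomp Require Import all_boot all_order all_algebra.
From mathcomp Require Import all_classical all_reals all_analysis.
From mathcomp Require Import measurable_realfun.

Set Implicit Arguments.
Unset Strict Implicit.
Unset Printing Implicit Defensive.
Import Order.TTheory GRing.Theory Num.Theory.
Import numFieldNormedType.Exports.
Local Open Scope classical_set_scope.
Local Open Scope ring_scope.

Section euclidean.
Variables (R : realType) (n : nat).
Implicit Types (u v w : 'rV[R]_n) (U : {vspace 'rV[R]_n}).

(** Points of R^n are row vectors. *)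
Definition dotv u v : R := \sum_i u 0 i * v 0 i.
Definition enorm u : R := Num.sqrt (dotv u u).

Lemma dotvC u v : dotv u v = dotv v u.
Proof. by apply: eq_bigr => i _; rewrite mulrC. Qed.

Lemma dotv_is_linear u : linear (dotv u : 'rV[R]_n -> R^o).
Proof.
move=> a v w; rewrite /dotv [in RHS]/GRing.scale/= mulr_sumr -big_split/=.
by apply: eq_bigr => i _; rewrite !mxE mulrDr mulrCA.
Qed.
HB.instance Definition _ u :=
  GRing.isLinear.Build R 'rV[R]_n R^o _ (dotv u : _ -> R^o) (dotv_is_linear u).

Lemma dotvDr u v w : dotv u (v + w) = dotv u v + dotv u w.
Proof. exact: (linearD (dotv u : {linear _ -> R^o})). Qed.
Lemma dotvZr a u v : dotv u (a *: v) = a * dotv u v.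
Proof. exact: (linearZ_LR (dotv u : {linear _ -> R^o})). Qed.
Lemma dotv0r u : dotv u 0 = 0.
Proof. exact: (linear0 (dotv u : {linear _ -> R^o})). Qed.
Lemma dotvNr u v : dotv u (- v) = - dotv u v.
Proof. exact: (linearN (dotv u : {linear _ -> R^o})). Qed.
Lemma dotv_sumr u I (s : seq I) P (F : I -> 'rV[R]_n) :
  dotv u (\sum_(i <- s | P i) F i) = \sum_(i <- s | P i) dotv u (F i).
Proof. exact: (linear_sum (dotv u : {linear _ -> R^o})). Qed.

Lemma dotv_ge0 u : 0 <= dotv u u.
Proof. by apply: sumr_ge0 => i _; rewrite -expr2 sqr_ge0. Qed.

Lemma dotv_eq0 u : (dotv u u == 0) = (u == 0).
Proof.
apply/idP/eqP => [|->]; last by rewrite dotv0r.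
rewrite psumr_eq0 => [/allP h|i _]; last by rewrite -expr2 sqr_ge0.
apply/rowP => i; rewrite mxE; apply/eqP.
by have := h i (mem_index_enum i); rewrite -expr2 sqrf_eq0.
Qed.

Definition orthc U : {vspace 'rV[R]_n} :=
  (\bigcap_(i < \dim U) lker (linfun (dotv (vbasis U)`_i : _ -> R^o)))%VS.

Lemma mem_orthc U u : reflect {in U, forall v, dotv v u = 0} (u \in orthc U).
Proof.
apply: (iffP idP) => [+ v /coord_vbasis ->|h].
  rewrite memvE => /subv_bigcapP h.
  rewrite dotvC dotv_sumr big1// => i _; rewrite dotvZr dotvC.
  by have := h i isT; rewrite -memvE memv_ker lfunE/= => /eqP ->; rewrite mulr0.
rewrite memvE; apply/subv_bigcapP => i _; rewrite -memvE memv_ker lfunE/=.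
by apply/eqP/h; apply: vbasis_mem; rewrite mem_nth// size_tuple.
Qed.

Lemma orthc_cap U : (U :&: orthc U = 0)%VS.
Proof.
apply/eqP; rewrite -subv0; apply/subvP => u; rewrite memv_cap => /andP[uU].
by move/mem_orthc => /(_ u uU) /eqP; rewrite dotv_eq0 memv0.
Qed.

Lemma dim_rV : \dim {:'rV[R]_n} = n.
Proof. by rewrite dimvf /dim/= mul1n. Qed.

Lemma dim_orthc_ge U : (n - \dim U <= \dim (orthc U))%N.
Proof.
rewrite /orthc -(big_mkord xpredT (fun i =>
  lker (linfun (dotv (vbasis U)`_i : _ -> R^o)))).
move: (tval (vbasis U)) => b.
elim: (\dim U) => [|d IH]; first by rewrite big_geq// subn0 dim_rV.
rewrite big_nat_recr//=; set A := (\bigcap_(_ <= i < _) _)%VS in IH *.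
set f := linfun _.
have := limg_ker_dim f A; have : (\dim (f @: A) <= 1)%N.
  by rewrite (leq_trans (dimvS (subvf _)))// dimvf /dim.
move=> h1 h2; rewrite subnS; apply: leq_trans (_ : (\dim A).-1 <= _)%N.
  by rewrite -!subn1 leq_sub2r.
by rewrite -h2 -subn1 leq_subLR [leqRHS]addnC leq_add2l.
Qed.

Lemma orthc_add U : (U + orthc U = fullv)%VS.
Proof.
apply/eqP; rewrite eqEdim subvf/= dim_rV dimv_disjoint_sum ?orthc_cap//.
by rewrite -leq_subLR dim_orthc_ge.
Qed.

Lemma dim_orthc U : \dim (orthc U) = (n - \dim U)%N.
Proof.
have := dimv_disjoint_sum (orthc_cap U); rewrite orthc_add dim_rV => h.
by move: (\dim U) (\dim (orthc U)) h => a b h; rewrite h addKn.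
Qed.

Lemma orthcK U : orthc (orthc U) = U.
Proof.
apply/eqP; rewrite eq_sym eqEdim !dim_orthc subKn; last first.
  by have := dimvS (subvf U); rewrite dim_rV.
rewrite leqnn andbT; apply/subvP => u uU; apply/mem_orthc => v /mem_orthc h.
by rewrite dotvC h.
Qed.

(** [u *m orthproj U] is the orthogonal projection of [u] onto [U] *)
Definition orthproj U : 'M[R]_n := lin1_mx (daddv_pi U (orthc U)).

Lemma orthprojE U u : u *m orthproj U = daddv_pi U (orthc U) u.
Proof. by rewrite mul_rV_lin1. Qed.

Lemma orthproj_mem U u : u *m orthproj U \in U.
Proof. by rewrite orthprojE memv_pi. Qed.

Lemma orthproj_id U u : u \in U -> u *m orthproj U = u.
Proof. by move=> uU; rewrite orthprojE daddv_pi_id// orthc_cap. Qed.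

Lemma orthproj_orthc U : orthproj (orthc U) = 1%:M - orthproj U.
Proof.
apply/row_matrixP => i; rewrite !rowE mulmxBr mulmx1 !orthprojE orthcK.
apply/eqP; rewrite eq_sym subr_eq addrC eq_sym.
by rewrite daddv_pi_add ?orthc_cap// orthc_add memvf.
Qed.

End euclidean.

Section orthonormal_basis.
Variables (R : realType) (n : nat).
Implicit Types (u v w : 'rV[R]_n) (e s : seq 'rV[R]_n) (U : {vspace 'rV[R]_n}).

Definition gram_schmidt_step e v :=
  let w := v - \sum_(u <- e) dotv v u *: u in
  if w == 0 then e else rcons e ((enorm w)^-1 *: w).

Definition gram_schmidt s : seq 'rV[R]_n := foldl gram_schmidt_step [::] s.

Definition orthonormal_seq e :=
  forall i j, (i < size e)%N -> (j < size e)%N ->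
    dotv e`_i e`_j = (i == j)%:R.

Lemma gram_schmidt_stepP e v : orthonormal_seq e ->
  orthonormal_seq (gram_schmidt_step e v) /\
  (<<gram_schmidt_step e v>> = <<e>> + <[v]>)%VS.
Proof.
rewrite /gram_schmidt_step => on; set S := \sum_(_ <- _) _; set w := v - S.
have Se : S \in <<e>>%VS.
  by rewrite /S big_seq; apply: memv_suml => u ue; rewrite memvZ// memv_span.
have vE : v = w + S by rewrite subrK.
case: ifPn => [/eqP w0|w0].
  split=> //; apply/esym/addv_idPl; rewrite -memvE vE w0 add0r; exact: Se.
have ew : enorm w != 0 by rewrite sqrtr_eq0 -ltNge lt_neqAle eq_sym dotv_eq0 w0 dotv_ge0.
have we j : (j < size e)%N -> dotv e`_j w = 0.
  move=> je; rewrite dotvDr dotvNr dotv_sumr (big_nth 0) big_mkord.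
  rewrite (bigD1 (Ordinal je))//= big1 => [|i ij].
    by rewrite dotvZr on// eqxx mulr1 addr0 dotvC subrr.
  rewrite dotvZr on// (_ : (j == i :> nat) = false) ?mulr0//.
  by apply/negbTE; rewrite eq_sym; exact: ij.
have ww : dotv ((enorm w)^-1 *: w) ((enorm w)^-1 *: w) = 1.
  rewrite dotvZr dotvC dotvZr mulrA -invfM -expr2 sqr_sqrtr ?dotv_ge0//.
  by rewrite mulVf// dotv_eq0.
split.
  move=> i j; rewrite size_rcons !ltnS !nth_rcons.
  rewrite leq_eqVlt => /predU1P[->|ie]; rewrite leq_eqVlt => /predU1P[->|je].
  - by rewrite ltnn eqxx ww.
  - by rewrite ltnn eqxx je dotvC dotvZr we// mulr0 gtn_eqF.
  - by rewrite ltnn eqxx ie dotvZr we// mulr0 ltn_eqF.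
  - by rewrite ie je on.
have S1 x : S \in (<<e>> + <[x]>)%VS.
  by move: (S) Se => z; apply/subvP; exact: addvSl.
have L1 x : x \in (<<e>> + <[x]>)%VS.
  by apply: subvP (memv_line x); exact: addvSr.
rewrite -cats1 span_cat span_seq1; set c := (enorm w)^-1.
apply/eqP; rewrite eqEsubv !subv_add !addvSl/= -!memvE; apply/andP; split.
  by apply/memvZ/memvB; [exact: L1|exact: S1].
rewrite [X in X \in _]vE; apply: memvD; last exact: S1.
by rewrite -[X in X \in _](scalerKV ew) -/c; apply/memvZ/L1.
Qed.

Lemma gram_schmidtP s :
  orthonormal_seq (gram_schmidt s) /\ (<<gram_schmidt s>> = << s >>)%VS.
Proof.
elim/last_ind: s => [|s v [on sp]]; first by split.
rewrite /gram_schmidt foldl_rcons; have [? ->] := gram_schmidt_stepP v on.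
by split => //; rewrite sp -cats1 span_cat span_seq1.
Qed.

Definition onb_seq U := gram_schmidt [seq row i (orthproj U) | i <- enum 'I_n].

Lemma onb_seqP U : orthonormal_seq (onb_seq U) /\ (<<onb_seq U>> = U)%VS.
Proof.
have [on ->] := gram_schmidtP [seq row i (orthproj U) | i <- enum 'I_n].
split=> //; apply/eqP; rewrite eqEsubv; apply/andP; split.
  by apply/span_subvP => _ /mapP[i _ ->]; rewrite rowE orthproj_mem.
apply/subvP => u /orthproj_id <-; rewrite mulmx_sum_row memv_suml// => i _.
by rewrite memvZ// memv_span//; apply: map_f; rewrite mem_enum.
Qed.

Lemma size_onb_seq U : size (onb_seq U) = \dim U.
Proof.
have [on sp] := onb_seqP U; rewrite -[in RHS]sp; apply/esym/eqP.
change (free (in_tuple (onb_seq U))); apply/freeP => c c0 i.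
have := dotv0r (onb_seq U)`_i; rewrite -[X in dotv _ X]c0 dotv_sumr (bigD1 i)//=.
rewrite big1 => [|j ji]; rewrite dotvZr on ?ltn_ord//; first last.
  by rewrite eq_sym (negbTE ji : (j == i :> nat) = false) mulr0.
by rewrite eqxx mulr1 addr0.
Qed.

(** The rows of [onb (\dim U) U] form an orthonormal basis of [U] ([onbP]);
    the number of rows is a parameter so that [U |-> onb m U] has a
    non-dependent type, and only [m = \dim U] is meaningful.  Any orthonormal
    basis would do for the definition of [lebesgue_on] below; this one is a
    measurable function of [U] ([measurable_onb]). *)
Definition onb (m : nat) U : 'M[R]_(m, n) := \matrix_(i < m) (onb_seq U)`_i.

Lemma onbP U : onb (\dim U) U *m (onb (\dim U) U)^T = 1%:M /\
  forall u, u \in U <-> exists y, u = y *m onb (\dim U) U.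
Proof.
have [on sp] := onb_seqP U; split.
  apply/matrixP => i j; rewrite !mxE -(on i j) ?size_onb_seq ?ltn_ord//.
  by apply: eq_bigr => l _; rewrite !mxE.
move=> u; rewrite -{1}sp.
have sz := size_onb_seq U; split => [|[y ->]].
  move=> /(@coord_span _ _ _ (in_tuple _)) ->.
  exists (\row_j coord (in_tuple (onb_seq U)) (cast_ord (esym sz) j) u).
  rewrite mulmx_sum_row (reindex (cast_ord (esym sz)))/=.
    by apply: eq_bigr => i _; rewrite mxE rowK.
  by exists (cast_ord sz) => i _; apply: val_inj.
rewrite mulmx_sum_row memv_suml// => i _; rewrite memvZ// rowK.
by rewrite memv_span// mem_nth// sz.
Qed.

Lemma onb_mem m U (y : 'rV[R]_m) : y *m onb m U \in U.
Proof.
have [_ sp] := onb_seqP U; rewrite mulmx_sum_row memv_suml// => i _.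
apply: memvZ; rewrite rowK.
have [?|?] := ltnP i (size (onb_seq U)); last by rewrite nth_default// mem0v.
by move/vspaceP: sp => <-; rewrite memv_span// mem_nth.
Qed.

End orthonormal_basis.

Definition mx_display (R : realType) : measure_display.
Proof. exact: default_measure_display. Qed.

(** Matrices carry the sigma-algebra generated by the coordinates, that is, the
    Borel sigma-algebra. *)
Section measurable_matrix.
Variables (R : realType) (m n : nat).

Definition measurable_mx : set (set 'M[R]_(m, n)) :=
  <<s \bigcup_(ij in [set: 'I_m * 'I_n])
        preimage_set_system setT (fun A : 'M[R]_(m, n) => A ij.1 ij.2)
          measurable >>.

Let measurable_mx0 : measurable_mx set0. Proof. exact: sigma_algebra0. Qed.
Let measurable_mxC A : measurable_mx A -> measurable_mx (~` A).
Proof. exact: sigma_algebraC. Qed.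
Let measurable_mx_bigcup (F : (set 'M[R]_(m, n))^nat) :
  (forall i, measurable_mx (F i)) -> measurable_mx (\bigcup_i F i).
Proof. exact: sigma_algebra_bigcup. Qed.

HB.instance Definition _ := isMeasurable.Build (mx_display R) 'M[R]_(m, n)
  measurable_mx0 measurable_mxC measurable_mx_bigcup.

End measurable_matrix.

Lemma measurable_mx_entry (R : realType) m n i j :
  measurable_fun [set: 'M[R]_(m, n)] (fun A : 'M[R]_(m, n) => A i j).
Proof.
move=> _ B mB; apply: sub_sigma_algebra; exists (i, j) => //=.
by exists B.
Qed.

Lemma measurable_fun_mxP d (T : measurableType d) (R : realType) m n
    (f : T -> 'M[R]_(m, n)) :
  (forall i j, measurable_fun setT (fun x => f x i j)) -> measurable_fun setT f.
Proof.
move=> mf; apply: (@measurability _ _ _ _ _ _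
  (\bigcup_(ij in [set: 'I_m * 'I_n])
     preimage_set_system setT (fun A : 'M[R]_(m, n) => A ij.1 ij.2)
       measurable)) => //.
move=> _ [_ [[i j] _ [B mB <-]] <-]; rewrite setTI setTI -comp_preimage.
by rewrite -[X in measurable X]setTI; exact: mf.
Qed.

Lemma measurable_mulmx d (T : measurableType d) (R : realType) m n l
    (f : T -> 'M[R]_(m, n)) (g : T -> 'M[R]_(n, l)) :
  measurable_fun setT f -> measurable_fun setT g ->
  measurable_fun setT (fun x => f x *m g x).
Proof.
move=> mf mg; apply: measurable_fun_mxP => i j; under eq_fun do rewrite mxE.
apply: measurable_sum => a; apply: measurable_funM.
  exact: measurableT_comp (measurable_mx_entry i a) mf.
exact: measurableT_comp (measurable_mx_entry a j) mg.
Qed.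

Definition rV_snoc (R : realType) n (xt : 'rV[R]_n * R) : 'rV[R]_n.+1 :=
  \row_i (if unlift ord_max i is Some j then xt.1 0 j else xt.2).

Lemma measurable_rV_snoc (R : realType) n :
  measurable_fun setT (@rV_snoc R n).
Proof.
apply: measurable_fun_mxP => i j; under eq_fun do rewrite mxE.
case: unlift => [l|]; last exact: measurable_snd.
exact: measurableT_comp (measurable_mx_entry 0 l) measurable_fst.
Qed.

Lemma sigma_finite_prod d1 d2 (T1 : measurableType d1) (T2 : measurableType d2)
    (R : realType) (m1 : {sigma_finite_measure set T1 -> \bar R})
    (m2 : {sigma_finite_measure set T2 -> \bar R}) :
  sigma_finite setT (m1 \x m2)%E.
Proof.
have /sigma_finiteP[F [TF ndF Foo]] := sigma_finiteT m1.
have /sigma_finiteP[G [TG ndG Goo]] := sigma_finiteT m2.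
exists (fun n => F n `*` G n).
 rewrite -setXTT TF TG predeqE => -[x y]; split.
    move=> [/= [n _ Fnx] [k _ Gky]]; exists (maxn n k) => //; split.
    - by move: x Fnx; exact/subsetPset/ndF/leq_maxl.
    - by move: y Gky; exact/subsetPset/ndG/leq_maxr.
  by move=> [n _ []/= ? ?]; split; exists n.
move=> k; have [? ?] := Foo k; have [? ?] := Goo k.
split; first exact: measurableX.
by rewrite product_measure1E// lte_mul_pinfty// ge0_fin_numE.
Qed.

Section lebesgue_rV_succ.
Variables (R : realType) (n : nat).
Variable m : {sigma_finite_measure set 'rV[R]_n -> \bar R}.

Definition lebesgue_rV_succ : set 'rV[R]_n.+1 -> \bar R :=
  pushforward (m \x lebesgue_measure)%E (@rV_snoc R n).

Let lebesgue_rV_succ_measure : {measure set 'rV[R]_n.+1 -> \bar R}.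
Proof.
by refine (lebesgue_rV_succ : {measure set _ -> \bar R});
  exact: measurable_rV_snoc.
Defined.
HB.instance Definition _ := Measure.copy lebesgue_rV_succ lebesgue_rV_succ_measure.

Let sigma_finite_lebesgue_rV_succ : sigma_finite setT lebesgue_rV_succ.
Proof.
pose g (x : 'rV[R]_n.+1) : 'rV[R]_n * measurableTypeR R :=
  (\row_j x 0 (lift ord_max j), x 0 ord_max).
have gK : cancel (@rV_snoc R n) g.
  move=> [x t]; rewrite /g mxE unlift_none/=; congr pair.
  by apply/rowP => j; rewrite !mxE liftK.
have mg : measurable_fun setT g.
  apply: measurable_fun_pair; last exact: measurable_mx_entry.
  apply: measurable_fun_mxP => i j; under eq_fun do rewrite mxE.
  exact: measurable_mx_entry.
have [F FT Foo] := sigma_finite_prod m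
  (@lebesgue_measure R : {sigma_finite_measure set (measurableTypeR R) -> \bar R}).
exists (fun i => g @^-1` F i); first by rewrite -preimage_bigcup -FT preimage_setT.
move=> i; have [mF lF] := Foo i; split.
  by rewrite -[X in measurable X]setTI; exact: mg.
by rewrite /lebesgue_rV_succ /pushforward -comp_preimage
  (_ : g \o _ = id)//; exact/funext.
Qed.
HB.instance Definition _ :=
  Measure_isSigmaFinite.Build _ _ _ lebesgue_rV_succ sigma_finite_lebesgue_rV_succ.

End lebesgue_rV_succ.

Fixpoint lebesgue_rV (R : realType) (n : nat) :
    {sigma_finite_measure set 'rV[R]_n -> \bar R} :=
  if n is n'.+1 then lebesgue_rV_succ (lebesgue_rV R n') else \d_(0 : 'rV[R]_0).

Section measurable_onb.
Context d (T : measurableType d) (R : realType) (n : nat).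
Implicit Types f g : T -> 'rV[R]_n.

Let mentry f i : measurable_fun setT f -> measurable_fun setT (fun x => f x 0 i).
Proof. by move=> mf; exact: measurableT_comp (measurable_mx_entry 0 i) mf. Qed.

Lemma measurable_dotv f g : measurable_fun setT f -> measurable_fun setT g ->
  measurable_fun setT (fun x => dotv (f x) (g x)).
Proof.
move=> mf mg; apply: measurable_sum => i.
by apply: measurable_funM; exact: mentry.
Qed.

Lemma measurable_enorm f : measurable_fun setT f ->
  measurable_fun setT (fun x => enorm (f x)).
Proof.
move=> mf; rewrite (_ : (fun _ => _) = fun x => dotv (f x) (f x) `^ 2^-1).
  apply: (measurableT_comp (measurable_powR _)); exact: measurable_dotv.
by apply/funext => x; rewrite /enorm powR12_sqrt// dotv_ge0.
Qed.

Let measurable_scale (a : T -> R) f : measurable_fun setT a ->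
  measurable_fun setT f -> measurable_fun setT (fun x => a x *: f x).
Proof.
move=> ma mf; apply: measurable_fun_mxP => i j; under eq_fun do rewrite mxE.
by apply: measurable_funM => //; rewrite (ord1 i); exact: mentry.
Qed.

Let measurable_sub f g : measurable_fun setT f -> measurable_fun setT g ->
  measurable_fun setT (fun x => f x - g x).
Proof.
move=> mf mg; apply: measurable_fun_mxP => i j.
under eq_fun do rewrite mxE [X in _ + X]mxE.
by apply: measurable_funB; rewrite (ord1 i); exact: mentry.
Qed.

Let measurable_sumv N (h : nat -> T -> 'rV[R]_n) :
  (forall i, measurable_fun setT (h i)) ->
  measurable_fun setT (fun x => \sum_(i < N) h i x).
Proof.
move=> mh; apply: measurable_fun_mxP => i j.
under eq_fun do rewrite summxE.
by apply: measurable_sum => l; rewrite (ord1 i); exact: mentry.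
Qed.

Lemma measurable_gram_schmidt (s : seq (T -> 'rV[R]_n)) :
  (forall i, measurable_fun setT (nth (cst 0) s i)) ->
  measurable_fun setT (fun x => size (gram_schmidt [seq f x | f <- s])) /\
  forall j, measurable_fun setT (fun x => (gram_schmidt [seq f x | f <- s])`_j).
Proof.
elim/last_ind: s => [_|s f IH ms].
  by split => [|j]; under eq_fun do rewrite /= ?nth_nil; exact: measurable_cst.
have {}/IH[msz mL] : forall i, measurable_fun setT (nth (cst 0) s i).
  move=> i; have := ms i; rewrite nth_rcons; case: ltnP => // si _.
  by rewrite nth_default//; exact: measurable_cst.
have mf : measurable_fun setT f.
  by have := ms (size s); rewrite nth_rcons ltnn eqxx.
pose L x := gram_schmidt [seq g x | g <- s].
pose w x := f x - \sum_(i < size s) dotv (f x) (L x)`_i *: (L x)`_i.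
have szL x : (size (L x) <= size s)%N.
  rewrite /L /gram_schmidt; elim/last_ind: s {ms msz mL L w} => // s g IH.
  rewrite map_rcons foldl_rcons size_rcons /gram_schmidt_step.
  by case: ifP => _; rewrite ?size_rcons ?ltnS// (leq_trans IH).
have mw : measurable_fun setT w.
  apply: measurable_sub => //; apply: (@measurable_sumv _ (fun i x =>
    dotv (f x) (L x)`_i *: (L x)`_i)) => i.
  by apply: measurable_scale; [exact: measurable_dotv|exact: mL].
have stepE x : gram_schmidt [seq g x | g <- rcons s f] =
    if w x == 0 then L x else rcons (L x) ((enorm (w x))^-1 *: w x).
  rewrite map_rcons /gram_schmidt foldl_rcons -/(gram_schmidt _) -/(L x).
  rewrite /gram_schmidt_step (_ : \sum_(u <- _) _ =
    \sum_(i < size s) dotv (f x) (L x)`_i *: (L x)`_i)//.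
  rewrite (big_nth 0) big_mkord.
  rewrite (big_ord_widen _ (fun i => dotv (f x) (L x)`_i *: (L x)`_i) (szL x)).
  rewrite big_mkcond/=; apply: eq_bigr => i _; case: ltnP => // h.
  by rewrite nth_default// scaler0.
have mw0 : measurable_fun setT (fun x => w x == 0).
  under eq_fun do rewrite -dotv_eq0.
  by apply: measurable_fun_eqr => //; exact: measurable_dotv.
split.
  rewrite (_ : (fun _ => _) = fun x => if w x == 0 then size (L x) else (size (L x) + 1)%N).
    apply: measurable_fun_ifT => //; exact: measurable_fun_addn.
  by apply/funext => x; rewrite stepE; case: ifP; rewrite ?size_rcons ?addn1.
move=> j; rewrite (_ : (fun _ => _) = fun x => if size (L x) == j
    then (enorm (w x))^-1 *: w x else (L x)`_j).
  apply: measurable_fun_ifT => //; first exact: measurable_fun_eqn.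
  apply: measurable_scale => //.
  rewrite (_ : (fun _ => _) = fun x => enorm (w x) `^ (-1)).
    apply: (measurableT_comp (measurable_powR _)); exact: measurable_enorm.
  by apply/funext => x; rewrite powR_inv1// sqrtr_ge0.
apply/funext => x; rewrite stepE; case: ifPn => [/eqP ->|_].
  by rewrite scaler0; case: eqP => // <-; rewrite nth_default.
rewrite nth_rcons [j == _]eq_sym; case: ltngtP => // h.
by rewrite nth_default// ltnW.
Qed.

Lemma measurable_onb m (U : T -> {vspace 'rV[R]_n}) :
  measurable_fun setT (fun x => orthproj (U x)) ->
  measurable_fun setT (fun x => onb m (U x)).
Proof.
move=> mU; apply: measurable_fun_mxP => i j; under eq_fun do rewrite mxE.
apply: mentry; pose s := [seq (fun x => row l (orthproj (U x))) | l <- enum 'I_n].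
rewrite (_ : (fun _ => _) = fun x => (gram_schmidt [seq f x | f <- s])`_i).
  apply: (measurable_gram_schmidt _).2 => l.
  have [ls|ls] := ltnP l (size s); last by rewrite nth_default//; exact: measurable_cst.
  rewrite size_map in ls; have n0 : 'I_n by move: ls; rewrite size_enum_ord => ls; exact: Ordinal ls.
  rewrite (nth_map n0)//; apply: measurable_fun_mxP => a b; under eq_fun do rewrite mxE.
  exact: measurableT_comp (measurable_mx_entry _ b) mU.
by apply/funext => x; rewrite /onb_seq /s -map_comp.
Qed.

End measurable_onb.

(** Lebesgue measure of the linear subspace [U] (transported by an orthonormal
    basis), seen as a measure on R^n concentrated on [U]. *)
Section lebesgue_on.
Variables (R : realType) (n : nat) (U : {vspace 'rV[R]_n}).

Definition lebesgue_on : set 'rV[R]_n -> \bar R :=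
  pushforward (lebesgue_rV R (\dim U))
    (fun y : 'rV[R]_(\dim U) => y *m onb (\dim U) U).

Let lebesgue_on_measure : {measure set 'rV[R]_n -> \bar R}.
Proof.
by refine (lebesgue_on : {measure set _ -> \bar R}); exact: measurable_mulmx.
Defined.
HB.instance Definition _ := Measure.copy lebesgue_on lebesgue_on_measure.

End lebesgue_on.

Lemma lebesgue_onE (R : realType) n (U : {vspace 'rV[R]_n}) m A : \dim U = m ->
  lebesgue_on U A = lebesgue_rV R m ((fun y => y *m onb m U) @^-1` A).
Proof. by move=> <-. Qed.

(** G(n, k).  The minimum with [n] only makes the type nonempty when [n < k],
    because measurable types are pointed. *)
Definition grassmannian (R : realType) (n k : nat) : Type :=
  {xi : {vspace 'rV[R]_n} | \dim xi == minn k n}.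

Section grassmannian.
Variables (R : realType) (n k : nat).
Local Notation G := (grassmannian R n k).

HB.instance Definition _ := SubChoice.on G.

Let grassmannian_point : G.
Proof.
exists (<<take (minn k n) (vbasis {:'rV[R]_n})>>%VS).
set b := vbasis _; have : free (take (minn k n) b).
  apply: (@catl_free _ _ (drop (minn k n) b)); rewrite cat_take_drop.
  exact: basis_free (vbasisP _).
rewrite /free => /eqP ->; rewrite size_take size_tuple dim_rV.
by case: ltnP => // h; apply/eqP/anti_leq; rewrite geq_minr h.
Qed.
HB.instance Definition _ := isPointed.Build G grassmannian_point.

(** [xi |-> orthproj (val xi)] identifies G(n, k) with a compact submanifold of
    the space of matrices; this is the Borel sigma-algebra. *)
HB.instance Definition _ := Measurable.copy G
  (g_sigma_algebra_preimageType (fun xi : G => orthproj (val xi))).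

Lemma measurable_orthproj : measurable_fun setT (fun xi : G => orthproj (val xi)).
Proof. by move=> _ B mB; exists B. Qed.

Definition orthogonal (g : 'M[R]_n) : Prop := g *m g^T = 1%:M.

(** The action of O(n), see [val_rotate]; [g] acts on row vectors from the
    right. *)
Definition rotate (g : 'M[R]_n) (xi : G) : G :=
  insubd xi (linfun (mulmxr g) @: val xi)%VS.

Lemma val_rotate g xi : orthogonal g ->
  val (rotate g xi) = (linfun (mulmxr g) @: val xi)%VS.
Proof.
move=> og; rewrite val_insubd limg_dim_eq ?(valP xi)//.
apply/eqP; rewrite -subv0; apply/subvP => u; rewrite memv_cap memv_ker lfunE/=.
move=> /andP[_ /eqP ug]; rewrite memv0.
by rewrite -[u]mulmx1 -og mulmxA ug mul0mx.
Qed.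

Definition rotation_invariant (gamma : set G -> \bar R) : Prop :=
  forall g, orthogonal g -> forall A : set G, measurable A ->
    gamma (rotate g @^-1` A) = gamma A.

End grassmannian.
Arguments rotate {R n k}.

Definition affine_plane (R : realType) (n k : nat) : Type :=
  {tau : grassmannian R n k * 'rV[R]_n | tau.2 \in orthc (val tau.1)}.

Section affine_plane.
Variables (R : realType) (n k : nat).
Local Notation G := (grassmannian R n k).
Local Notation Pi := (affine_plane R n k).

HB.instance Definition _ := SubChoice.on Pi.
HB.instance Definition _ :=
  isPointed.Build Pi (exist _ (point, 0) (mem0v (orthc (val (point : G))))).
HB.instance Definition _ := Measurable.copy Pi
  (g_sigma_algebra_preimageType (val : Pi -> G * 'rV[R]_n)).

Definition direction (tau : Pi) : G := (val tau).1.
Definition offset (tau : Pi) : 'rV[R]_n := (val tau).2.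

Variable gamma : {sfinite_measure set G -> \bar R}.

(** The measure [dtau = dxi du]. *)
Definition plane_measure (A : set Pi) : \bar R :=
  (\int[gamma]_xi
     lebesgue_on (orthc (val xi)) [set u | exists2 tau, A tau & val tau = (xi, u)])%E.

Definition plane_param (p : G * 'rV[R]_(n - minn k n)) : Pi :=
  exist _ (p.1, p.2 *m onb (n - minn k n) (orthc (val p.1))) (onb_mem _ _).

Lemma measurable_plane_param : measurable_fun setT plane_param.
Proof.
have mp : measurable_fun setT (val \o plane_param).
  apply: measurable_fun_pair; first exact: measurable_fst.
  apply: measurable_mulmx; first exact: measurable_snd.
  apply: measurable_onb.
  apply: (eq_measurable_fun (fun p : G * 'rV[R]_(n - minn k n) =>
    1%:M - orthproj (val p.1))) => [p _|]; first by rewrite orthproj_orthc.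
  have mo : measurable_fun setT (fun p : G * 'rV[R]_(n - minn k n) =>
      orthproj (val p.1)).
    have := @measurableT_comp _ _ _ _ _ _ (fun xi : G => orthproj (val xi)) _ _
      (@measurable_orthproj R n k) (@measurable_fst _ _ G 'rV[R]_(n - minn k n)).
    exact.
  apply: measurable_fun_mxP => i j.
  apply: (eq_measurable_fun (fun p : G * 'rV[R]_(n - minn k n) =>
    (1%:M : 'M[R]_n) i j - orthproj (val p.1) i j)) => [p _|].
    by rewrite [in RHS]mxE [X in _ = _ + X]mxE.
  apply: measurable_funB => //.
  exact: (measurableT_comp (measurable_mx_entry i j)).
move=> _ _ [B mB <-]; rewrite !setTI -comp_preimage.
by rewrite -[X in measurable X]setTI; exact: mp.
Qed.

Lemma plane_measureE :
  plane_measure = pushforward (gamma \x lebesgue_rV R (n - minn k n))%E plane_param.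
Proof.
apply/funext => A; apply: eq_integral => xi _ /=.
rewrite (@lebesgue_onE _ _ _ (n - minn k n)%N); last first.
  by rewrite dim_orthc (eqP (valP xi)).
congr (lebesgue_rV _ _ _); apply/seteqP; split => y /=.
  move=> [tau Atau tauE]; rewrite /xsection/= inE/=.
  by rewrite (_ : plane_param _ = tau)//; exact: val_inj.
by rewrite /xsection/= inE/= => ?; exists (plane_param (xi, y)).
Qed.

Let plane_measure_measure : {measure set Pi -> \bar R}.
Proof.
by refine (pushforward (gamma \x lebesgue_rV R (n - minn k n))%E plane_param
  : {measure set Pi -> \bar R}); exact: measurable_plane_param.
Defined.

Let plane_measure0 : plane_measure set0 = 0%E.
Proof. by rewrite plane_measureE (measure0 plane_measure_measure). Qed.
Let plane_measure_ge0 A : (0 <= plane_measure A)%E.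
Proof. by rewrite plane_measureE (measure_ge0 plane_measure_measure). Qed.
Let plane_measure_sigma_additive : semi_sigma_additive plane_measure.
Proof.
rewrite plane_measureE.
exact: (@measure_semi_sigma_additive _ _ _ plane_measure_measure).
Qed.

HB.instance Definition _ := isMeasure.Build _ _ _ plane_measure
  plane_measure0 plane_measure_ge0 plane_measure_sigma_additive.

End affine_plane.

Section weighted_Lp.
Context d (T : measurableType d) (R : realType).
Variables (m : {measure set T -> \bar R}) (p : \bar R) (w : T -> R).

Definition weighted_norm (f : T -> R) : \bar R :=
  Lnorm m p (fun x => (w x * f x)%:E).

Definition weighted_Lp : set (T -> R) :=
  [set f | measurable_fun setT f /\ (weighted_norm f < +oo)%E].

End weighted_Lp.

Section operators.
Context d1 d2 (T1 : measurableType d1) (T2 : measurableType d2) (R : realType).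
Variables (m1 : {measure set T1 -> \bar R}) (m2 : {measure set T2 -> \bar R}).
Variables (p : \bar R) (w1 : T1 -> R) (w2 : T2 -> R).
Variable A : (T1 -> R) -> (T2 -> R).

(** Functions are not quotiented by almost-everywhere equality, hence linearity
    is required almost everywhere; with the last clause it makes [A] well
    defined on classes. *)
Definition bounded_linear_operator : Prop :=
  [/\ forall f, weighted_Lp m1 p w1 f -> weighted_Lp m2 p w2 (A f),
      forall (a b : R) f g, weighted_Lp m1 p w1 f -> weighted_Lp m1 p w1 g ->
        {ae m2, forall t, A (fun x => a * f x + b * g x) t = a * A f t + b * A g t}
    & exists C : R, forall f, weighted_Lp m1 p w1 f ->
        (weighted_norm m2 p w2 (A f) <= C%:E * weighted_norm m1 p w1 f)%E].

Definition operator_norm : \bar R :=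
  ereal_sup [set weighted_norm m2 p w2 (A f) | f in
    [set f | weighted_Lp m1 p w1 f /\ (weighted_norm m1 p w1 f <= 1)%E]].

End operators.

Section kplane.
Variables (R : realType) (n k : nat).

Definition kplane_transform (f : 'rV[R]_n -> R) (tau : affine_plane R n k) : R :=
  \int[lebesgue_on (val (direction tau))]_y f (y + offset tau).

Definition kplane_integrable (f : 'rV[R]_n -> R) (tau : affine_plane R n k) :=
  (lebesgue_on (val (direction tau))).-integrable setT
    (fun y => (f (y + offset tau))%:E).

Definition plane_norm (tau : affine_plane R n k) : R := enorm (offset tau).

End kplane.

Definition Gamma_fun (R : realType) (s : R) : R :=
  \int[lebesgue_measure]_(t in `]0, +oo[) (t `^ (s - 1) * expR (- t)).

(** sigma_(m-1): the argument [m] is the dimension of the ambient space R^m *)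
Definition sphere_area (R : realType) (m : nat) : R :=
  2 * pi `^ (m%:R / 2) / Gamma_fun (m%:R / 2).

(* Main.v *)
(** No Haar measure on O(n) is needed.  For [a > k], the integral of [|x|^-a] over
    a k-plane [tau] is [C(a) |tau|^(k-a)], with
    [C(a) = pi^(k/2) Gamma((a-k)/2) / Gamma(a/2)].  Let [a = mu + n/p].  Hoelder's
    inequality on [tau] with the weight [|x|^-a] bounds [|tau|^(nu p) |R_k f|^p] by
    [C(a)^(p-1) |tau|^(a-n)] times the integral over [tau] of
    [|f|^p |x|^(a(p-1))].  When this is integrated over [tau], Fubini on
    [xi + xi^perp] replaces the factor [|tau|^(a-n)] by the average over [xi] of
    [|P x|^(a-n)], where [P] is the projection onto [xi^perp].  By invariance of
    [dxi] this average is [D |x|^(a-n)], and a Gaussian test function gives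
    [D = sigma_(n-k-1) / sigma_(n-1) * C(a)].  The exponents add up to
    [|x|^(mu p)], whence the upper bound.

    Conversely, if [f] is [|x|^-(a+e)] for [|x| >= 1] and 0 elsewhere, then
    [R_k f = C(a+e) |tau|^(k-a-e)] for [|tau| >= 1], so that the quotient of the
    norms is at least [(sigma_(n-k-1) / sigma_(n-1))^(1/p) C(a+e)]; let [e]
    tend to 0.  For [p = oo] the function [|x|^-mu] is extremal. *)

Require Import Defs.
From HB Require Import structures.
From mathcomp Require Import all_boot all_order all_algebra.
From mathcomp Require Import all_classical all_reals all_analysis.
From mathcomp Require Import measurable_realfun ess_sup_inf ring.
Import Order.TTheory GRing.Theory Num.Theory.
Import numFieldNormedType.Exports.
Local Open Scope classical_set_scope.
Local Open Scope ring_scope.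
Set Implicit Arguments.
Unset Strict Implicit.
Unset Printing Implicit Defensive.

(** * Uniqueness of invariant integrals *)

(** The weight |x|^-a is dictated by the case of equality: for 1 < p < oo, equality in Hoelder's
    inequality on tau wants |f| |x|^a to be constant there, and a = mu + n/p is the exponent for
    which |x|^mu |x|^-a fails to be in L^p(R^n) only logarithmically, at 0 and at infinity. So the
    bound is nearly attained by the same power, cut off near 0 and lowered by e; its norm blows up
    as e tends to 0, but that of its transform blows up at the same rate. The assumption on mu says
    a > k, which is the convergence of C(a). The splitting of dx along xi + xi^perp, polar
    coordinates and the symmetry of dt/t under inversion all come from one principle: two integrals
    invariant under the same group are proportional, and one test function determines the ratio.
    Powers are total, with 0 raised to a nonzero exponent equal to 0, so the law of exponents fails
    at the origin. This is why so many steps pass to almost every point or almost every plane. *)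

(** Uniqueness of Haar measure by Fubini: both sides are equal to the double
    integral of [h (q y) * f (p x + q y)].  The two measures live on arbitrary
    spaces, sent to the abelian group [T] by [p] and [q]. *)
Lemma invariant_integral_unique (R : realType) d (T : measurableType d)
    dX (X : measurableType dX) dY (Y : measurableType dY)
    (al : {sfinite_measure set X -> \bar R})
    (be : {sfinite_measure set Y -> \bar R})
    (add : T -> T -> T) (neg : T -> T)
    (p : X -> T) (q : Y -> T) (w1 : X -> \bar R) (w2 : Y -> \bar R)
    (f h : T -> \bar R) :
  measurable_fun setT (fun ab : T * T => add ab.1 ab.2) ->
  measurable_fun setT neg ->
  (forall a b, add a b = add b a) ->
  (forall a b, add (neg a) (add a b) = b) ->
  measurable_fun setT p -> measurable_fun setT q ->
  measurable_fun setT w1 -> measurable_fun setT w2 ->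
  (forall x, 0 <= w1 x)%E -> (forall y, 0 <= w2 y)%E ->
  (forall t (g : T -> \bar R), measurable_fun setT g -> (forall x, 0 <= g x)%E ->
    \int[al]_x (w1 x * g (add t (p x))) = \int[al]_x (w1 x * g (p x)))%E ->
  (forall t (g : T -> \bar R), measurable_fun setT g -> (forall x, 0 <= g x)%E ->
    \int[be]_y (w2 y * g (add t (q y))) = \int[be]_y (w2 y * g (q y)))%E ->
  measurable_fun setT f -> (forall x, 0 <= f x)%E ->
  measurable_fun setT h -> (forall x, 0 <= h x)%E ->
  (forall a b, h (add (neg a) b) = h (add (neg b) a)) ->
  ((\int[al]_x (w1 x * f (p x))) * (\int[be]_y (w2 y * h (q y))) =
   (\int[be]_y (w2 y * f (q y))) * (\int[al]_x (w1 x * h (p x))))%E.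
Proof.
move=> madd mneg addC addK mp mq mw1 mw2 w10 w20 inv1 inv2 mf f0 mh h0 hsym.
have madd2 d' (Z : measurableType d') (u v : Z -> T) : measurable_fun setT u ->
    measurable_fun setT v -> measurable_fun setT (fun z => add (u z) (v z)).
  move=> mu mv.
  exact: (measurableT_comp madd (measurable_fun_pair mu mv)).
have mfp : measurable_fun setT (f \o p) by exact: measurableT_comp.
have mhp : measurable_fun setT (h \o p) by exact: measurableT_comp.
have mfq : measurable_fun setT (f \o q) by exact: measurableT_comp.
have mhq : measurable_fun setT (h \o q) by exact: measurableT_comp.
have mp1 : measurable_fun setT (fun z : X * Y => p z.1) by exact: measurableT_comp.
have mq2 : measurable_fun setT (fun z : X * Y => q z.2) by exact: measurableT_comp.
have mw11 : measurable_fun setT (fun z : X * Y => w1 z.1) by exact: measurableT_comp.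
have mw22 : measurable_fun setT (fun z : X * Y => w2 z.2) by exact: measurableT_comp.
pose F (z : X * Y) := (w1 z.1 * (w2 z.2 * (h (q z.2) * f (add (p z.1) (q z.2)))))%E.
(* For fixed [x], [G] is [F] with [q y] replaced by [- p x + q y]. As [hsym] reverses the difference
   inside [h], a translation by [- q y] then frees the integral in [x] from [y]. *)
pose G (z : X * Y) := (w1 z.1 * (w2 z.2 * (h (add (neg (p z.1)) (q z.2)) * f (q z.2))))%E.
have mF : measurable_fun setT F.
  apply: emeasurable_funM => //; apply: emeasurable_funM => //.
  apply: emeasurable_funM; first exact: measurableT_comp mh mq2.
  by apply: measurableT_comp mf _; exact: madd2.
have mG : measurable_fun setT G.
  apply: emeasurable_funM => //; apply: emeasurable_funM => //.
  apply: emeasurable_funM; last exact: measurableT_comp mf mq2.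
  by apply: measurableT_comp mh _; apply: madd2 => //; exact: measurableT_comp.
have F0 z : (0 <= F z)%E by rewrite !mule_ge0.
have G0 z : (0 <= G z)%E by rewrite !mule_ge0.
have i0 g : (forall x, 0 <= g x)%E -> (0 <= \int[al]_x (w1 x * g (p x)))%E.
  by move=> g0; apply: integral_ge0 => x _; rewrite mule_ge0.
rewrite muleC -ge0_integralZr//; last 3 first.
- exact: emeasurable_funM.
- by move=> y _; rewrite mule_ge0.
- exact: i0.
transitivity (\int[be]_y \int[al]_x F (x, y))%E.
  apply: eq_integral => y _; rewrite -(inv1 (q y))// -ge0_integralZl//; last 3 first.
  - apply: emeasurable_funM => //; apply: measurableT_comp => //.
    exact: madd2.
  - by move=> x _; rewrite mule_ge0.
  - by rewrite mule_ge0.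
  by apply: eq_integral => x _; rewrite /F/= (addC (q y)) muleCA !muleA.
rewrite -(sfinite_Fubini al be)//.
transitivity (\int[al]_x \int[be]_y G (x, y))%E.
  apply: eq_integral => x _.
  transitivity (w1 x * \int[be]_y (w2 y * (h (q y) * f (add (p x) (q y)))))%E.
    rewrite -ge0_integralZl//.
      apply: emeasurable_funM => //; apply: emeasurable_funM => //.
      by apply: measurableT_comp => //; exact: madd2.
    by move=> y _; rewrite !mule_ge0.
  transitivity (w1 x * \int[be]_y (w2 y * (h (add (neg (p x)) (q y)) * f (q y))))%E; last first.
    rewrite -ge0_integralZl//.
      apply: emeasurable_funM => //; apply: emeasurable_funM => //.
      by apply: measurableT_comp => //; exact: madd2.
    by move=> y _; rewrite !mule_ge0.
  congr (_ * _)%E.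
  rewrite -(inv2 (p x) (fun z => h (add (neg (p x)) z) * f z)%E)//; last 2 first.
  - by apply: emeasurable_funM => //; apply: measurableT_comp => //; exact: madd2.
  - by move=> y; rewrite mule_ge0.
  by apply: eq_integral => y _; rewrite addK.
rewrite (sfinite_Fubini al be)//.
rewrite -ge0_integralZr//; last 3 first.
- exact: emeasurable_funM.
- by move=> y _; rewrite mule_ge0.
- exact: i0.
apply: eq_integral => y _; rewrite -(inv1 (neg (q y)))// -ge0_integralZl//; last 3 first.
- apply: emeasurable_funM => //; apply: measurableT_comp => //.
  exact: madd2.
- by move=> x _; rewrite mule_ge0.
- by rewrite mule_ge0.
apply: eq_integral => x _; rewrite /G/= (hsym (p x)).
set a := f _; set b := h _; set c := w1 _; set e := w2 _.
by rewrite [(b * a)%E]muleC !muleA [(c * e)%E]muleC -!muleA [(c * (_ * _))%E]muleCA.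
Qed.

(** * Lebesgue measure on row vectors *)

Section lebesgue_1d.
Variable R : realType.
Implicit Types (f : R -> \bar R) (c t : R).

(** Uniqueness of Lebesgue measure: [c] times its image under [x |-> c * x + t] gives every
    half-open interval its length. *)
Lemma lebesgue_integral_affine f c t : 0 < c -> measurable_fun setT f ->
  (forall x, 0 <= f x)%E ->
  (\int[lebesgue_measure]_x f x =
   c%:E * \int[lebesgue_measure]_x f (c * x + t)%R)%E.
Proof.
move=> c0 mf f0.
have mphi : measurable_fun setT (fun x : measurableTypeR R => (c * x + t)%R : measurableTypeR R).
  by apply: measurable_funD => //; exact: measurable_funM.
pose phi (x : measurableTypeR R) : measurableTypeR R := (c * x + t)%R.
(* The image is hidden behind an equation so that its measure structure, which rests on [mphi], is
   available to [mscale]. *)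
have pf : {m : {measure set (measurableTypeR R) -> \bar R} |
    m = pushforward (@lebesgue_measure R) phi :> (set (measurableTypeR R) -> \bar R)}.
  unshelve eexists; first by refine (pushforward (@lebesgue_measure R) phi
    : {measure set (measurableTypeR R) -> \bar R}); exact: mphi.
  by [].
have {pf} [pf pfE] := pf.
pose m := mscale (NngNum (ltW c0)) pf.
have mE A : measurable A -> @lebesgue_measure R A = m A.
  apply: lebesgue_measure_unique => _ [[a b]] _ <-.
  transitivity (c%:E * pf `]a, b]%classic)%E; last by [].
  rewrite pfE /pushforward/phi.
  rewrite (_ : _ @^-1` _ = `](a - t) / c, (b - t) / c]%classic); last first.
    apply/seteqP; split => x /=; rewrite !in_itv/= ltr_pdivrMr// ler_pdivlMr// ltrBlDr lerBrDr mulrC //.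
  rewrite !lebesgue_measure_itv/= !lte_fin ltr_pM2r ?invr_gt0// ltrD2r.
  case: ifPn => _; last by rewrite mule0.
  by rewrite -!EFinB -EFinM; congr EFin; field; rewrite gt_eqF.
rewrite (@eq_measure_integral _ _ _ _ m); last by move=> A mA _; exact: mE.
rewrite ge0_integral_mscale//; congr (_ * _)%E.
rewrite (eq_measure_integral (pushforward (@lebesgue_measure R) phi)) => [|A _ _]; last by rewrite pfE.
by rewrite ge0_integral_pushforward.
Qed.

Lemma lebesgue_integral_translate f t : measurable_fun setT f ->
  (forall x, 0 <= f x)%E ->
  (\int[lebesgue_measure]_x f (x + t)%R = \int[lebesgue_measure]_x f x)%E.
Proof.
move=> mf f0; rewrite (@lebesgue_integral_affine f 1 t)// mul1e.
by under [RHS]eq_integral do rewrite mul1r.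
Qed.

End lebesgue_1d.

Section lebesgue_rV_integral.
Variable R : realType.
Implicit Types n : nat.

Lemma integral_rV0 (f : 'rV[R]_0 -> \bar R) : measurable_fun setT f ->
  (\int[lebesgue_rV R 0]_x f x = f 0%R)%E.
Proof.
move=> mf; rewrite /= integral_dirac//.
by rewrite diracE in_setT mul1e.
Qed.

Lemma integral_rVS n (f : 'rV[R]_n.+1 -> \bar R) : measurable_fun setT f ->
  (forall x, 0 <= f x)%E ->
  (\int[lebesgue_rV R n.+1]_x f x =
   \int[lebesgue_rV R n]_x \int[lebesgue_measure]_t f (rV_snoc (x, t)))%E.
Proof.
move=> mf f0.
have ms : measurable_fun (setT : set ('rV[R]_n * measurableTypeR R)) (@rV_snoc R n).
  exact: measurable_rV_snoc.
have h := @ge0_integral_pushforward _ _ _ _ _ _ ms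
  ((lebesgue_rV R n \x @lebesgue_measure R)%E :
   {measure set ('rV[R]_n * measurableTypeR R) -> \bar R}) setT f measurableT mf (fun y _ => f0 y).
apply: (etrans h); rewrite preimage_setT.
apply: (@fubini_tonelli1 _ _ _ _ _ (lebesgue_rV R n) lebesgue_measure (f \o @rV_snoc R n)) => //.
  exact: measurableT_comp.
by move=> x; exact: f0.
Qed.

Lemma measurable_rV_snocT n (g : 'rV[R]_n.+1 -> \bar R) (x : 'rV[R]_n) :
  measurable_fun setT g -> measurable_fun setT (fun t : R => g (rV_snoc (x, t))).
Proof.
move=> mg; apply: measurableT_comp => //.
exact: (measurableT_comp (@measurable_rV_snoc R n) (@measurable_pair1 _ _ _ _ x)).
Qed.

Lemma measurable_int_rV_snoc n (f : 'rV[R]_n.+1 -> \bar R) : measurable_fun setT f ->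
  (forall x, 0 <= f x)%E ->
  measurable_fun setT (fun x => \int[lebesgue_measure]_t f (rV_snoc (x, t)))%E.
Proof.
move=> mf f0.
apply: (@measurable_fun_fubini_tonelli_F _ _ _ _ _ lebesgue_measure (f \o @rV_snoc R n)) => [|x]; last exact: f0.
exact: measurableT_comp (@measurable_rV_snoc R n).
Qed.

Definition rV_init n (v : 'rV[R]_n.+1) : 'rV[R]_n := \row_j v 0 (lift ord_max j).

Lemma rV_snocK n (v : 'rV[R]_n.+1) : rV_snoc (rV_init v, v 0 ord_max) = v.
Proof.
apply/rowP => j; rewrite mxE; case: unliftP => [i ->|->] //=.
by rewrite mxE.
Qed.

Lemma rV_snocD n (x y : 'rV[R]_n) (s t : R) :
  rV_snoc (x, s) + rV_snoc (y, t) = rV_snoc (x + y, s + t).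
Proof. by apply/rowP => j; rewrite !mxE; case: unlift => [i|] /=; rewrite ?mxE. Qed.

Lemma rV_snocZ n c (x : 'rV[R]_n) (t : R) :
  c *: rV_snoc (x, t) = rV_snoc (c *: x, c * t).
Proof. by apply/rowP => j; rewrite !mxE; case: unlift => [i|] /=; rewrite ?mxE. Qed.

Lemma dotv_rV_snoc n (x : 'rV[R]_n) (t : R) :
  dotv (rV_snoc (x, t)) (rV_snoc (x, t)) = dotv x x + t ^+ 2.
Proof.
rewrite /dotv big_ord_recr/= !mxE unlift_none/= expr2; congr (_ + _).
apply: eq_bigr => i _; rewrite (_ : widen_ord _ i = lift ord_max i) ?mxE ?liftK//.
by apply: ord_inj; rewrite lift_max.
Qed.

Lemma measurable_addv n (v : 'rV[R]_n) : measurable_fun setT (fun x : 'rV[R]_n => x + v).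
Proof.
apply: measurable_fun_mxP => i j; under eq_fun do rewrite mxE.
by apply: measurable_funD => //; exact: measurable_mx_entry.
Qed.

Lemma measurable_scalev n (c : R) : measurable_fun setT (fun x : 'rV[R]_n => c *: x).
Proof.
apply: measurable_fun_mxP => i j; under eq_fun do rewrite mxE.
by apply: measurable_funM => //; exact: measurable_mx_entry.
Qed.

Lemma integral_rV_translate n (f : 'rV[R]_n -> \bar R) v : measurable_fun setT f ->
  (forall x, 0 <= f x)%E ->
  (\int[lebesgue_rV R n]_x f (x + v)%R = \int[lebesgue_rV R n]_x f x)%E.
Proof.
elim: n f v => [|n IH] f v mf f0.
  by apply: eq_integral => x _; congr f; apply/rowP => -[].
have mfv : measurable_fun setT (fun x : 'rV[R]_n.+1 => f (x + v)).
  by apply: measurableT_comp => //; exact: measurable_addv.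
rewrite (integral_rVS mfv (fun x => f0 (x + v))) (integral_rVS mf f0) -[RHS](IH _ (rV_init v)); last 2 first.
- exact: measurable_int_rV_snoc.
- by move=> x; exact: integral_ge0.
apply: eq_integral => x _.
rewrite -(@lebesgue_integral_translate _ (fun t => f (rV_snoc (x + rV_init v, t))) (v 0 ord_max))//; last exact: measurable_rV_snocT.
by apply: eq_integral => t _; rewrite -rV_snocD rV_snocK.
Qed.

Lemma integral_rV_scale n (f : 'rV[R]_n -> \bar R) c : 0 < c ->
  measurable_fun setT f -> (forall x, 0 <= f x)%E ->
  (\int[lebesgue_rV R n]_x f x =
   (c ^+ n)%:E * \int[lebesgue_rV R n]_x f (c *: x)%R)%E.
Proof.
move=> c0; elim: n f => [|n IH] f mf f0.
  rewrite expr0 mul1e; apply: eq_integral => x _; congr f; apply/rowP => -[]//.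
have mfv : measurable_fun setT (fun x : 'rV[R]_n.+1 => f (c *: x)).
  by apply: measurableT_comp => //; exact: measurable_scalev.
rewrite !integral_rVS// IH; last 2 first.
- exact: (measurable_int_rV_snoc mf).
- by move=> x; exact: integral_ge0.
rewrite exprSr EFinM -muleA; congr (_ * _)%E.
rewrite -ge0_integralZl//; last 3 first.
- exact: (measurable_int_rV_snoc mfv).
- by move=> x _; exact: integral_ge0.
- by rewrite lee_fin ltW.
apply: eq_integral => x _.
rewrite (@lebesgue_integral_affine _ (fun t => f (rV_snoc (c *: x, t))) c 0)//; last exact: measurable_rV_snocT.
by congr (_ * _)%E; apply: eq_integral => t _; rewrite rV_snocZ addr0.
Qed.

Definition gaussv n (x : 'rV[R]_n) : \bar R := (expR (- dotv x x))%:E.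

Lemma gaussv_ge0 n (x : 'rV[R]_n) : (0 <= gaussv x)%E.
Proof. by rewrite lee_fin expR_ge0. Qed.

Lemma measurable_gaussv n : measurable_fun setT (@gaussv n).
Proof.
apply/measurable_EFinP; apply: measurableT_comp => //.
by apply: measurableT_comp => //; exact: measurable_dotv.
Qed.

Lemma integral_gaussv n :
  (\int[lebesgue_rV R n]_x gaussv x = (pi `^ (n%:R / 2))%:E)%E.
Proof.
elim: n => [|n IH].
  rewrite integral_rV0; last exact: measurable_gaussv.
  by rewrite mul0r powRr0 /gaussv dotv0r oppr0 expR0.
rewrite integral_rVS//; [|exact: measurable_gaussv|exact: gaussv_ge0].
transitivity (\int[lebesgue_rV R n]_x (gaussv x * (Num.sqrt pi)%:E))%E.
  apply: eq_integral => x _; rewrite -integralT_gauss -ge0_integralZl//.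
  - by apply: eq_integral => t _; rewrite /gaussv dotv_rV_snoc opprD expRD EFinM.
  - by apply/measurable_EFinP; exact: measurable_gauss_fun.
  - by move=> t _; rewrite lee_fin gauss_fun_ge0.
  - exact: gaussv_ge0.
rewrite (@ge0_integralZr _ _ _ (lebesgue_rV R n) setT measurableT (@gaussv n))//.
- rewrite IH -EFinM -powR12_sqrt ?pi_ge0// -powRD ?pi_neq0//; last first.
    by rewrite gt_eqF ?pi_gt0// implybT.
  by rewrite -[n.+1%:R]natr1 mulrDl mul1r.
- exact: measurable_gaussv.
- by move=> x _; exact: gaussv_ge0.
Qed.

Lemma integral_gaussv_scale n (c : R) : 0 < c ->
  (\int[lebesgue_rV R n]_x (expR (- (c * dotv x x)))%:E =
   ((pi / c) `^ (n%:R / 2))%:E)%E.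
Proof.
move=> c0; have s0 : 0 < Num.sqrt c by rewrite sqrtr_gt0.
have := @integral_rV_scale n (@gaussv n) (Num.sqrt c) s0 (@measurable_gaussv n) (@gaussv_ge0 n).
rewrite integral_gaussv.
rewrite (_ : \int[lebesgue_rV R n]_x gaussv (Num.sqrt c *: x)%R =
   \int[lebesgue_rV R n]_x (expR (- (c * dotv x x)))%:E)%E; last first.
  apply: eq_integral => x _; rewrite /gaussv dotvZr dotvC dotvZr mulrA -expr2.
  by rewrite sqr_sqrtr// ltW.
move=> /(congr1 (fun z => ((Num.sqrt c ^- n)%:E * z)%E)).
rewrite [in RHS]muleA -[in RHS]EFinM mulVf ?mul1e; last by rewrite expf_neq0// gt_eqF.
move=> <-; congr EFin; rewrite powRM ?pi_ge0 ?invr_ge0 ?(ltW c0)// mulrC; congr (_ * _).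
rewrite -powR_inv1 ?ltW// -powRrM mulN1r powRN; congr (_^-1).
by rewrite -powR12_sqrt ?ltW// -powR_mulrn ?powR_ge0// -powRrM mulrC.
Qed.

Lemma measurable_rV_set0 n : measurable [set 0 : 'rV[R]_n].
Proof.
rewrite (_ : [set 0] = (fun x : 'rV[R]_n => dotv x x) @^-1` [set 0]).
  by rewrite -[X in measurable X]setTI; apply: measurable_dotv.
by apply/seteqP; split => x /=; [move=> ->; rewrite dotv0r|move/eqP; rewrite dotv_eq0 => /eqP].
Qed.

(** The origin lies in the hyperplane where the last coordinate vanishes, a product with a null
    factor. In dimension 0 the measure is a Dirac mass and the origin has mass 1. *)
Lemma lebesgue_rV_set0 n : (0 < n)%N -> lebesgue_rV R n [set 0] = 0%E.
Proof.
case: n => // n _; apply/eqP; rewrite eq_le measure_ge0 andbT.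
apply: (@le_trans _ _ ((lebesgue_rV R n \x lebesgue_measure)%E
  (setT `*` [set 0] : set ('rV[R]_n * measurableTypeR R)))); last first.
  rewrite product_measure1E// [X in (_ * X)%E](_ : _ = 0%E) ?mule0//.
  exact: lebesgue_measure_set1.
change ((lebesgue_rV R n \x lebesgue_measure)%E (@rV_snoc R n @^-1` [set 0%R : 'rV[R]_n.+1]) <=
  (lebesgue_rV R n \x lebesgue_measure)%E
  (setT `*` [set 0%R] : set ('rV[R]_n * measurableTypeR R)))%E.
apply: le_measure; rewrite ?inE.
- rewrite -[X in measurable X]setTI; apply: measurable_rV_snoc => //.
  exact: measurable_rV_set0.
- exact: measurableX.
- move=> [x t] /= /rowP/(_ ord_max); rewrite !mxE unlift_none/= => ->.
  by [].
Qed.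

End lebesgue_rV_integral.

(** * Splitting Lebesgue measure along a subspace and its orthogonal complement *)

Section split.
Variable R : realType.
Implicit Types n k m : nat.

Lemma dotv_mx n (u v : 'rV[R]_n) : dotv u v = (u *m v^T) 0 0.
Proof. by rewrite mxE; apply: eq_bigr => i _; rewrite mxE. Qed.

Lemma dim_orthc_eq n k (U : {vspace 'rV[R]_n}) : \dim U = k -> \dim (orthc U) = (n - k)%N.
Proof. by move=> <-; exact: dim_orthc. Qed.

Lemma onb_orthonormal n k (U : {vspace 'rV[R]_n}) : \dim U = k ->
  onb k U *m (onb k U)^T = 1%:M.
Proof. by move=> <-; case: (onbP U). Qed.

Lemma onb_span n k (U : {vspace 'rV[R]_n}) u : \dim U = k -> u \in U ->
  exists y : 'rV_k, u = y *m onb k U.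
Proof. by move=> <-; case: (onbP U) => _ /(_ u) [+ _]. Qed.

Lemma onb_orthcr n k m (U : {vspace 'rV[R]_n}) :
  onb k U *m (onb m (orthc U))^T = 0.
Proof.
apply/matrixP => i j; rewrite [RHS]mxE.
transitivity (dotv (row i (onb k U)) (row j (onb m (orthc U)))).
  by rewrite dotv_mx tr_row -row_mul !mxE; apply: eq_bigr => l _; rewrite !mxE.
have h l (V : {vspace 'rV[R]_n}) (s : 'I_l) : row s (onb l V) \in V.
  by rewrite rowE onb_mem.
by have /mem_orthc := h m (orthc U) j; apply; exact: h.
Qed.

Lemma onb_orthcl n k m (U : {vspace 'rV[R]_n}) :
  onb m (orthc U) *m (onb k U)^T = 0.
Proof. by apply: trmx_inj; rewrite trmx_mul trmxK onb_orthcr trmx0. Qed.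

Lemma dotv_onb n k m (U : {vspace 'rV[R]_n}) (y : 'rV_k) (u : 'rV_m) :
  \dim U = k -> \dim (orthc U) = m ->
  dotv (y *m onb k U + u *m onb m (orthc U)) (y *m onb k U + u *m onb m (orthc U)) =
  dotv y y + dotv u u.
Proof.
move=> dk dm; rewrite !dotv_mx linearD/= !trmx_mul mulmxDl !mulmxDr !mulmxA.
rewrite -[y *m onb k U *m _]mulmxA -[u *m onb m _ *m (onb m _)^T]mulmxA.
rewrite -[y *m onb k U *m (onb m _)^T]mulmxA -[u *m onb m _ *m (onb k U)^T]mulmxA.
by rewrite !onb_orthonormal// onb_orthcr onb_orthcl !mulmx0 !mul0mx !mulmx1 addr0 add0r mxE.
Qed.

Lemma measurable_mulmx_cst d (T : measurableType d) n k (A : 'M[R]_(k, n)) (f : T -> 'rV[R]_k) :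
  measurable_fun setT f -> measurable_fun setT (fun x => f x *m A).
Proof. by move=> mf; exact: measurable_mulmx. Qed.

Lemma measurable_addmx d (T : measurableType d) n (f g : T -> 'rV[R]_n) :
  measurable_fun setT f -> measurable_fun setT g ->
  measurable_fun setT (fun x => f x + g x).
Proof.
move=> mf mg; apply: measurable_fun_mxP => i j; under eq_fun do rewrite mxE.
apply: measurable_funD.
  exact: measurableT_comp (measurable_mx_entry i j) mf.
exact: measurableT_comp (measurable_mx_entry i j) mg.
Qed.

Lemma measurable_oppmx n : measurable_fun setT (fun x : 'rV[R]_n => - x).
Proof.
apply: measurable_fun_mxP => i j; under eq_fun do rewrite mxE.
by apply: measurableT_comp => //; exact: measurable_mx_entry.
Qed.

(** Both sides are translation invariant and they agree on the Gaussian. *)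
Lemma integral_rV_split n k m (U : {vspace 'rV[R]_n}) (f : 'rV[R]_n -> \bar R) :
  \dim U = k -> \dim (orthc U) = m ->
  measurable_fun setT f -> (forall x, 0 <= f x)%E ->
  (\int[lebesgue_rV R n]_x f x =
   \int[lebesgue_rV R m]_u \int[lebesgue_rV R k]_y
     f (y *m onb k U + u *m onb m (orthc U))%R)%E.
Proof.
move=> dk dm mf f0.
(* The product is repacked as a sigma-finite measure because [invariant_integral_unique] asks for an
   s-finite one. *)
pose P : {sigma_finite_measure set ('rV[R]_m * 'rV[R]_k)%type -> \bar R} :=
  HB.pack (lebesgue_rV R m \x lebesgue_rV R k)%E
   (Measure_isSigmaFinite.Build _ _ _ (lebesgue_rV R m \x lebesgue_rV R k)%E
     (sigma_finite_prod (lebesgue_rV R m) (lebesgue_rV R k))).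
pose p (z : ('rV[R]_m * 'rV[R]_k)%type) := z.2 *m onb k U + z.1 *m onb m (orthc U).
have mp : measurable_fun setT p.
  by apply: measurable_addmx; apply: measurable_mulmx_cst.
have PE (g : 'rV[R]_n -> \bar R) : measurable_fun setT g -> (forall x, 0 <= g x)%E ->
    (\int[P]_z g (p z) = \int[lebesgue_rV R m]_u \int[lebesgue_rV R k]_y g (p (u, y)))%E.
  move=> mg g0.
  apply: (@fubini_tonelli1 _ _ _ _ _ (lebesgue_rV R m) (lebesgue_rV R k) (g \o p)) => [|x]; last exact: g0.
  exact: measurableT_comp.
have mpu u : measurable_fun setT (fun y => p (u, y)).
  exact: (measurableT_comp mp (@measurable_pair1 _ _ _ _ u)).
have trP t (g : 'rV[R]_n -> \bar R) : measurable_fun setT g -> (forall x, 0 <= g x)%E ->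
    (\int[P]_z (1 * g (t + p z)%R) = \int[P]_z (1 * g (p z)))%E.
  move=> mg g0; under eq_integral do rewrite mul1e.
  under [RHS]eq_integral do rewrite mul1e.
  (* Translating by [t] shifts the coordinates in [U] and in [orthc U] separately, so the invariance
     of the two factors suffices. *)
  have [y tU] : exists y, daddv_pi U (orthc U) t = y *m onb k U.
    by apply: onb_span => //; exact: memv_pi.
  have [u tV] : exists u, daddv_pi (orthc U) U t = u *m onb m (orthc U).
    by apply: onb_span => //; exact: memv_pi.
  have tE : t = y *m onb k U + u *m onb m (orthc U).
    by rewrite -tU -tV daddv_pi_add ?orthc_cap// orthc_add memvf.
  have mtg : measurable_fun setT (fun x => g (t + x)).
    apply: measurableT_comp => //; exact: measurable_addmx.
  apply: (etrans (PE _ mtg (fun x => g0 (t + x)))); apply/esym.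
  apply: (etrans (PE _ mg g0)); apply/esym => /=.
  rewrite -(@integral_rV_translate _ _ (fun v => \int[lebesgue_rV R k]_y0 g (p (v, y0)))%E u); last 2 first.
  - apply: (@measurable_fun_fubini_tonelli_F _ _ _ _ _ (lebesgue_rV R k) (g \o p)) => [|x]; last exact: g0.
    exact: measurableT_comp.
  - by move=> v; exact: integral_ge0.
  apply: eq_integral => v _.
  rewrite -[RHS](@integral_rV_translate _ _ (fun y0 => g (p (v + u, y0))) y)//; last first.
    by apply: measurableT_comp => //; exact: mpu.
  apply: eq_integral => w _; congr g; rewrite tE /p/= !mulmxDl.
  by rewrite addrC addrACA.
have trn t (g : 'rV[R]_n -> \bar R) : measurable_fun setT g -> (forall x, 0 <= g x)%E ->
    (\int[lebesgue_rV R n]_z (1 * g (t + z)%R) = \int[lebesgue_rV R n]_z (1 * g z))%E.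
  move=> mg g0; under eq_integral do rewrite mul1e.
  under [RHS]eq_integral do rewrite mul1e.
  rewrite -[RHS](@integral_rV_translate _ _ g t)//.
  by apply: eq_integral => x _; rewrite addrC.
have gsym (a b : 'rV[R]_n) : gaussv (- a + b) = gaussv (- b + a).
  rewrite /gaussv; congr (expR (- _))%:E.
  have -> : - a + b = - (- b + a) by rewrite opprD opprK addrC.
  by rewrite dotvNr dotvC dotvNr opprK.
have gP : (\int[lebesgue_rV R m]_u \int[lebesgue_rV R k]_y gaussv (p (u, y)) =
    (pi `^ (n%:R / 2))%:E)%E.
  transitivity (\int[lebesgue_rV R m]_u (gaussv u * (pi `^ (k%:R / 2))%:E))%E.
    apply: eq_integral => u _; rewrite -integral_gaussv -ge0_integralZl//.
    - apply: eq_integral => y _; rewrite /gaussv /p/= dotv_onb//.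
      by rewrite opprD expRD EFinM muleC.
    - exact: measurable_gaussv.
    - by move=> y _; exact: gaussv_ge0.
    - exact: gaussv_ge0.
  rewrite (@ge0_integralZr _ _ _ (lebesgue_rV R m) setT measurableT (@gaussv R m))//.
  - rewrite integral_gaussv -EFinM -powRD; last by rewrite (gt_eqF (pi_gt0 R)) implybT.
    rewrite -mulrDl -natrD addnC.
    have <- : (k + m)%N = n by rewrite -dm (dim_orthc_eq dk) subnKC// -dk -[n in (_ <= n)%N](@dim_rV R) dimvS// subvf.
    by [].
  - exact: measurable_gaussv.
  - by move=> x _; exact: gaussv_ge0.
  - by rewrite lee_fin powR_ge0.
have h : ((\int[P]_z (1 * f (p z))) * (\int[lebesgue_rV R n]_x (1 * gaussv x)) =
    (\int[lebesgue_rV R n]_x (1 * f x)) * (\int[P]_z (1 * gaussv (p z))))%E.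
  apply: (@invariant_integral_unique R _ _ _ _ _ _ P (lebesgue_rV R n) (fun a b : 'rV[R]_n => a + b)
    (fun a => - a) p id (fun=> 1%E) (fun=> 1%E) f (@gaussv R n)) => //.
  - exact: measurable_addmx.
  - exact: measurable_oppmx.
  - exact: addrC.
  - by move=> a b; rewrite addKr.
  - exact: measurable_gaussv.
  - exact: gaussv_ge0.
have c0 : 0 < pi `^ (n%:R / 2) :> R by apply/powR_gt0/pi_gt0.
have e1 d (T : measurableType d) (mu : {measure set T -> \bar R}) (g : T -> \bar R) :
    (\int[mu]_x (1 * g x) = \int[mu]_x g x)%E.
  by apply: eq_integral => x _; rewrite mul1e.
move: h; rewrite (e1 _ _ P (f \o p)) (e1 _ _ P (@gaussv R n \o p)).
rewrite (e1 _ _ (lebesgue_rV R n) f) (e1 _ _ (lebesgue_rV R n) (@gaussv R n)).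
rewrite integral_gaussv (PE f)// (PE (@gaussv R n)); last 2 first.
- exact: measurable_gaussv.
- exact: gaussv_ge0.
rewrite gP => /(congr1 (fun z => z * ((pi `^ (n%:R / 2))^-1)%:E)%E).
by rewrite -!muleA -EFinM divff ?gt_eqF// !mule1.
Qed.

End split.

(** * The measure dt/t, polar coordinates and the Gamma function *)

Section multiplicative_integral.
Variable R : realType.
Implicit Types (F G : R -> \bar R) (c s t : R).

(** Density of dt/t, the Haar measure of the positive reals under multiplication. Its value 0 for
    [t <= 0] lets integrals run over the whole line. *)
Definition mweight t : \bar R := (if 0 < t then t^-1 else 0)%:E.

Definition mint F : \bar R := (\int[lebesgue_measure]_t (mweight t * F t))%E.

Lemma mweight_ge0 t : (0 <= mweight t)%E.
Proof. by rewrite /mweight lee_fin; case: ifP => // /ltW; rewrite invr_ge0. Qed.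

Lemma measurable_invr : measurable_fun setT (fun t : R => t^-1).
Proof.
rewrite (_ : (fun _ => _) = fun t : R => if 0 <= t then t `^ (-1) else - ((- t) `^ (-1))).
  apply: measurable_fun_ifT.
  - exact: measurable_fun_ler.
  - exact: measurable_powR.
  - apply: measurableT_comp => //; apply: (measurableT_comp (measurable_powR _)).
    exact: (@oppr_measurable R setT).
apply/funext => t; case: ifPn => [t0|]; first by rewrite powR_inv1.
by rewrite -ltNge => t0; rewrite powR_inv1 ?oppr_ge0 ?ltW// invrN opprK.
Qed.

Lemma measurable_mweight : measurable_fun setT mweight.
Proof.
apply/measurable_EFinP; apply: measurable_fun_ifT => //.
- exact: measurable_fun_ltr.
- exact: measurable_invr.
Qed.

Lemma mint_itv F : mint F = (\int[lebesgue_measure]_(t in `]0%R, +oo[) ((t^-1)%:E * F t))%E.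
Proof.
rewrite integral_mkcond; apply: eq_integral => t _.
rewrite patchE mem_setE in_itv/= andbT /mweight; case: ifP => // _.
by rewrite mul0e.
Qed.

Lemma eq_mint F G : (forall t, 0 < t -> F t = G t) -> mint F = mint G.
Proof.
move=> FG; apply: eq_integral => t _; rewrite /mweight; case: ifPn => [/FG ->//|_].
by rewrite !mul0e.
Qed.

Lemma le_mint F G : measurable_fun setT F -> measurable_fun setT G ->
  (forall t, 0 <= F t)%E -> (forall t, (0 < t)%R -> F t <= G t)%E ->
  (forall t, 0 <= G t)%E -> (mint F <= mint G)%E.
Proof.
move=> mF mG F0 FG G0; apply: ge0_le_integral => //.
- by move=> t _; rewrite mule_ge0// mweight_ge0.
- by apply: emeasurable_funM => //; exact: measurable_mweight.
- by apply: emeasurable_funM => //; exact: measurable_mweight.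
- move=> t _; rewrite /mweight; case: ifPn => t0; last by rewrite !mul0e.
  by apply: lee_wpmul2l; [rewrite lee_fin invr_ge0 ltW|exact: FG].
Qed.

Lemma mint_scale F c : 0 < c -> measurable_fun setT F -> (forall t, 0 <= F t)%E ->
  mint (fun t => F (c * t)) = mint F.
Proof.
move=> c0 mF F0; rewrite [RHS]/mint (@lebesgue_integral_affine _ _ c 0)//; last 2 first.
- by apply: emeasurable_funM => //; exact: measurable_mweight.
- by move=> t; rewrite mule_ge0// mweight_ge0.
rewrite -ge0_integralZl//; last 3 first.
- apply: emeasurable_funM.
    apply: (measurableT_comp measurable_mweight).
    by apply: measurable_funD => //; exact: measurable_funM.
  apply: (measurableT_comp mF).
  by apply: measurable_funD => //; exact: measurable_funM.
- by move=> t _; rewrite mule_ge0// mweight_ge0.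
- by rewrite lee_fin ltW.
apply: eq_integral => t _; rewrite addr0 muleA; congr (_ * _)%E.
rewrite /mweight pmulr_rgt0// -EFinM; congr EFin; case: ifP => _; last by rewrite mulr0.
by rewrite invfM mulrA divff ?gt_eqF// mul1r.
Qed.

(** An even function, as required of the test function [h] of
    [invariant_integral_unique]. *)
Definition mtest t : \bar R := (`|t| <= 1)%R%:R%:E.

Lemma measurable_mtest : measurable_fun setT mtest.
Proof.
apply/measurable_EFinP.
rewrite (_ : (fun _ => _) = fun t : R => if `|t| <= 1 then 1 else 0); last first.
  by apply/funext => t; case: ifP.
apply: measurable_fun_ifT => //; apply: measurable_fun_ler => //.
Qed.

Lemma mtest_ge0 t : (0 <= mtest t)%E. Proof. by rewrite lee_fin ler0n. Qed.

(** With [mint_mtest_fin], this allows the mass of the test function to be cancelled. On [1, e] the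
    test function is 1 and the density is at least 1/e. *)
Lemma mint_mtest_gt0 : (0 < mint (mtest \o @ln R))%E.
Proof.
apply: (@lt_le_trans _ _ (\int[lebesgue_measure]_(t in `[1%R, expR 1]) (expR (- 1)%R)%:E)%E).
  rewrite integral_cst//= lebesgue_measure_itv/= lte_fin expR_gt1 ltr01.
  by rewrite -EFinB -EFinM lte_fin mulr_gt0 ?expR_gt0// subr_gt0 expR_gt1.
rewrite integral_mkcond; apply: ge0_le_integral => //.
- by move=> t _; rewrite patchE; case: ifP; rewrite // lee_fin expR_ge0.
- by apply/(measurable_restrictT _ _).1.
- apply: emeasurable_funM; first exact: measurable_mweight.
  by apply: (measurableT_comp measurable_mtest); exact: measurable_ln.
- move=> t _; rewrite patchE mem_setE in_itv/=; case: ifPn => [/andP[t1 te]|_].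
    have t0 : 0 < t by rewrite (lt_le_trans ltr01).
    rewrite /mweight t0 /mtest/= ger0_norm ?ln_ge0//.
    have -> : ln t <= 1 by rewrite -(expRK 1) ler_ln ?posrE ?expR_gt0.
    by rewrite mule1 lee_fin expRN lef_pV2 ?posrE ?expR_gt0.
  by rewrite mule_ge0 ?mweight_ge0// mtest_ge0.
Qed.

Lemma ln_le1E t : 0 < t -> (`|ln t| <= 1) = (expR (-1) <= t <= expR 1).
Proof.
move=> t0; rewrite ler_norml; congr andb.
  by rewrite -[X in _ = (_ <= X)]lnK ?posrE// ler_expR.
by rewrite -[X in _ = (X <= _)]lnK ?posrE// ler_expR.
Qed.

Lemma mint_mtest_fin : (mint (mtest \o @ln R) < +oo)%E.
Proof.
apply: (@le_lt_trans _ _ (\int[lebesgue_measure]_(t in `[0%R, expR 1]) (expR 1%R)%:E)%E); last first.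
  by rewrite integral_cst//= lebesgue_measure_itv/= lte_fin expR_gt0 -EFinB -EFinM ltry.
rewrite [leRHS]integral_mkcond; apply: ge0_le_integral => //.
- by move=> t _; rewrite mule_ge0 ?mweight_ge0// mtest_ge0.
- apply: emeasurable_funM; first exact: measurable_mweight.
  by apply: (measurableT_comp measurable_mtest); exact: measurable_ln.
- by apply/(measurable_restrictT _ _).1.
- move=> t _; rewrite patchE mem_setE in_itv/= /mweight /mtest/=.
  case: ifPn => t0; last by rewrite mul0e; case: ifP => _; rewrite // lee_fin expR_ge0.
  rewrite ln_le1E// (ltW t0)/=; case: (leP t) => te; last by rewrite andbF mule0.
  rewrite andbT; case: (leP (expR (-1)) t) => et; last by rewrite mule0 lee_fin expR_ge0.
  rewrite mule1 lee_fin -[leRHS]invrK lef_pV2 ?posrE ?invr_gt0 ?expR_gt0//.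
  by rewrite -expRN.
Qed.

(** Logarithms turn dilations into translations of the line: this is [invariant_integral_unique] for
    the maps [ln (N x)] and [ln t] and the function [F \o expR]. The alternative in the hypotheses
    guarantees [expR (ln (N x)) = N x] wherever the weight is not 0. *)
Lemma scale_invariant_integral d (X : measurableType d)
    (al : {sfinite_measure set X -> \bar R}) (w : X -> \bar R) (N : X -> R) F :
  measurable_fun setT w -> (forall x, 0 <= w x)%E -> measurable_fun setT N ->
  (forall x, w x = 0%E \/ 0 < N x) ->
  (forall c G, (0 < c)%R -> measurable_fun setT G -> (forall t, 0 <= G t)%E ->
    \int[al]_x (w x * G (c * N x)%R) = \int[al]_x (w x * G (N x)))%E ->
  measurable_fun setT F -> (forall t, 0 <= F t)%E ->
  ((\int[al]_x (w x * F (N x))) * mint (mtest \o @ln R) =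
   mint F * \int[al]_x (w x * mtest (ln (N x))))%E.
Proof.
move=> mw w0 mN wN inv mF F0.
have h := @invariant_integral_unique R _ (measurableTypeR R) _ X _ (measurableTypeR R) al lebesgue_measure
  (fun a b : R => a + b) (fun a => - a) (fun x => ln (N x)) (@ln R) w mweight
  (F \o expR) mtest.
have mlN : measurable_fun setT (fun x => ln (N x)).
  by apply: (measurableT_comp (@measurable_ln R)).
have e1 : (\int[al]_x (w x * F (N x)) = \int[al]_x (w x * (F \o expR) (ln (N x))))%E.
  apply: eq_integral => x _; have [->|N0] := wN x; first by rewrite !mul0e.
  by rewrite /= lnK.
have e2 : (mint F = \int[lebesgue_measure]_x (mweight x * (F \o expR) (ln x)))%E.
  by apply: eq_mint => t t0; rewrite /= lnK.
rewrite e1 e2; apply: h => //.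
- by apply: measurable_funD.
- exact: (@oppr_measurable R setT).
- exact: addrC.
- by move=> a b; rewrite addKr.
- exact: measurable_mweight.
- exact: mweight_ge0.
- move=> t g mg g0.
  have mgl := measurableT_comp (mg : measurable_fun (setT : set R) g) (@measurable_ln R).
  rewrite -(inv (expR t) (g \o @ln R)) ?expR_gt0//; last by move=> z; exact: g0.
  apply: eq_integral => x _; have [->|N0] := wN x; first by rewrite !mul0e.
  by rewrite /= lnM ?posrE ?expR_gt0// expRK.
- move=> t g mg g0.
  have mgl := measurableT_comp (mg : measurable_fun (setT : set R) g) (@measurable_ln R).
  rewrite -[RHS](@mint_scale (g \o @ln R) (expR t)) ?expR_gt0//; last by move=> z; exact: g0.
  by apply: eq_mint => x x0; rewrite /= lnM ?posrE ?expR_gt0// expRK.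
- apply: (measurableT_comp mF); exact: measurable_expR.
- by move=> x; exact: F0.
- exact: measurable_mtest.
- exact: mtest_ge0.
- by move=> a b; rewrite /mtest -normrN opprD opprK addrC.
Qed.

(** The integral of [F (1/t)] against dt/t is again scale invariant, hence proportional to [mint F].
    The ratio is 1 because [ln (1/t) = - ln t] and [mtest] is even. *)
Lemma mint_inv F : measurable_fun setT F -> (forall t, 0 <= F t)%E ->
  mint (fun t => F (t^-1)) = mint F.
Proof.
move=> mF F0.
have := @scale_invariant_integral _ (measurableTypeR R) lebesgue_measure mweight (fun t : R => t^-1) F.
have -> : (\int[lebesgue_measure]_x (mweight x * mtest (ln (x^-1)%R)) = mint (mtest \o @ln R))%E.
  by apply: eq_mint => t t0; rewrite /= lnV// /mtest normrN.
have M0 := mint_mtest_gt0; have Moo := mint_mtest_fin.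
have Mfin : mint (mtest \o @ln R) \is a fin_num by rewrite ge0_fin_numE// ltW.
move=> h; have {}h : (mint (fun t => F (t^-1)%R) * mint (mtest \o @ln R) = mint F * mint (mtest \o @ln R))%E.
  apply: h => //.
  - exact: measurable_mweight.
  - exact: mweight_ge0.
  - exact: measurable_invr.
  - by move=> x; rewrite /mweight; case: ifPn => x0; [right; rewrite invr_gt0|left].
  - move=> c G c0 mG G0.
    rewrite -[RHS](@mint_scale (fun t => G (t^-1)) c^-1) ?invr_gt0//; last first.
      by apply: measurableT_comp mG _; exact: measurable_invr.
    by apply: eq_mint => t t0; rewrite invfM invrK.
move: h; rewrite -(fineK Mfin) => /(congr1 (fun z => z * ((fine (mint (mtest \o @ln R)))^-1)%:E)%E).
by rewrite -!muleA -EFinM divff ?mule1// gt_eqF// fine_gt0// M0.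
Qed.

Lemma cvg_powRN_pinfty (r : R) : 0 < r -> t `^ (- r) @[t --> +oo%R] --> (0 : R).
Proof.
move=> r0; apply/cvgrPdist_lt => e e0.
near=> t.
have t0 : 0 < t by near: t; exact: nbhs_pinfty_gt.
rewrite sub0r normrN ger0_norm ?powR_ge0//.
rewrite powRN invf_plt ?posrE ?powR_gt0//.
have : (e^-1) `^ (r^-1) < t by near: t; exact: nbhs_pinfty_gt.
move=> /(gt0_ltr_powR r0); rewrite !nnegrE powR_ge0 (ltW t0) => /(_ isT isT).
by rewrite -powRrM mulVf ?gt_eqF// powRr1 ?invr_ge0 ?ltW.
Unshelve. all: by end_near. Qed.

Lemma mint_powRN_ge1 (r : R) : 0 < r ->
  mint (fun t => (if 1 <= t then t `^ (- r) else 0)%:E) = (r^-1)%:E.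
Proof.
move=> r0.
transitivity (\int[lebesgue_measure]_(t in `[1%R, +oo[) (t `^ (- r - 1))%:E)%E.
  rewrite [RHS]integral_mkcond; apply: eq_integral => t _.
  rewrite patchE mem_setE in_itv/= andbT; case: ifPn => t1; last by rewrite mule0.
  have t0 : 0 < t by rewrite (lt_le_trans ltr01).
  rewrite /mweight t0 -EFinM; congr EFin; rewrite powRB ?(gt_eqF t0) ?implybT//.
  by rewrite powRr1 ?ltW// mulrC.
apply: (etrans (@ge0_continuous_FTC2y R (fun t => t `^ (- r - 1)) (fun t => - r^-1 * t `^ (- r)) 1 0 _ _ _ _ _ _)).
- by move=> t _; rewrite powR_ge0.
- apply: derivable_within_continuous => t; rewrite in_itv/= andbT => t1.
  by apply: derivable_powR; rewrite in_itv/= andbT (lt_le_trans ltr01).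
- rewrite -[X in _ --> X](mulr0 (- r^-1)); apply: cvgMr; exact: cvg_powRN_pinfty.
- move=> t t1; apply: derivableM => //; apply: derivable_powR.
  by rewrite in_itv/= andbT (lt_trans ltr01).
- apply: cvgMr; apply: cvg_at_right_filter.
  have : {for 1, continuous (fun t : R => t `^ (- r))}; last by [].
  apply: differentiable_continuous; apply/derivable1_diffP.
  by apply: derivable_powR; rewrite in_itv/= andbT.
- move=> t; rewrite in_itv/= andbT => t1; have t0 := lt_trans ltr01 t1.
  rewrite derive1E deriveM//; last by apply: derivable_powR; rewrite in_itv/= andbT.
  rewrite derive_cst scaler0 addr0 -derive1E powR_derive1 ?in_itv/= ?andbT//.
  by rewrite /GRing.scale/= mulrA mulrNN mulVf ?gt_eqF// mul1r.
- by rewrite powR1 mulr1 sub0e -EFinN opprK.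
Qed.

Lemma mint_powR_le1 (r : R) : 0 < r ->
  mint (fun t => (if t <= 1 then t `^ r else 0)%:E) = (r^-1)%:E.
Proof.
move=> r0; rewrite -(mint_powRN_ge1 r0) -[RHS]mint_inv; last 2 first.
- apply/measurable_EFinP; apply: measurable_fun_ifT => //; first exact: measurable_fun_ler.
- by move=> t; rewrite lee_fin; case: ifP => // _; rewrite powR_ge0.
apply: eq_mint => t t0; rewrite -[1 in RHS]invr1 lef_pV2 ?posrE//.
by case: ifP => // _; rewrite -powR_inv1 ?ltW// -powRrM mulN1r opprK.
Qed.

End multiplicative_integral.

(** * Gamma integrals, radial integrals and the constant C(a) *)

Section gamma_polar.
Variable R : realType.
Implicit Types (F G : R -> \bar R) (a b c r s t : R).

(** The exponent is [s] and not [s - 1] because this is integrated against dt/t. *)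
Definition gamma_integrand s t : \bar R := (t `^ s * expR (- t))%:E.

Lemma measurable_expRN c : measurable_fun setT (fun t : R => expR (- (c * t))).
Proof.
apply: (measurableT_comp (@measurable_expR R)); by apply: measurableT_comp => //.
Qed.

Lemma measurable_gamma_integrand s : measurable_fun setT (gamma_integrand s).
Proof.
apply/measurable_EFinP; apply: measurable_funM; first exact: measurable_powR.
by have := measurable_expRN 1; under eq_fun do rewrite mul1r.
Qed.

Lemma gamma_integrand_ge0 s t : (0 <= gamma_integrand s t)%E.
Proof. by rewrite lee_fin mulr_ge0 ?powR_ge0 ?expR_ge0. Qed.

Lemma measurable_if_le1 s : measurable_fun setT (fun t : R => (if t <= 1 then t `^ s else 0)%:E).
Proof.
apply/measurable_EFinP; apply: measurable_fun_ifT => //; exact: measurable_fun_ler.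
Qed.

Lemma measurable_if_ge1 s : measurable_fun setT (fun t : R => (if 1 <= t then t `^ s else 0)%:E).
Proof.
apply/measurable_EFinP; apply: measurable_fun_ifT => //; exact: measurable_fun_ler.
Qed.

(** A single term of the exponential series, of degree [truncn s + 2 >= s + 1], already dominates a
    multiple of t^(s+1) for [t >= 1]; its factorial is the constant. *)
Lemma powR_expR_bound s t : 0 < s -> 1 <= t ->
  t `^ s * expR (- t) <= ((Num.truncn s).+2)`!%:R * t `^ (- 1).
Proof.
move=> s0 t1; have t0 : 0 < t by rewrite (lt_le_trans ltr01).
set j := (Num.truncn s).+1.
have sj : s + 1 <= j.+1%:R.
  by rewrite -[j.+1%:R]natr1 lerD2r ltW// /j truncnS_gt// ltW.
rewrite expRN ler_pdivrMr ?expR_gt0//.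
have h : t ^+ j.+1 / j.+1`!%:R <= expR t.
  by apply: le_trans (expR_ge1Dxn j (ltW t0)); rewrite lerDr.
have : t `^ s * t <= j.+1`!%:R * expR t.
  rewrite -[X in _ * X](powRr1 (ltW t0)) -powRD; last by rewrite (gt_eqF t0) implybT.
  rewrite mulrC -ler_pdivrMr ?ltr0n ?fact_gt0//; apply: le_trans h.
  rewrite ler_pM2r ?invr_gt0 ?ltr0n ?fact_gt0// -powR_mulrn ?(ltW t0)//.
  exact: ler_powR.
by rewrite powR_inv1 ?(ltW t0)// mulrAC ler_pdivlMr.
Qed.

Lemma mint_gamma_fin s : 0 < s -> (mint (gamma_integrand s) < +oo)%E.
Proof.
move=> s0; set C : R := ((Num.truncn s).+2)`!%:R.
have C0 : 0 <= C by rewrite ler0n.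
(* The first term dominates the integrand for t <= 1 and the second for t >= 1. Both have a finite
   integral against dt/t, and their overlap at 1 only enlarges the majorant. *)
pose G t := ((if t <= 1 then t `^ s else 0)%:E + C%:E * (if 1 <= t then t `^ (- 1) else 0)%:E)%E.
have G0 t : (0 <= (if t <= 1 then t `^ s else 0)%:E)%E by rewrite lee_fin; case: ifP; rewrite // powR_ge0.
have H0 t : (0 <= C%:E * (if 1 <= t then t `^ (- 1) else 0)%:E)%E.
  by rewrite mule_ge0 ?lee_fin//; case: ifP; rewrite // powR_ge0.
have mH : measurable_fun setT (fun t => (C%:E * (if 1 <= t then t `^ (- 1) else 0)%:E)%E).
  by apply: emeasurable_funM => //; exact: measurable_if_ge1.
apply: (@le_lt_trans _ _ (mint G)).
  apply: le_mint => //.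
  - exact: measurable_gamma_integrand.
  - by apply: emeasurable_funD => //; exact: measurable_if_le1.
  - exact: gamma_integrand_ge0.
  - move=> t t0; rewrite /G /gamma_integrand -EFinM -EFinD lee_fin.
    case: (leP 1 t) => t1; last first.
      rewrite (ltW t1) mulr0 addr0 -[leRHS]mulr1 ler_pM2l ?powR_gt0//.
      by rewrite expR_le1 oppr_le0 ltW.
    apply: (le_trans (powR_expR_bound s0 t1)); rewrite lerDr.
    by case: ifP; rewrite // powR_ge0.
  - by move=> t; rewrite adde_ge0.
rewrite /mint /G; under eq_integral do rewrite ge0_muleDr//.
rewrite ge0_integralD//; last 4 first.
- by move=> t _; rewrite mule_ge0// mweight_ge0.
- by apply: emeasurable_funM; [exact: measurable_mweight|exact: measurable_if_le1].
- by move=> t _; rewrite mule_ge0// mweight_ge0.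
- by apply: emeasurable_funM => //; exact: measurable_mweight.
under [X in (_ + X)%E]eq_integral do rewrite muleCA.
rewrite ge0_integralZl//; last 2 first.
- by apply: emeasurable_funM; [exact: measurable_mweight|exact: measurable_if_ge1].
- by move=> t _; rewrite mule_ge0 ?mweight_ge0// lee_fin; case: ifP; rewrite // powR_ge0.
have := mint_powR_le1 s0; rewrite /mint => ->.
have := @mint_powRN_ge1 R 1 ltr01; rewrite /mint => ->.
by rewrite -EFinM -EFinD ltry.
Qed.

Lemma mint_gamma_gt0 s : 0 < s -> (0 < mint (gamma_integrand s))%E.
Proof.
move=> s0; apply: (@lt_le_trans _ _ ((expR (- 1))%:E * (s^-1)%:E)%E).
  by rewrite -EFinM lte_fin mulr_gt0 ?expR_gt0// invr_gt0.
rewrite -mint_powR_le1// -ge0_integralZl//; last 2 first.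
- by apply: emeasurable_funM; [exact: measurable_mweight|exact: measurable_if_le1].
- by move=> t _; rewrite mule_ge0 ?mweight_ge0// lee_fin; case: ifP; rewrite // powR_ge0.
under eq_integral do rewrite muleCA.
have m1 : measurable_fun setT (fun t : R => ((expR (- 1))%:E * (if t <= 1 then t `^ s else 0)%:E)%E).
  by apply: emeasurable_funM => //; exact: measurable_if_le1.
apply: (@le_mint _ (fun t => (expR (- 1))%:E * (if t <= 1 then t `^ s else 0)%:E)%E) => //.
- exact: measurable_gamma_integrand.
- by move=> t; rewrite mule_ge0 ?lee_fin ?expR_ge0//; case: ifP; rewrite // powR_ge0.
- move=> t t0; rewrite -EFinM lee_fin; case: ifPn => t1; last by rewrite mulr0 mulr_ge0 ?powR_ge0 ?expR_ge0.
  by rewrite mulrC ler_pM2l ?powR_gt0// ler_expR lerN2.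
- exact: gamma_integrand_ge0.
Qed.

(** [Gamma_fun] is the [fine] part of an extended integral, so the finiteness of that integral is
    what makes it the true value and not the default 0. *)
Lemma mint_gammaE s : 0 < s -> mint (gamma_integrand s) = (Gamma_fun s)%:E.
Proof.
move=> s0; have f := mint_gamma_fin s0; have p := mint_gamma_gt0 s0.
have fin : mint (gamma_integrand s) \is a fin_num by rewrite ge0_fin_numE// ltW.
rewrite -(fineK fin); congr EFin; rewrite /Gamma_fun /Rintegral; congr fine.
rewrite mint_itv; apply: eq_integral => t; rewrite inE/= in_itv/= andbT => t0.
rewrite -EFinM mulrA; congr (_ * _)%:E; rewrite powRB; last by rewrite (gt_eqF t0) implybT.
by rewrite powRr1 ?ltW// mulrC.
Qed.

Lemma Gamma_fun_gt0 s : 0 < s -> 0 < Gamma_fun s.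
Proof. by move=> s0; rewrite -lte_fin -mint_gammaE// mint_gamma_gt0. Qed.

Lemma sphere_area_gt0 m : (0 < m)%N -> 0 < sphere_area R m.
Proof.
move=> m0; rewrite divr_gt0 ?mulr_gt0 ?powR_gt0 ?pi_gt0// Gamma_fun_gt0//.
by rewrite divr_gt0 ?ltr0n.
Qed.

Lemma measurable_dotvv m : measurable_fun setT (fun x : 'rV[R]_m => dotv x x).
Proof. exact: measurable_dotv. Qed.

Lemma dotv_gt0 m (x : 'rV[R]_m) : (0 < dotv x x) = (x != 0).
Proof. by rewrite lt_neqAle eq_sym dotv_eq0 dotv_ge0 andbT. Qed.

Lemma dotvZZ m c (x : 'rV[R]_m) : dotv (c *: x) (c *: x) = c ^+ 2 * dotv x x.
Proof. by rewrite dotvZr dotvC dotvZr mulrA -expr2. Qed.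

Lemma ae_rV_neq0 m : (0 < m)%N -> {ae lebesgue_rV R m, forall x, x != 0}.
Proof.
move=> m0; exists [set 0]; split; first exact: measurable_rV_set0.
  exact: lebesgue_rV_set0.
by move=> x /= /negP; rewrite negbK => /eqP.
Qed.

(** The image of [|x|^-m dx] under [x |-> |x|^2] is scale invariant, hence
    proportional to dt/t; the Gaussian gives the constant. *)
Lemma integral_radial m F : (0 < m)%N -> measurable_fun setT F -> (forall t, 0 <= F t)%E ->
  (\int[lebesgue_rV R m]_x F (dotv x x) =
   (sphere_area R m / 2)%:E * mint (fun t => (t `^ (m%:R / 2))%:E * F t))%E.
Proof.
move=> m0; set h : R := m%:R / 2.
have h0 : 0 < h by rewrite divr_gt0 ?ltr0n.
(* [w 0 = 0] because [0 `^ (- h) = 0]. *)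
pose w (x : 'rV[R]_m) : \bar R := (dotv x x `^ (- h))%:E.
have mw : measurable_fun setT w.
  apply/measurable_EFinP; apply: (measurableT_comp (measurable_powR _)).
  exact: measurable_dotvv.
have w0 x : (0 <= w x)%E by rewrite lee_fin powR_ge0.
(* [lift] undoes the weight: [w x * lift G (dotv x x)] is [G (dotv x x)] except at the origin, a
   null set. *)
pose lift G t := ((t `^ h)%:E * G t)%E.
have mlift G : measurable_fun setT G -> measurable_fun setT (lift G).
  move=> mG; apply: emeasurable_funM => //; apply/measurable_EFinP.
  exact: measurable_powR.
have lift0 G : (forall t, 0 <= G t)%E -> (forall t, 0 <= lift G t)%E.
  by move=> G0 t; rewrite mule_ge0// lee_fin powR_ge0.
have wE G : measurable_fun setT G -> (forall t, 0 <= G t)%E ->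
    (\int[lebesgue_rV R m]_x G (dotv x x) = \int[lebesgue_rV R m]_x (w x * lift G (dotv x x)))%E.
  move=> mG G0; apply: ge0_ae_eq_integral => //.
  - by apply: (measurableT_comp mG); exact: measurable_dotvv.
  - apply: emeasurable_funM => //; apply: (measurableT_comp (mlift _ mG)).
    exact: measurable_dotvv.
  - by move=> x _; rewrite mule_ge0// lift0.
  - apply: filterS (ae_rV_neq0 m0) => x x0 _; rewrite /w /lift muleA -EFinM.
    rewrite -powRD; last by rewrite dotv_eq0 x0 implybT.
    by rewrite addNr powRr0 mul1e.
(* The dilation by sqrt c multiplies |x|^2 by c; its Jacobian c^(m/2) is cancelled by the
   homogeneity of [w], which is of degree -m in x. *)
have inv c G : 0 < c -> measurable_fun setT G -> (forall t, 0 <= G t)%E ->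
    (\int[lebesgue_rV R m]_x (w x * G (c * dotv x x)%R) =
     \int[lebesgue_rV R m]_x (w x * G (dotv x x)))%E.
  move=> c0 mG G0; have s0 : 0 < Num.sqrt c by rewrite sqrtr_gt0.
  rewrite [RHS](@integral_rV_scale _ _ _ (Num.sqrt c))//; last 2 first.
  - apply: emeasurable_funM => //; apply: (measurableT_comp mG).
    exact: measurable_dotvv.
  - by move=> x; rewrite mule_ge0.
  rewrite -ge0_integralZl//; last 2 first.
  - rewrite /=; apply: emeasurable_funM.
      by apply: (measurableT_comp mw); exact: measurable_scalev.
    apply: (measurableT_comp mG); apply: (measurableT_comp (@measurable_dotvv _)).
    exact: measurable_scalev.
  - by move=> x _; rewrite mule_ge0.
  apply: eq_integral => x _; rewrite muleA dotvZZ sqr_sqrtr ?ltW//; congr (_ * _)%E.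
  rewrite /w -EFinM; congr EFin; rewrite dotvZZ sqr_sqrtr ?(ltW c0)// powRM ?dotv_ge0 ?(ltW c0)//.
  rewrite mulrA -[LHS]mul1r; congr (_ * _).
  rewrite -powR12_sqrt ?(ltW c0)// -powR_mulrn ?powR_ge0// -powRrM -powRD; last by rewrite (gt_eqF c0) implybT.
  by rewrite (_ : _ + _ = 0) ?powRr0// /h mulrC addrN.
have key G : measurable_fun setT G -> (forall t, 0 <= G t)%E ->
    ((\int[lebesgue_rV R m]_x G (dotv x x)) * mint (@mtest R \o @ln R) =
     mint (lift G) * \int[lebesgue_rV R m]_x (w x * mtest (ln (dotv x x))))%E.
  move=> mG G0; rewrite wE//.
  apply: (@scale_invariant_integral _ _ _ (lebesgue_rV R m) w (fun x => dotv x x) (lift G)) => //.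
  - exact: measurable_dotvv.
  - move=> x; have [->|x0] := eqVneq x 0; last by right; rewrite dotv_gt0.
    by left; rewrite /w dotv0r powR0// oppr_eq0 gt_eqF.
  - exact: mlift.
  - exact: lift0.
move=> mF F0.
have kF := key F mF F0.
have mE : measurable_fun setT (fun t : R => (expR (- t))%:E).
  by apply/measurable_EFinP; have := measurable_expRN 1; under eq_fun do rewrite mul1r.
have kG := key (fun t => (expR (- t))%:E) mE (fun t => expR_ge0 (- t)).
rewrite -[mint (lift F)]/(mint (fun t => ((t `^ h)%:E * F t)%E)) in kF *.
move: kG; rewrite integral_gaussv -/h.
rewrite (_ : mint (lift _) = (Gamma_fun h)%:E); last by rewrite -mint_gammaE.
have M0 := mint_mtest_gt0 R; have Moo := mint_mtest_fin R.
have Mfin : mint (@mtest R \o @ln R) \is a fin_num by rewrite ge0_fin_numE// ltW.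
move: kF; rewrite -(fineK Mfin).
have {}M0 : 0 < fine (mint (@mtest R \o @ln R)) by rewrite fine_gt0// M0.
move: (fine _) M0 => M M0.
have G0 := Gamma_fun_gt0 h0.
set A := (\int[_]_x F _)%E; set B := (\int[_]_x (w x * _))%E; set D := mint _ => kF kG.
(* [B] is an unknown constant independent of [F]. The Gaussian, that is [F t = exp (- t)],
   determines it in terms of [M], and [M] then drops out of the general identity. *)
have BE : B = (pi `^ h * M / Gamma_fun h)%:E.
  move/(congr1 (fun z => z * ((Gamma_fun h)^-1)%:E)%E): kG.
  by rewrite -!EFinM => ->; rewrite muleAC -EFinM divff ?gt_eqF// mul1e.
move: kF; rewrite BE => /(congr1 (fun z => z * (M^-1)%:E)%E).
rewrite -!muleA -!EFinM divff ?gt_eqF// mule1 => ->; rewrite muleC; congr (_%:E * _)%E.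
by rewrite /sphere_area -/h; field; rewrite !gt_eqF.
Qed.

Lemma enorm_powR m (x : 'rV[R]_m) b : enorm x `^ b = dotv x x `^ (b / 2).
Proof. by rewrite /enorm -powR12_sqrt ?dotv_ge0// -powRrM mulrC. Qed.

(** These moments supply the sphere areas and the Gamma factors on both sides of the computation in
    [proj_moment1]. *)
Lemma integral_enorm_gauss m b : (0 < m)%N -> 0 < m%:R + b ->
  (\int[lebesgue_rV R m]_x ((enorm x `^ b)%:E * gaussv x) =
   (sphere_area R m / 2 * Gamma_fun ((m%:R + b) / 2))%:E)%E.
Proof.
move=> m0 mb; have mb2 : 0 < (m%:R + b) / 2 by rewrite divr_gt0.
transitivity (\int[lebesgue_rV R m]_x (gamma_integrand (b / 2) (dotv x x)))%E.
  by apply: eq_integral => x _; rewrite enorm_powR -EFinM.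
rewrite integral_radial//; [|exact: measurable_gamma_integrand|exact: gamma_integrand_ge0].
rewrite [RHS]EFinM -mint_gammaE//; congr (_ * _)%E; apply: eq_mint => t t0.
rewrite -EFinM mulrA -powRD; last by rewrite (gt_eqF t0) implybT.
by rewrite -mulrDl.
Qed.

(** The constant C(a) of the overview: the integral of |x|^-a over a k-plane at distance 1 from the
    origin. *)
Definition cauchy_integral (k : nat) a : R :=
  pi `^ (k%:R / 2) * (Gamma_fun ((a - k%:R) / 2) / Gamma_fun (a / 2)).

Lemma cauchy_integral_gt0 k a : k%:R < a -> 0 < cauchy_integral k a.
Proof.
move=> ka; have a0 : 0 < a by rewrite (le_lt_trans _ ka)// ler0n.
rewrite mulr_gt0 ?powR_gt0 ?pi_gt0// divr_gt0// Gamma_fun_gt0// divr_gt0//.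
by rewrite subr_gt0.
Qed.

(** [Gamma (a / 2) * (|y|^2 + 1)^(- a / 2)] is the integral of
    [t^(a / 2) exp (- t (|y|^2 + 1))] against dt/t. *)
Lemma integral_cauchy1 k a : k%:R < a ->
  (\int[lebesgue_rV R k]_y ((dotv y y + 1) `^ (- (a / 2)))%:E = (cauchy_integral k a)%:E)%E.
Proof.
move=> ka; have a0 : 0 < a by rewrite (le_lt_trans _ ka)// ler0n.
have a2 : 0 < a / 2 by rewrite divr_gt0.
have ak2 : 0 < (a - k%:R) / 2 by rewrite divr_gt0// subr_gt0.
have G0 := Gamma_fun_gt0 a2.
have d0 (y : 'rV[R]_k) : 0 < dotv y y + 1 by rewrite ltr_wpDl// dotv_ge0.
have m1 : measurable_fun setT (fun y : 'rV[R]_k => ((dotv y y + 1) `^ (- (a / 2)))%:E).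
  apply/measurable_EFinP; apply: (measurableT_comp (measurable_powR _)).
  by apply: measurable_funD => //; exact: measurable_dotvv.
suff : (\int[lebesgue_rV R k]_y (((dotv y y + 1) `^ (- (a / 2)))%:E * (Gamma_fun (a / 2))%:E) =
    (pi `^ (k%:R / 2))%:E * (Gamma_fun ((a - k%:R) / 2))%:E)%E.
  rewrite (@ge0_integralZr _ _ _ _ _ measurableT)//; last 2 first.
  - by move=> y _; rewrite lee_fin powR_ge0.
  - by rewrite lee_fin ltW.
  move/(congr1 (fun z => z * ((Gamma_fun (a / 2))^-1)%:E)%E).
  by rewrite -muleA -!EFinM divff ?gt_eqF// mule1 => ->; rewrite /cauchy_integral mulrA.
pose F (z : 'rV[R]_k * measurableTypeR R) : \bar R := (mweight z.2 *
  (gamma_integrand (a / 2) z.2 * (expR (- (z.2 * dotv z.1 z.1)))%:E))%E.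
have mF : measurable_fun setT F.
  apply: emeasurable_funM; first exact: (measurableT_comp (@measurable_mweight R)).
  apply: emeasurable_funM; first exact: (measurableT_comp (@measurable_gamma_integrand _)).
  apply/measurable_EFinP; apply: (measurableT_comp (@measurable_expR R)).
  apply: (measurableT_comp (@oppr_measurable R setT)).
  apply: measurable_funM => //; apply: (measurableT_comp (@measurable_dotvv _)).
  exact: measurable_fst.
have F0 z : (0 <= F z)%E.
  by rewrite mule_ge0 ?mweight_ge0// mule_ge0 ?gamma_integrand_ge0// lee_fin expR_ge0.
transitivity (\int[lebesgue_rV R k]_y \int[lebesgue_measure]_t F (y, t))%E.
  apply: eq_integral => y _; rewrite -mint_gammaE//.
  rewrite -[X in (_ * X)%E](@mint_scale _ _ (dotv y y + 1))//; last 2 first.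
  - exact: measurable_gamma_integrand.
  - exact: gamma_integrand_ge0.
  rewrite -ge0_integralZl//; last 3 first.
  - apply: emeasurable_funM; first exact: measurable_mweight.
    apply: (measurableT_comp (@measurable_gamma_integrand _)); exact: measurable_funM.
  - by move=> t _; rewrite mule_ge0 ?mweight_ge0// gamma_integrand_ge0.
  - by rewrite lee_fin powR_ge0.
  apply: eq_integral => t _; rewrite /F/= muleCA /mweight; case: ifPn => t0; last by rewrite !mul0e.
  congr (_ * _)%E; rewrite /gamma_integrand -!EFinM; congr EFin.
  rewrite powRM ?(ltW t0) ?(ltW (d0 y))// !mulrA -powRD; last by rewrite (gt_eqF (d0 y)) implybT.
  rewrite addNr powRr0 mul1r -mulrA -expRD; congr (_ * expR _); ring.
rewrite (@fubini_tonelli _ _ _ _ _ (lebesgue_rV R k) lebesgue_measure F)//.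
rewrite -mint_gammaE// -ge0_integralZl//; last 3 first.
- by apply: emeasurable_funM; [exact: measurable_mweight|exact: measurable_gamma_integrand].
- by move=> t _; rewrite mule_ge0 ?mweight_ge0// gamma_integrand_ge0.
- by rewrite lee_fin powR_ge0.
apply: eq_integral => t _; rewrite /F/=.
rewrite ge0_integralZl//; last 3 first.
- apply: emeasurable_funM => //; apply/measurable_EFinP.
  apply: (measurableT_comp (@measurable_expR R)).
  apply: (measurableT_comp (@oppr_measurable R setT)).
  by apply: measurable_funM => //; exact: measurable_dotvv.
- by move=> y _; rewrite mule_ge0 ?gamma_integrand_ge0// lee_fin expR_ge0.
- exact: mweight_ge0.
rewrite muleCA /mweight; case: ifPn => t0; last by rewrite !mul0e.
congr (_ * _)%E; rewrite ge0_integralZl//; last 2 first.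
- apply/measurable_EFinP; apply: (measurableT_comp (@measurable_expR R)).
  apply: (measurableT_comp (@oppr_measurable R setT)).
  by apply: measurable_funM => //; exact: measurable_dotvv.
- exact: gamma_integrand_ge0.
(* The Gaussian integral in y is (pi/t)^(k/2). It lowers the exponent of t from a/2 to (a-k)/2,
   whence the numerator of C(a). *)
rewrite integral_gaussv_scale// /gamma_integrand -!EFinM; congr EFin.
rewrite powRM ?pi_ge0 ?invr_ge0 ?(ltW t0)// -[t^-1]powR_inv1 ?(ltW t0)// -powRrM mulN1r.
rewrite mulrBl powRD ?(gt_eqF t0) ?implybT//; ring.
Qed.

Lemma integral_cauchy k a r : k%:R < a -> 0 < r ->
  (\int[lebesgue_rV R k]_y ((dotv y y + r ^+ 2) `^ (- (a / 2)))%:E =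
   (cauchy_integral k a * r `^ (k%:R - a))%:E)%E.
Proof.
move=> ka r0.
have m1 c : measurable_fun setT (fun y : 'rV[R]_k => ((dotv y y + c) `^ (- (a / 2)))%:E).
  apply/measurable_EFinP; apply: (measurableT_comp (measurable_powR _)).
  by apply: measurable_funD => //; exact: measurable_dotvv.
rewrite (@integral_rV_scale _ _ _ r)//; last first.
  by move=> y; rewrite lee_fin powR_ge0.
transitivity ((r ^+ k)%:E * (\int[lebesgue_rV R k]_y
    ((r `^ (- a))%:E * ((dotv y y + 1) `^ (- (a / 2)))%:E)))%E.
  congr (_ * _)%E; apply: eq_integral => y _; rewrite dotvZZ -EFinM; congr EFin.
  rewrite -[X in _ + X]mulr1 -mulrDr powRM ?sqr_ge0 ?addr_ge0 ?dotv_ge0//.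
  congr (_ * _); rewrite -powR_mulrn ?(ltW r0)// -powRrM; by congr (_ `^ _); field.
rewrite ge0_integralZl//; last 2 first.
- by move=> y _; rewrite lee_fin powR_ge0.
- by rewrite lee_fin powR_ge0.
rewrite integral_cauchy1// -!EFinM; congr EFin.
rewrite mulrA mulrC; congr (_ * _); rewrite powRD ?(gt_eqF r0) ?implybT//.
by rewrite powR_mulrn// ltW.
Qed.

End gamma_polar.

(** * Averages over the Grassmannian *)

Section orthogonal_matrices.
Variables (R : realType) (n : nat).
Implicit Types (u v w x y : 'rV[R]_n) (U : {vspace 'rV[R]_n}) (g : 'M[R]_n).

Lemma orthproj_unique U u p : p \in U -> u - p \in orthc U -> u *m orthproj U = p.
Proof.
move=> pU upU; have q : (u - p) *m orthproj (orthc U) = u - p by apply: orthproj_id.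
move: q; rewrite orthproj_orthc mulmxBr mulmx1 => /eqP.
rewrite -subr_eq0 addrC addrA addNr add0r oppr_eq0 mulmxBl (orthproj_id pU) subr_eq0.
by move/eqP.
Qed.

Lemma subr_orthproj_mem U u : u - u *m orthproj U \in orthc U.
Proof. by rewrite -[X in X - _]mulmx1 -mulmxBr -orthproj_orthc orthproj_mem. Qed.

Lemma orthogonal_tr g : Defs.orthogonal g -> g^T *m g = 1%:M.
Proof. by move=> og; exact: mulmx1C. Qed.

Lemma dotv_orthogonal g u v : Defs.orthogonal g -> dotv (u *m g) (v *m g) = dotv u v.
Proof. by move=> og; rewrite !dotv_mx trmx_mul mulmxA -[u *m g *m _]mulmxA og mulmx1. Qed.

Lemma orthproj_image g U : Defs.orthogonal g ->
  orthproj (linfun (mulmxr g) @: U)%VS = g^T *m orthproj U *m g.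
Proof.
move=> og; apply/row_matrixP => i; rewrite [LHS]rowE [RHS]rowE.
apply: orthproj_unique.
  rewrite !mulmxA -[X in X \in _]/(mulmxr g (delta_mx 0 i *m g^T *m orthproj U)).
  rewrite -[X in X \in _](lfunE (mulmxr g)); apply: memv_img; exact: orthproj_mem.
set e := delta_mx _ _; apply/mem_orthc => v /memv_imgP[w wU ->]; rewrite lfunE/=.
have -> : e - e *m (g^T *m orthproj U *m g) =
    (e *m g^T - e *m g^T *m orthproj U) *m g.
  by rewrite mulmxBl !mulmxA -[e *m g^T *m g]mulmxA orthogonal_tr// mulmx1.
by rewrite dotv_orthogonal//; exact/mem_orthc/wU/subr_orthproj_mem.
Qed.

Lemma orthogonal_exists x y : dotv x x = dotv y y -> exists2 g, Defs.orthogonal g & x *m g = y.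
Proof.
move=> xy; have [->|xNy] := eqVneq x y.
  by exists 1%:M; rewrite /Defs.orthogonal ?mulmx1// trmx1 mulmx1.
pose w := x - y; pose q := dotv w w.
have q0 : q != 0 by rewrite dotv_eq0 subr_eq0.
have ww : w *m w^T = q%:M by rewrite [LHS]mx11_scalar -dotv_mx.
(* the Householder reflection exchanging x and y *)
exists (1%:M - (2 / q) *: (w^T *m w)).
  have gT : (1%:M - (2 / q) *: (w^T *m w))^T = 1%:M - (2 / q) *: (w^T *m w).
    by rewrite linearB/= trmx1 linearZ/= trmx_mul trmxK.
  have W2 : w^T *m w *m (w^T *m w) = q *: (w^T *m w).
    by rewrite mulmxA -[w^T *m w *m w^T]mulmxA ww mul_mx_scalar -scalemxAl.
  rewrite /Defs.orthogonal gT; set A := (2 / q) *: _ in W2 *.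
  have AA : A *m A = A + A.
    rewrite /A -scalemxAr -scalemxAl W2 !scalerA -scalerDl; congr (_ *: _); by field.
  by rewrite mulmxBr mulmx1 mulmxBl mul1mx AA opprB addrK subrK.
rewrite mulmxBr mulmx1 -scalemxAr mulmxA [x *m w^T]mx11_scalar -dotv_mx mul_scalar_mx scalerA.
have xw : q = 2 * dotv x w.
  rewrite /q /w !dotvDr !dotvNr dotvC dotvDr dotvNr [dotv (x - y) y]dotvC dotvDr dotvNr.
  rewrite (dotvC y x) -xy; ring.
rewrite (_ : 2 / q * dotv x w = 1) ?scale1r ?subKr//.
by rewrite mulrAC -xw divff.
Qed.

End orthogonal_matrices.

Section projection_average.
Variables (R : realType) (n k : nat).
Local Notation G := (grassmannian R n k).
Local Notation Pi := (affine_plane R n k).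
Local Notation k' := (minn k n).
Local Notation m := (n - minn k n)%N.

Lemma measurable_orthprojx d (T : measurableType d) (x : T -> 'rV[R]_n) (xi : T -> G) :
  measurable_fun setT x -> measurable_fun setT xi ->
  measurable_fun setT (fun t => x t - x t *m orthproj (val (xi t))).
Proof.
move=> mx mxi.
have mP : measurable_fun setT (fun t => orthproj (val (xi t))).
  exact: (measurableT_comp (@measurable_orthproj R n k) mxi).
have mxP := measurable_mulmx mx mP.
apply: measurable_fun_mxP => i j; under eq_fun do rewrite mxE [X in _ + X]mxE.
apply: measurable_funB.
  exact: measurableT_comp (measurable_mx_entry i j) mx.
exact: measurableT_comp (measurable_mx_entry i j) mxP.
Qed.

Lemma orthproj_rotate (g : 'M[R]_n) (xi : G) : Defs.orthogonal g ->
  orthproj (val (rotate g xi)) = g^T *m orthproj (val xi) *m g.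
Proof. by move=> og; rewrite val_rotate// orthproj_image. Qed.

(** The sigma-algebra is generated by the projections, on which a rotation acts by conjugation. *)
Lemma measurable_rotate (g : 'M[R]_n) : Defs.orthogonal g ->
  measurable_fun setT (rotate g : G -> G).
Proof.
move=> og _ _ [B mB <-]; rewrite !setTI -comp_preimage.
rewrite (_ : _ \o _ = fun xi : G => g^T *m orthproj (val xi) *m g); last first.
  by apply/funext => xi /=; rewrite orthproj_rotate.
rewrite -[X in measurable X]setTI.
have mo := @measurable_orthproj R n k.
have : measurable_fun setT (fun xi : G => g^T *m orthproj (val xi) *m g).
  apply: measurable_mulmx; last exact: measurable_cst.
  by apply: measurable_mulmx => //; exact: measurable_cst.
exact.
Qed.

Variable dxi : probability G R.
Hypothesis hdxi : rotation_invariant dxi.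

(** The dual transform of |tau|^b at [x]: the translate of [xi] through [x] is at this distance from
    0. A subspace containing [x] contributes 0, even for negative [b], by the convention on powers
    of 0. *)
Definition proj_moment (b : R) (x : 'rV[R]_n) : \bar R :=
  (\int[dxi]_xi (enorm (x - x *m orthproj (val xi)) `^ b)%:E)%E.

Lemma measurable_proj_moment_integrand b : measurable_fun setT
  (fun z : ('rV[R]_n * G)%type => (enorm (z.1 - z.1 *m orthproj (val z.2)) `^ b)%:E).
Proof.
apply/measurable_EFinP; apply: (measurableT_comp (measurable_powR _)).
apply: measurable_enorm; apply: measurable_orthprojx.
  exact: measurable_fst.
exact: measurable_snd.
Qed.

Lemma measurable_proj_moment_xi b x : measurable_fun setT
  (fun xi : G => (enorm (x - x *m orthproj (val xi)) `^ b)%:E).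
Proof.
exact: (measurableT_comp (measurable_proj_moment_integrand b) (@measurable_pair1 _ _ _ _ x)).
Qed.

Lemma integral_rotate (g : 'M[R]_n) (F : G -> \bar R) : Defs.orthogonal g ->
  measurable_fun setT F -> (forall xi, 0 <= F xi)%E ->
  (\int[dxi]_xi F (rotate g xi) = \int[dxi]_xi F xi)%E.
Proof.
move=> og mF F0; have mr := measurable_rotate og.
have h := @ge0_integral_pushforward _ _ _ _ _ _ mr dxi setT F measurableT mF (fun y _ => F0 y).
rewrite preimage_setT in h; apply: (etrans (esym h)).
by apply: eq_measure_integral => A mA _; exact: hdxi.
Qed.

(** Rotating [x] amounts to rotating [xi]: the projection is conjugated by [g], which then factors
    out and is absorbed by the norm. *)
Lemma proj_moment_orthogonal b g x : Defs.orthogonal g ->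
  proj_moment b (x *m g) = proj_moment b x.
Proof.
move=> og; rewrite /proj_moment.
pose F xi := (enorm (x *m g - x *m g *m orthproj (val (xi : G))) `^ b)%:E.
have mF : measurable_fun setT F by exact: measurable_proj_moment_xi.
have F0 xi : (0 <= F xi)%E by rewrite lee_fin powR_ge0.
apply: (etrans (esym (integral_rotate og mF F0))).
apply: eq_integral => xi _; rewrite /F (orthproj_rotate xi og).
rewrite !mulmxA -[x *m g *m g^T]mulmxA og mulmx1 -mulmxBl.
by rewrite /enorm (dotv_orthogonal _ _ og).
Qed.

Lemma enormZ (c : R) (x : 'rV[R]_n) : 0 <= c -> enorm (c *: x) = c * enorm x.
Proof. by move=> c0; rewrite /enorm dotvZZ sqrtrM ?sqr_ge0// sqrtr_sqr ger0_norm. Qed.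

Lemma proj_momentZ b c x : 0 <= c -> proj_moment b (c *: x) = ((c `^ b)%:E * proj_moment b x)%E.
Proof.
move=> c0; rewrite /proj_moment -ge0_integralZl//; last 3 first.
- exact: measurable_proj_moment_xi.
- by move=> xi _; rewrite lee_fin powR_ge0.
- by rewrite lee_fin powR_ge0.
apply: eq_integral => xi _; rewrite -scalemxAl -scalerBr enormZ// powRM ?sqrtr_ge0//.
Qed.

(** O(n) is transitive on spheres, so a dilation followed by a rotation carries [e] to any [x]. *)
Lemma proj_momentE b e x : enorm e = 1 ->
  proj_moment b x = ((enorm x `^ b)%:E * proj_moment b e)%E.
Proof.
move=> e1; have de : dotv e e = 1 by rewrite -[LHS]sqr_sqrtr ?dotv_ge0// -/(enorm e) e1 expr1n.
have [g og gE] : exists2 g, Defs.orthogonal g & (enorm x *: e) *m g = x.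
  by apply: orthogonal_exists; rewrite dotvZZ de mulr1 sqr_sqrtr// dotv_ge0.
rewrite -{1}gE (proj_moment_orthogonal _ _ og).
by apply: proj_momentZ; rewrite sqrtr_ge0.
Qed.

Lemma dim_grass (xi : G) : \dim (val xi) = k'.
Proof. exact/eqP/(valP xi). Qed.

Lemma dim_orthc_grass (xi : G) : \dim (orthc (val xi)) = m.
Proof. by rewrite dim_orthc dim_grass. Qed.

Lemma dotv_mul_onb d (U : {vspace 'rV[R]_n}) (u : 'rV_d) : \dim U = d ->
  dotv (u *m onb d U) (u *m onb d U) = dotv u u.
Proof. by move=> dU; rewrite !dotv_mx trmx_mul mulmxA -[u *m _ *m _]mulmxA onb_orthonormal// mulmx1. Qed.

(** Exchange the integrals over [x] and [xi], then split [x] along [xi]: the part orthogonal to [xi]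
    has norm |u| and does not involve [y]. *)
Lemma integral_proj_moment b (F : 'rV[R]_n -> \bar R) : measurable_fun setT F ->
  (forall x, 0 <= F x)%E ->
  (\int[lebesgue_rV R n]_x (F x * proj_moment b x) =
   \int[dxi]_xi \int[lebesgue_rV R m]_u ((enorm u `^ b)%:E *
     \int[lebesgue_rV R k']_y F (y *m onb k' (val xi) + u *m onb m (orthc (val xi)))%R))%E.
Proof.
move=> mF F0.
pose H (z : ('rV[R]_n * G)%type) : \bar R :=
  (F z.1 * (enorm (z.1 - z.1 *m orthproj (val z.2)) `^ b)%:E)%E.
have mH : measurable_fun setT H.
  apply: emeasurable_funM; last exact: measurable_proj_moment_integrand.
  exact: (measurableT_comp mF measurable_fst).
have H0 z : (0 <= H z)%E by rewrite mule_ge0// lee_fin powR_ge0.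
transitivity (\int[lebesgue_rV R n]_x \int[dxi]_xi H (x, xi))%E.
  apply: eq_integral => x _; rewrite /proj_moment -ge0_integralZl//.
  - exact: measurable_proj_moment_xi.
  - by move=> xi _; rewrite lee_fin powR_ge0.
rewrite (@sfinite_Fubini _ _ _ _ _ (lebesgue_rV R n) dxi H)//.
apply: eq_integral => xi _.
have mHx : measurable_fun setT (fun x => H (x, xi)).
  exact: (measurableT_comp mH (@measurable_pair2 _ _ _ _ xi)).
apply: (etrans (integral_rV_split (dim_grass xi) (dim_orthc_grass xi) mHx (fun x => H0 (x, xi)))).
apply: eq_integral => u _.
pose A := onb k' (val xi); pose B := onb m (orthc (val xi)).
have mFy : measurable_fun setT (fun y => F (y *m A + u *m B)).
  apply: (measurableT_comp mF); apply: measurable_addmx; first exact: measurable_mulmx_cst.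
  exact: measurable_cst.
have ub0 : (0 <= (enorm u `^ b)%:E)%E by rewrite lee_fin powR_ge0.
rewrite -[RHS](ge0_integralZl _ measurableT mFy (fun y _ => F0 _) ub0).
apply: eq_integral => y _; rewrite /H -/A -/B muleC [(y *m A + u *m B, xi).1]/= [(y *m A + u *m B, xi).2]/=.
have -> : (y *m A + u *m B) *m orthproj (val xi) = y *m A.
  apply: orthproj_unique; first exact: onb_mem.
  by rewrite addrAC addrN add0r onb_mem.
rewrite addrAC addrN add0r /enorm /B.
by rewrite (_ : dotv (u *m _) _ = dotv u u)//; apply: dotv_mul_onb; exact: dim_orthc_grass.
Qed.

Lemma integral_lebesgue_on d (U : {vspace 'rV[R]_n}) (F : 'rV[R]_n -> \bar R) : \dim U = d ->
  measurable_fun setT F -> (forall x, 0 <= F x)%E ->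
  (\int[lebesgue_on U]_y F y = \int[lebesgue_rV R d]_y F (y *m onb d U))%E.
Proof.
move=> <- mF F0.
have mo : measurable_fun setT (fun y : 'rV[R]_(\dim U) => y *m onb (\dim U) U).
  exact: measurable_mulmx_cst.
have h := @ge0_integral_pushforward _ _ _ _ _ _ mo (lebesgue_rV R (\dim U)) setT F measurableT mF (fun y _ => F0 y).
by rewrite preimage_setT in h; apply: (etrans h).
Qed.

Lemma integral_plane_measure (F : Pi -> \bar R) : measurable_fun setT F ->
  (forall x, 0 <= F x)%E ->
  (\int[plane_measure dxi]_tau F tau =
   \int[dxi]_xi \int[lebesgue_rV R m]_u F (plane_param (xi, u)))%E.
Proof.
move=> mF F0.
have mp := @measurable_plane_param R n k.
have h := @ge0_integral_pushforward _ _ _ _ _ _ mp (dxi \x lebesgue_rV R m)%E setT F measurableT mF (fun y _ => F0 y).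
transitivity (\int[pushforward (dxi \x lebesgue_rV R m)%E (@plane_param R n k)]_tau F tau)%E.
  by apply: eq_measure_integral => A mA _; exact: (congr1 (fun f => f A) (plane_measureE dxi)).
rewrite preimage_setT in h; apply: (etrans h).
apply: (@fubini_tonelli1 _ _ _ _ _ dxi (lebesgue_rV R m) (F \o @plane_param R n k)) => [|x]; last exact: F0.
exact: measurableT_comp.
Qed.

(** The transform of nonnegative functions, with values in [0, +oo], to which Tonelli's theorem
    applies without any integrability. *)
Definition plane_integral (F : 'rV[R]_n -> \bar R) (tau : Pi) : \bar R :=
  (\int[lebesgue_on (val (direction tau))]_y F (y + offset tau)%R)%E.

Lemma measurable_planeval : measurable_fun setT (val : Pi -> G * 'rV[R]_n).
Proof. by move=> _ B mB; exists B. Qed.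

Lemma measurable_direction : measurable_fun setT (@direction R n k).
Proof. exact: (measurableT_comp measurable_fst measurable_planeval). Qed.

Lemma measurable_offset : measurable_fun setT (@offset R n k).
Proof. exact: (measurableT_comp measurable_snd measurable_planeval). Qed.

(** The orthonormal basis moves the integral to a space that no longer depends on [tau], which makes
    measurability in [tau] a consequence of Tonelli's theorem. *)
Lemma plane_integralE F tau : measurable_fun setT F -> (forall x, 0 <= F x)%E ->
  plane_integral F tau =
  (\int[lebesgue_rV R k']_y F (y *m onb k' (val (direction tau)) + offset tau)%R)%E.
Proof.
move=> mF F0; apply: (integral_lebesgue_on (dim_grass (direction tau))) => [|y]; last exact: F0.
by apply: (measurableT_comp mF); exact: measurable_addv.
Qed.

Lemma measurable_plane_point :
  measurable_fun setT (fun z : (Pi * 'rV[R]_k')%type =>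
    z.2 *m onb k' (val (direction z.1)) + offset z.1).
Proof.
apply: measurable_addmx; last exact: (measurableT_comp measurable_offset measurable_fst).
apply: measurable_mulmx; first exact: measurable_snd.
apply: measurable_onb.
exact: (measurableT_comp (@measurable_orthproj R n k) (measurableT_comp measurable_direction measurable_fst)).
Qed.

Lemma measurable_plane_integral F : measurable_fun setT F -> (forall x, 0 <= F x)%E ->
  measurable_fun setT (plane_integral F).
Proof.
move=> mF F0.
rewrite (_ : plane_integral F = (fun tau => \int[lebesgue_rV R k']_y
    F (y *m onb k' (val (direction tau)) + offset tau)%R)%E); last first.
  by apply/funext => tau; exact: plane_integralE.
apply: (@measurable_fun_fubini_tonelli_F _ _ _ _ _ (lebesgue_rV R k')
  (fun z => F (z.2 *m onb k' (val (direction z.1)) + offset z.1))) => [|z]; last exact: F0.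
exact: (measurableT_comp mF measurable_plane_point).
Qed.

Lemma plane_integral_ge0 F tau : (forall x, 0 <= F x)%E -> (0 <= plane_integral F tau)%E.
Proof. by move=> F0; apply: integral_ge0. Qed.

Lemma measurable_plane_norm : measurable_fun setT (@plane_norm R n k).
Proof. exact: (measurable_enorm measurable_offset). Qed.

Lemma measurable_plane_normX b : measurable_fun setT (fun tau : Pi => (plane_norm tau `^ b)%:E).
Proof.
by apply/measurable_EFinP; exact: (measurableT_comp (measurable_powR b) measurable_plane_norm).
Qed.

(** Duality: |Px|^b F(x), with P the projection onto the complement of xi, is integrated plane by
    plane on the left and point by point on the right. *)
Lemma integral_plane_weight b F : measurable_fun setT F -> (forall x, 0 <= F x)%E ->
  (\int[plane_measure dxi]_tau ((plane_norm tau `^ b)%:E * plane_integral F tau) =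
   \int[lebesgue_rV R n]_x (F x * proj_moment b x))%E.
Proof.
move=> mF F0; rewrite (integral_proj_moment b mF F0) integral_plane_measure; last 2 first.
- by apply: emeasurable_funM; [exact: measurable_plane_normX|exact: measurable_plane_integral].
- by move=> tau; rewrite mule_ge0 ?plane_integral_ge0// lee_fin powR_ge0.
apply: eq_integral => xi _; apply: eq_integral => u _.
have dE : direction (plane_param (xi, u)) = xi by [].
have oE : offset (plane_param (xi, u)) = u *m onb m (orthc (val xi)) by [].
have nE : plane_norm (plane_param (xi, u)) = enorm u.
  by rewrite /plane_norm oE /enorm (dotv_mul_onb _ (dim_orthc_grass xi)).
by rewrite (plane_integralE _ mF F0) nE dE oE.
Qed.

Hypothesis hk : (0 < k < n)%N.

Let k'E : k' = k. Proof. by apply/minn_idPl/ltnW; case/andP: hk. Qed.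
Let mE : m = (n - k)%N. Proof. by rewrite k'E. Qed.
Let n0 : (0 < n)%N. Proof. by case/andP: hk => /ltn_trans; apply. Qed.
Let m0 : (0 < n - k)%N. Proof. by case/andP: hk => _; rewrite subn_gt0. Qed.

(** The value is found by applying [integral_proj_moment] to the Gaussian. *)
Lemma proj_moment1 b e : enorm e = 1 -> k%:R - n%:R < b ->
  proj_moment b e = (sphere_area R (n - k) / sphere_area R n * cauchy_integral k (b + n%:R))%:E.
Proof.
move=> e1 kb.
have nb : 0 < n%:R + b by rewrite -ltrBlDl sub0r (le_lt_trans _ kb)// lerBrDr addrC subrr ler0n.
have mb : 0 < (n - k)%:R + b by rewrite natrB 1?ltnW//; [rewrite -ltrBlDl sub0r opprB|case/andP: hk].
have M0 : (0 <= proj_moment b e)%E by apply: integral_ge0 => xi _; rewrite lee_fin powR_ge0.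
have : ((sphere_area R n / 2 * Gamma_fun ((n%:R + b) / 2))%:E * proj_moment b e =
   (pi `^ (k%:R / 2) * (sphere_area R (n - k) / 2 * Gamma_fun (((n - k)%:R + b) / 2)))%:E)%E.
  rewrite -integral_enorm_gauss//.
  rewrite -ge0_integralZr//; last 2 first.
  - apply: emeasurable_funM; last exact: measurable_gaussv.
    apply/measurable_EFinP; apply: (measurableT_comp (measurable_powR _)); exact: measurable_enorm.
  - by move=> x _; rewrite mule_ge0 ?gaussv_ge0// lee_fin powR_ge0.
  transitivity (\int[lebesgue_rV R n]_x (gaussv x * proj_moment b x))%E.
    by apply: eq_integral => x _; rewrite (proj_momentE b x e1) muleA [(gaussv x * _)%E]muleC.
  rewrite integral_proj_moment; [|exact: measurable_gaussv|exact: gaussv_ge0].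
  transitivity (\int[dxi]_xi (cst (pi `^ (k%:R / 2) * (sphere_area R (n - k) / 2 * Gamma_fun (((n - k)%:R + b) / 2)))%:E xi))%E; last first.
    rewrite integral_cst; last exact: measurableT.
    by rewrite [X in (_ * X)%E](_ : _ = 1%E) ?mule1//; exact: probability_setT.
  apply: eq_integral => xi _ /=.
  rewrite EFinM -integral_enorm_gauss// -ge0_integralZl//; last 3 first.
  - apply: emeasurable_funM; last exact: measurable_gaussv.
    apply/measurable_EFinP; apply: (measurableT_comp (measurable_powR _)); exact: measurable_enorm.
  - by move=> x _; rewrite mule_ge0 ?gaussv_ge0// lee_fin powR_ge0.
  - by rewrite lee_fin powR_ge0.
  rewrite -mE; apply: eq_integral => u _; rewrite muleCA; congr (_ * _)%E.
  have pk : pi `^ (k'%:R / 2) = pi `^ (k%:R / 2) :> R by rewrite k'E.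
  rewrite -pk -integral_gaussv muleC.
  rewrite -[RHS](ge0_integralZl _ measurableT (@measurable_gaussv R k') (fun y _ => gaussv_ge0 y) (gaussv_ge0 u)).
  apply: eq_integral => y _; rewrite /gaussv (dotv_onb _ _ (dim_grass xi) (dim_orthc_grass xi)).
  by rewrite opprD expRD EFinM muleC.
have S0 := @sphere_area_gt0 R n n0.
have Gn : 0 < Gamma_fun ((n%:R + b) / 2) by rewrite Gamma_fun_gt0// divr_gt0.
pose c : R := sphere_area R n / 2 * Gamma_fun ((n%:R + b) / 2).
have c0 : 0 < c by rewrite mulr_gt0// divr_gt0.
move=> /(congr1 (fun z => (c^-1)%:E * z)%E).
rewrite muleA -!EFinM mulVf ?gt_eqF// mul1e => ->; congr EFin.
rewrite /cauchy_integral (addrC b) natrB; last by apply/ltnW; case/andP: hk.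
rewrite (_ : n%:R - k%:R + b = n%:R + b - k%:R); last by ring.
have fld (s1 s2 g1 g2 q : R) : s2 != 0 -> g2 != 0 ->
    (s2 / 2 * g2)^-1 * (q * (s1 / 2 * g1)) = s1 / s2 * (q * (g1 / g2)).
  by move=> s20 g20; field; rewrite s20 g20.
by apply: fld; rewrite gt_eqF.
Qed.

(** The identity from which the upper bounds follow: with [b = a - n] for finite exponents, and with
    [b = 0] to carry null sets over to planes for the exponent +oo. *)
Lemma integral_plane_weightE b F : k%:R - n%:R < b ->
  measurable_fun setT F -> (forall x, 0 <= F x)%E ->
  (\int[plane_measure dxi]_tau ((plane_norm tau `^ b)%:E * plane_integral F tau) =
   (sphere_area R (n - k) / sphere_area R n * cauchy_integral k (b + n%:R))%:E *
   \int[lebesgue_rV R n]_x ((enorm x `^ b)%:E * F x))%E.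
Proof.
move=> kb mF F0.
pose e : 'rV[R]_n := delta_mx 0 (Ordinal n0).
have e1 : enorm e = 1.
  rewrite /enorm /dotv (bigD1 (Ordinal n0))//= big1 => [|i /negbTE ie]; last by rewrite mxE ie andbF mulr0.
  by rewrite mxE !eqxx mulr1 addr0 sqrtr1.
pose W x := ((enorm x `^ b)%:E * F x)%E.
have mW : measurable_fun setT W.
  apply: emeasurable_funM => //; apply/measurable_EFinP.
  by apply: (measurableT_comp (measurable_powR _)); exact: measurable_enorm.
have W0 x : (0 <= W x)%E by rewrite mule_ge0// lee_fin powR_ge0.
have M0 : (0 <= proj_moment b e)%E by apply: integral_ge0 => xi _; rewrite lee_fin powR_ge0.
rewrite (integral_plane_weight b mF F0) -(proj_moment1 e1 kb) muleC.
rewrite -[RHS](ge0_integralZr _ measurableT mW (fun x _ => W0 x) M0).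
by apply: eq_integral => x _; rewrite (proj_momentE b x e1) muleA /W [(F x * _)%E]muleC.
Qed.

End projection_average.

(** * The transform plane by plane, and the negligible planes through the origin *)

Section kplane_basics.
Variables (R : realType) (n k : nat).
Local Notation G := (grassmannian R n k).
Local Notation Pi := (affine_plane R n k).
Local Notation k' := (minn k n).
Local Notation m := (n - minn k n)%N.
Implicit Types (tau : Pi) (f : 'rV[R]_n -> R).

Definition absf f (x : 'rV[R]_n) : \bar R := `|f x|%:E.

Lemma absf_ge0 f x : (0 <= absf f x)%E.
Proof. by rewrite lee_fin normr_ge0. Qed.

Lemma measurable_absf f : measurable_fun setT f -> measurable_fun setT (absf f).
Proof. by move=> mf; apply/measurable_EFinP; exact: measurableT_comp. Qed.

Lemma measurable_translate_offset d (T : measurableType d) (F : 'rV[R]_n -> T) tau :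
  measurable_fun setT F -> measurable_fun setT (fun y : 'rV[R]_n => F (y + offset tau)).
Proof. by move=> mF; apply: (measurableT_comp mF); exact: measurable_addv. Qed.

Lemma measurable_kplane_transform f : measurable_fun setT f ->
  measurable_fun setT (@kplane_transform R n k f).
Proof.
move=> mf.
have mE : measurable_fun setT (EFin \o f) by exact/measurable_EFinP.
have mp := measurable_funepos mE; have mn := measurable_funeneg mE.
have p0 x : (0 <= (EFin \o f)^\+%E x)%E by exact: funepos_ge0.
have n0 x : (0 <= (EFin \o f)^\-%E x)%E by exact: funeneg_ge0.
have mI : measurable_fun setT (fun tau =>
    plane_integral (EFin \o f)^\+%E tau - plane_integral (EFin \o f)^\-%E tau)%E.
  by apply: emeasurable_funB; exact: measurable_plane_integral.
have := measurableT_comp (@fine_measurable R _ measurableT) mI.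
apply: eq_measurable_fun => tau _ /=.
rewrite /kplane_transform /Rintegral [in RHS]integralE /plane_integral.
by congr (fine (_ - _)%E); apply: eq_integral => y _; rewrite ?funeposE ?funenegE.
Qed.

(** If the integral of [f] over [tau] is infinite, its [fine] part is 0 and the inequality still
    holds. *)
Lemma le_kplane_transform f tau : measurable_fun setT f ->
  (`|kplane_transform f tau|%:E <= plane_integral (absf f) tau)%E.
Proof.
move=> mf; have mft := measurable_translate_offset tau mf.
have mE : measurable_fun setT (EFin \o (fun y : 'rV[R]_n => f (y + offset tau))) by exact/measurable_EFinP.
have := le_abse_integral (lebesgue_on (val (direction tau))) measurableT mE.
apply: le_trans; rewrite /kplane_transform /Rintegral.
by case: (integral _ _ _) => [r||] //=; rewrite ?normr0 leey.
Qed.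

Lemma kplane_integrableP f tau : measurable_fun setT f ->
  kplane_integrable f tau <-> (plane_integral (absf f) tau < +oo)%E.
Proof.
move=> mf; have mft := measurable_translate_offset tau mf.
split=> [/integrableP[_ //]|h]; apply/integrableP; split => //.
exact/measurable_EFinP.
Qed.

Lemma dotv_plane_point tau (y : 'rV[R]_k') :
  dotv (y *m onb k' (val (direction tau)) + offset tau)
       (y *m onb k' (val (direction tau)) + offset tau) =
  dotv y y + plane_norm tau ^+ 2.
Proof.
set z := y *m _; have zo : dotv z (offset tau) = 0.
  by have /mem_orthc := valP tau; apply; exact: onb_mem.
rewrite /plane_norm sqr_sqrtr ?dotv_ge0// dotvDr (dotvC (z + _) z) (dotvC (z + _)) !dotvDr.
rewrite zo (dotvC _ z) zo addr0 add0r; congr (_ + _).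
by apply: dotv_mul_onb; exact: dim_grass.
Qed.

Lemma plane_norm_ge0 tau : 0 <= plane_norm tau.
Proof. exact: sqrtr_ge0. Qed.

Lemma measurable_enormX b : measurable_fun setT (fun x : 'rV[R]_n => (enorm x `^ b)%:E).
Proof.
apply/measurable_EFinP; apply: (measurableT_comp (measurable_powR _)).
exact: measurable_enorm.
Qed.

Lemma enormX_ge0 b (x : 'rV[R]_n) : (0 <= (enorm x `^ b)%:E)%E.
Proof. by rewrite lee_fin powR_ge0. Qed.

Lemma enorm_neq0 d (x : 'rV[R]_d) : (enorm x != 0) = (x != 0).
Proof. by rewrite /enorm sqrtr_eq0 -ltNge dotv_gt0. Qed.

Lemma enorm_gt0 d (x : 'rV[R]_d) : (0 < enorm x) = (x != 0).
Proof. by rewrite /enorm sqrtr_gt0 dotv_gt0. Qed.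

Lemma plane_point_neq0 tau (y : 'rV[R]_n) : 0 < plane_norm tau ->
  y \in val (direction tau) -> y + offset tau != 0.
Proof.
move=> t0 yU; apply: contraL t0 => /eqP yo0.
have oU : offset tau \in val (direction tau).
  by rewrite -[offset tau](addKr y) yo0 addr0 memvN.
have /mem_orthc/(_ _ oU) := valP tau.
by rewrite -[(val tau).2]/(offset tau) => o0; rewrite /plane_norm /enorm o0 sqrtr0 ltxx.
Qed.

Variable dxi : probability G R.
Hypothesis hk : (0 < k < n)%N.

Let k'E : k' = k. Proof. by apply/minn_idPl/ltnW; case/andP: hk. Qed.
Let mE : m = (n - k)%N. Proof. by rewrite k'E. Qed.
Let m0 : (0 < n - k)%N. Proof. by case/andP: hk => _; rewrite subn_gt0. Qed.

Lemma plane_integral_enormN a tau : k%:R < a -> 0 < plane_norm tau ->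
  plane_integral (fun x => (enorm x `^ (- a))%:E) tau =
  (cauchy_integral k a * plane_norm tau `^ (k%:R - a))%:E.
Proof.
move=> ka t0; rewrite (plane_integralE tau (measurable_enormX (- a)) (enormX_ge0 (- a))).
rewrite -(integral_cauchy ka t0).
transitivity (\int[lebesgue_rV R k']_y ((dotv y y + plane_norm tau ^+ 2) `^ (- (a / 2)))%:E)%E.
  by apply: eq_integral => y _; rewrite enorm_powR dotv_plane_point mulNr.
by rewrite k'E.
Qed.

(** For each direction only the offset 0 is excluded, a single point of a space of dimension n - k >
    0. *)
Lemma ae_plane_norm_gt0 : {ae plane_measure dxi, forall tau, 0 < plane_norm tau}.
Proof.
pose A : set Pi := [set tau | plane_norm tau = 0].
have mA : measurable A.
  rewrite (_ : A = @plane_norm R n k @^-1` [set 0]); last by [].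
  by rewrite -[X in measurable X]setTI; exact: (@measurable_plane_norm R n k).
exists A; split => //; last first.
  move=> tau /= /negP; rewrite lt_neqAle plane_norm_ge0 andbT negbK => /eqP.
  by rewrite /A/= => <-.
have mI : measurable_fun setT (EFin \o \1_A : Pi -> \bar R) by exact/measurable_EFinP/measurable_indic.
have I0 tau : (0 <= (EFin \o \1_A : Pi -> \bar R) tau)%E by rewrite lee_fin.
have := integral_indic (plane_measure dxi) measurableT mA.
rewrite setIT => <-; apply: (etrans (integral_plane_measure dxi mI I0)).
apply: integral0_eq => xi _.
transitivity (\int[lebesgue_rV R m]_u (EFin \o \1_[set 0%R : 'rV[R]_m]) u)%E.
  apply: eq_integral => u _ /=; congr (_%:E); rewrite !indicE; congr ((nat_of_bool _)%:R).
  have nE : plane_norm (plane_param (xi, u)) = enorm u.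
    by rewrite /plane_norm /enorm (dotv_mul_onb _ (dim_orthc_grass xi)).
  apply/idP/idP => /set_mem h; apply/mem_set.
    have /eqP h0 : enorm u = 0 by rewrite -nE.
    by apply/eqP; rewrite -[_ == _]negbK -enorm_neq0 negbK.
  by change (plane_norm (plane_param (xi, u)) = 0); rewrite nE h /enorm dotv0r sqrtr0.
rewrite integral_indic//; last exact: measurable_rV_set0.
by rewrite setIT; apply: lebesgue_rV_set0; rewrite mE.
Qed.

End kplane_basics.

(** * The upper bound *)

(** Hoelder's inequality for the factorization of [h * w] into [h * w^(1/r)] and [w^(1/q)], raised
    to the power [r]; the exponent of [M] is r/q = r - 1. *)
Lemma weighted_power_mean (R : realType) d (T : measurableType d)
    (mu : {measure set T -> \bar R}) (h w : T -> R) (M r : R) :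
  1 <= r -> 0 <= M -> measurable_fun setT h -> measurable_fun setT w ->
  (forall x, 0 <= h x) -> (forall x, 0 <= w x) ->
  (\int[mu]_x (w x)%:E = M%:E)%E ->
  ((\int[mu]_x (h x * w x)%:E) `^ r <=
   (M `^ (r - 1))%:E * \int[mu]_x (h x `^ r * w x)%:E)%E.
Proof.
move=> r1 M0 mh mw h0 w0 wM.
have r0 : 0 < r by rewrite (lt_le_trans ltr01).
have I0 : (0 <= \int[mu]_x (h x * w x)%:E)%E.
  by apply: integral_ge0 => x _; rewrite lee_fin mulr_ge0.
(* For [r = 1] the conjugate exponent is infinite, but both sides coincide. *)
have [rE|rN1] := eqVneq r 1.
  rewrite rE subrr powRr0 mul1e (poweRe1 I0).
  by under [leRHS]eq_integral do rewrite (powRr1 (h0 _)).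
have rgt : 0 < r - 1 by rewrite subr_gt0 lt_neqAle eq_sym rN1.
pose q := r / (r - 1).
have q0 : 0 < q by rewrite divr_gt0.
have rq : r^-1 + q^-1 = 1 by rewrite /q invf_div; field; rewrite !gt_eqF.
have mp s : measurable_fun setT (fun x => w x `^ s).
  exact: (measurableT_comp (measurable_powR s) mw).
have mf : measurable_fun setT (fun x => h x * w x `^ r^-1) by exact: measurable_funM.
have H := hoelder mu mf (mp q^-1) r0 q0 rq.
have X0 : (0 <= \int[mu]_x (h x `^ r * w x)%:E)%E.
  by apply: integral_ge0 => x _; rewrite lee_fin mulr_ge0 ?powR_ge0.
have LE : ('N[mu]_1[EFin \o ((fun x => h x * w x `^ r^-1) \* (fun x => w x `^ q^-1))%R] =
    \int[mu]_x (h x * w x)%:E)%E.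
  rewrite Lnorm1; apply: eq_integral => x _ /=.
  rewrite -mulrA -powRD; last by rewrite rq oner_eq0.
  by rewrite rq (powRr1 (w0 _)) ger0_norm// mulr_ge0.
have RE : ('N[mu]_r%:E[EFin \o (fun x => h x * w x `^ r^-1)%R] =
    (\int[mu]_x (h x `^ r * w x)%:E) `^ r^-1)%E.
  rewrite unlock; congr (_ `^ _)%E; apply: eq_integral => x _ /=.
  rewrite ger0_norm; last by rewrite mulr_ge0 ?powR_ge0.
  by rewrite powRM ?powR_ge0// -powRrM mulVf ?gt_eqF// powRr1.
have QE : ('N[mu]_q%:E[EFin \o (fun x => w x `^ q^-1)%R] = (M `^ q^-1)%:E)%E.
  rewrite unlock -poweR_EFin -wM; congr (_ `^ _)%E; apply: eq_integral => x _ /=.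
  by rewrite ger0_norm ?powR_ge0// -powRrM mulVf ?gt_eqF// powRr1.
move: H; rewrite LE RE QE => H.
have := gt0_ler_poweR (ltW r0) _ _ H.
rewrite !in_itv/= !leey !andbT => /(_ I0).
rewrite mule_ge0 ?poweR_ge0 ?lee_fin ?powR_ge0// => /(_ isT) {}H.
apply: (le_trans H).
rewrite poweRM ?poweR_ge0 ?lee_fin ?powR_ge0// -poweRrM mulVf ?gt_eqF// (poweRe1 X0).
rewrite poweR_EFin -powRrM muleC (_ : q^-1 * r = r - 1)//.
by rewrite /q invf_div; field; rewrite !gt_eqF.
Qed.

Section upper_bound.
Variables (R : realType) (n k : nat).
Local Notation G := (grassmannian R n k).
Local Notation Pi := (affine_plane R n k).
Local Notation k' := (minn k n).
Implicit Types (tau : Pi) (f : 'rV[R]_n -> R).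
Hypothesis hk : (0 < k < n)%N.

Let k'E : k' = k. Proof. by apply/minn_idPl/ltnW; case/andP: hk. Qed.
Let n0 : (0 < n)%N. Proof. by case/andP: hk => /ltn_trans; apply. Qed.

Definition powf (s r : R) f (x : 'rV[R]_n) : \bar R := (enorm x `^ s * `|f x| `^ r)%:E.

Lemma powf_ge0 s r f x : (0 <= powf s r f x)%E.
Proof. by rewrite lee_fin mulr_ge0 ?powR_ge0. Qed.

Lemma measurable_powf s r f : measurable_fun setT f -> measurable_fun setT (powf s r f).
Proof.
move=> mf; apply/measurable_EFinP; apply: measurable_funM.
  by apply: (measurableT_comp (measurable_powR _)); exact: measurable_enorm.
by apply: (measurableT_comp (measurable_powR _)); exact: measurableT_comp.
Qed.

Lemma plane_power_mean f tau a r : 1 <= r -> k%:R < a -> 0 < plane_norm tau ->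
  measurable_fun setT f ->
  ((plane_integral (absf f) tau) `^ r <=
   ((cauchy_integral k a * plane_norm tau `^ (k%:R - a)) `^ (r - 1))%:E *
   plane_integral (powf (a * (r - 1)) r f) tau)%E.
Proof.
move=> r1 ka t0 mf.
have zE := plane_integral_enormN hk ka t0.
rewrite (plane_integralE tau (measurable_enormX (- a)) (enormX_ge0 (- a))) in zE.
rewrite (plane_integralE tau (measurable_absf mf) (absf_ge0 f)).
rewrite (plane_integralE tau (measurable_powf _ _ mf) (powf_ge0 _ _ f)).
pose z (y : 'rV[R]_k') := y *m onb k' (val (direction tau)) + offset tau.
have z0 y : z y != 0 by rewrite plane_point_neq0// onb_mem.
have ez y : 0 < enorm (z y) by rewrite enorm_gt0.
have mz : measurable_fun setT z.
  by apply: measurable_addmx; [exact: measurable_mulmx_cst|exact: measurable_cst].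
have me s : measurable_fun setT (fun y => enorm (z y) `^ s).
  by apply: (measurableT_comp (measurable_powR _)); exact: measurable_enorm.
have mfz : measurable_fun setT (fun y => `|f (z y)|).
  by apply: measurableT_comp => //; exact: (measurableT_comp mf mz).
(* Putting |x|^a into [h] makes [h * w] equal to |f|, while [h^r * w] becomes the integrand
   |x|^(a(r-1)) |f|^r of [powf]. *)
pose h y := `|f (z y)| * enorm (z y) `^ a.
pose w y := enorm (z y) `^ (- a).
have H := @weighted_power_mean R _ _ (lebesgue_rV R k') h w _ r r1 _ (measurable_funM mfz (me a)) (me (- a)) _ _ zE.
have hwE : (\int[lebesgue_rV R k']_y (h y * w y)%:E = \int[lebesgue_rV R k']_y absf f (z y))%E.
  apply: eq_integral => y _; rewrite /h /w -mulrA -powRD; last by rewrite (gt_eqF (ez y)) implybT.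
  by rewrite addrN powRr0 mulr1.
have hrE : (\int[lebesgue_rV R k']_y (h y `^ r * w y)%:E =
    \int[lebesgue_rV R k']_y powf (a * (r - 1)) r f (z y))%E.
  apply: eq_integral => y _; rewrite /h /w powRM ?powR_ge0// -powRrM -mulrA -powRD; last first.
    by rewrite (gt_eqF (ez y)) implybT.
  by rewrite /powf mulrC mulrBr mulr1.
rewrite -hwE -hrE; apply: H.
- by rewrite mulr_ge0 ?powR_ge0// ltW// cauchy_integral_gt0.
- by move=> y; rewrite mulr_ge0 ?powR_ge0.
- by move=> y; exact: powR_ge0.
Qed.

Variable dxi : probability G R.
Hypothesis hdxi : rotation_invariant dxi.

Definition area_ratio : R := sphere_area R (n - k) / sphere_area R n.

Lemma area_ratio_gt0 : 0 < area_ratio.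
Proof. by rewrite divr_gt0// sphere_area_gt0// subn_gt0; case/andP: hk. Qed.

Lemma measurable_poweRr d (T : measurableType d) (F : T -> \bar R) r :
  measurable_fun setT F -> measurable_fun setT (fun x => F x `^ r)%E.
Proof. by move=> mF; exact: (measurableT_comp (measurable_poweR r) mF). Qed.

Lemma kplane_power_bound f (mu r : R) : 1 <= r -> k%:R - n%:R / r < mu ->
  measurable_fun setT f ->
  (\int[plane_measure dxi]_tau
     ((plane_norm tau `^ ((mu - k%:R + k%:R / r) * r))%:E * (plane_integral (absf f) tau) `^ r) <=
   (area_ratio * cauchy_integral k (mu + n%:R / r) `^ r)%:E *
   \int[lebesgue_rV R n]_x powf (mu * r) r f x)%E.
Proof.
move=> r1 kmu mf; have r0 : 0 < r by rewrite (lt_le_trans ltr01).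
set a := mu + n%:R / r; have ka : k%:R < a by rewrite -ltrBlDr.
have c0 := cauchy_integral_gt0 ka; set c := cauchy_integral k a in c0 *.
(* [b] is the power of |tau| that remains after Hoelder's inequality: nu r + (k - a)(r - 1) = a - n,
   where nu = mu - k + k/r. The condition [b > k - n] is again a > k. *)
pose b := a - n%:R; pose F := powf (a * (r - 1)) r f.
have mF : measurable_fun setT F by exact: measurable_powf.
have F0 x : (0 <= F x)%E by exact: powf_ge0.
have kb : k%:R - n%:R < b by rewrite ltrD2r.
have bn : b + n%:R = a by rewrite subrK.
have key := integral_plane_weightE hdxi hk kb mF F0.
rewrite bn -/c -/area_ratio in key.
(* The exponents satisfy b + a (r - 1) = mu r; the origin, where powers do not add, is discarded. *)
have FE : (\int[lebesgue_rV R n]_x ((enorm x `^ b)%:E * F x) =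
    \int[lebesgue_rV R n]_x powf (mu * r) r f x)%E.
  apply: ge0_ae_eq_integral => //.
  - by apply: emeasurable_funM => //; exact: measurable_enormX.
  - exact: measurable_powf.
  - by move=> x _; rewrite mule_ge0 ?enormX_ge0.
  - by move=> x _; exact: powf_ge0.
  - apply: filterS (ae_rV_neq0 R n0) => x x0 _.
    rewrite /F /powf -EFinM mulrA -powRD; last by rewrite enorm_neq0 x0 implybT.
    rewrite (_ : b + a * (r - 1) = mu * r)//.
    by rewrite /b /a; field; rewrite gt_eqF.
rewrite FE in key.
pose W tau := ((plane_norm tau `^ b)%:E * plane_integral F tau)%E.
have mW : measurable_fun setT W.
  by apply: emeasurable_funM; [exact: measurable_plane_normX|exact: measurable_plane_integral].
have W0 tau : (0 <= W tau)%E by rewrite mule_ge0 ?plane_integral_ge0// lee_fin powR_ge0.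
have cr0 : (0 <= (c `^ (r - 1))%:E)%E by rewrite lee_fin powR_ge0.
have -> : (area_ratio * c `^ r)%:E = ((c `^ (r - 1))%:E * (area_ratio * c)%:E)%E.
  by rewrite -EFinM; congr EFin; rewrite mulrCA [_ * c]mulrC mulr_powRB1// ltW.
rewrite -muleA -key.
rewrite -(ge0_integralZl _ measurableT mW (fun t _ => W0 t) cr0).
apply: ae_ge0_le_integral => //.
- by move=> tau _; rewrite mule_ge0 ?poweR_ge0// lee_fin powR_ge0.
- apply: emeasurable_funM; first exact: measurable_plane_normX.
  apply: measurable_poweRr; apply: measurable_plane_integral; last exact: absf_ge0.
  exact: measurable_absf.
- by move=> tau _; rewrite mule_ge0.
- by apply: emeasurable_funM => //; exact: measurable_cst.
apply: filterS (ae_plane_norm_gt0 dxi hk) => tau t0 _.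
apply: le_trans (_ : ((plane_norm tau `^ ((mu - k%:R + k%:R / r) * r))%:E *
   (((c * plane_norm tau `^ (k%:R - a)) `^ (r - 1))%:E * plane_integral F tau) <= _)%E).
  by apply: lee_wpmul2l; [rewrite lee_fin powR_ge0|exact: plane_power_mean].
rewrite /W muleA muleCA !muleA -!EFinM; apply: lee_wpmul2r; first exact: plane_integral_ge0.
rewrite lee_fin powRM ?powR_ge0 ?(ltW c0)// -powRrM mulrCA -powRD; last by rewrite (gt_eqF t0) implybT.
rewrite (_ : _ * r + _ = b)// 1?mulrC//.
by rewrite /b /a; field; rewrite gt_eqF.
Qed.

End upper_bound.

Lemma weighted_norm_fin (R : realType) d (T : measurableType d)
    (m : {measure set T -> \bar R}) (r : R) (w f : T -> R) :
  0 < r -> (forall x, 0 <= w x) ->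
  weighted_norm m r%:E w f = ((\int[m]_x (w x `^ r * `|f x| `^ r)%:E) `^ r^-1)%E.
Proof.
move=> r0 w0; rewrite /weighted_norm unlock; congr (_ `^ _)%E.
apply: eq_integral => x _ /=; rewrite normrM (ger0_norm (w0 x)).
by rewrite powRM.
Qed.

(** For the exponent +oo, [Lnorm] is the essential supremum only on a space of positive measure;
    hence the two positivity lemmas below. *)
Lemma weighted_norm_infty (R : realType) d (T : measurableType d)
    (m : {measure set T -> \bar R}) (w f : T -> R) : (0 < m setT)%E ->
  weighted_norm m +oo w f = ess_sup m (fun x => `|w x * f x|%:E).
Proof. by move=> m0; rewrite /weighted_norm unlock m0. Qed.

(** * Norm estimates and almost everywhere integrability for finite and infinite exponents *)

Section norm_bounds.
Variables (R : realType) (n k : nat).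
Local Notation G := (grassmannian R n k).
Local Notation Pi := (affine_plane R n k).
Local Notation k' := (minn k n).
Implicit Types (tau : Pi) (f : 'rV[R]_n -> R).
Hypothesis hk : (0 < k < n)%N.
Variable dxi : probability G R.
Hypothesis hdxi : rotation_invariant dxi.
Local Notation dtau := (plane_measure dxi).
Local Notation lam := (lebesgue_rV R n).
Local Notation wx mu := (fun x : 'rV[R]_n => enorm x `^ mu).
Local Notation wtau nu := (fun tau : Pi => plane_norm tau `^ nu).

Let n0 : (0 < n)%N. Proof. by case/andP: hk => /ltn_trans; apply. Qed.

Lemma weighted_norm_rV (r mu : R) f : 0 < r ->
  weighted_norm lam r%:E (wx mu) f = ((\int[lam]_x powf (mu * r) r f x) `^ r^-1)%E.
Proof.
move=> r0; have w0 (x : 'rV[R]_n) : 0 <= enorm x `^ mu by exact: powR_ge0.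
rewrite (weighted_norm_fin lam f r0 w0).
suff -> : (\int[lam]_x ((enorm x `^ mu) `^ r * `|f x| `^ r)%:E = \int[lam]_x powf (mu * r) r f x)%E by [].
by apply: eq_integral => x _; rewrite /powf powRrM.
Qed.

Lemma kplane_norm_fin (r mu : R) f : 1 <= r -> k%:R - n%:R / r < mu ->
  measurable_fun setT f ->
  (weighted_norm dtau r%:E (wtau (mu - k%:R + k%:R / r)) (@kplane_transform R n k f) <=
   (area_ratio R n k `^ r^-1 * cauchy_integral k (mu + n%:R / r))%:E *
   weighted_norm lam r%:E (wx mu) f)%E.
Proof.
move=> r1 kmu mf; have r0 : 0 < r by rewrite (lt_le_trans ltr01).
have ka : k%:R < mu + n%:R / r by rewrite -ltrBlDr.
have c0 := cauchy_integral_gt0 ka.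
have A0 := area_ratio_gt0 R hk.
set nu := _ + _; have w0 tau : 0 <= plane_norm tau `^ nu by exact: powR_ge0.
rewrite (weighted_norm_rV mu f r0) (weighted_norm_fin dtau _ r0 w0); set c := cauchy_integral _ _ in c0 *; set A := area_ratio R n k in A0 *.
have I0 : (0 <= \int[lam]_x powf (mu * r) r f x)%E.
  by apply: integral_ge0 => x _; exact: powf_ge0.
have -> : (A `^ r^-1 * c)%:E = ((A * c `^ r)%:E `^ r^-1)%E.
  rewrite poweR_EFin powRM ?powR_ge0 ?(ltW A0)// -powRrM mulfV ?gt_eqF//.
  by rewrite powRr1// ltW.
rewrite -poweRM//; last by rewrite lee_fin mulr_ge0 ?powR_ge0// ltW.
apply: gt0_ler_poweR.
- by rewrite invr_ge0 ltW.
- rewrite in_itv/= leey andbT; apply: integral_ge0 => x _.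
  by rewrite lee_fin mulr_ge0 ?powR_ge0.
- by rewrite in_itv/= leey andbT mule_ge0// lee_fin mulr_ge0 ?powR_ge0// ltW.
apply: le_trans (kplane_power_bound hk hdxi r1 kmu mf).
apply: (ge0_le_integral dtau measurableT).
- by move=> x _; rewrite lee_fin mulr_ge0 ?powR_ge0.
- apply/measurable_EFinP; apply: measurable_funM.
    apply: (measurableT_comp (measurable_powR _)); apply: (measurableT_comp (measurable_powR _)).
    exact: measurable_plane_norm.
  apply: (measurableT_comp (measurable_powR _)); apply: measurableT_comp => //.
  exact: measurable_kplane_transform.
- apply: emeasurable_funM; first exact: measurable_plane_normX.
  apply: measurable_poweRr; apply: measurable_plane_integral; last exact: absf_ge0.
  exact: measurable_absf.
- move=> tau _; rewrite EFinM -powRrM; apply: lee_wpmul2l; first by rewrite lee_fin powR_ge0.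
  rewrite -poweR_EFin; apply: gt0_ler_poweR; first exact: ltW.
  + by rewrite in_itv/= leey andbT lee_fin.
  + by rewrite in_itv/= leey andbT plane_integral_ge0// => x; exact: absf_ge0.
  exact: le_kplane_transform.
Qed.

(** [kplane_power_bound] controls the integrals of |f| over planes and not merely the transform of
    [f], so these integrals are finite for almost every plane. *)
Lemma ae_kplane_integrable_fin (r mu : R) f : 1 <= r -> k%:R - n%:R / r < mu ->
  measurable_fun setT f -> (weighted_norm lam r%:E (wx mu) f < +oo)%E ->
  {ae dtau, forall tau, kplane_integrable f tau}.
Proof.
move=> r1 kmu mf; have r0 : 0 < r by rewrite (lt_le_trans ltr01).
rewrite (weighted_norm_rV mu f r0) => /lty_poweRy; rewrite invr_eq0 gt_eqF// => /(_ isT) Ioo.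
have B := kplane_power_bound hk hdxi r1 kmu mf.
have I0 : (0 <= \int[lam]_x powf (mu * r) r f x)%E.
  by apply: integral_ge0 => x _; exact: powf_ge0.
pose W tau := ((plane_norm tau `^ ((mu - k%:R + k%:R / r) * r))%:E * (plane_integral (absf f) tau) `^ r)%E.
have P0 tau : (0 <= plane_integral (absf f) tau)%E.
  by apply: plane_integral_ge0 => x; exact: absf_ge0.
have W0 tau : (0 <= W tau)%E by rewrite mule_ge0 ?poweR_ge0// lee_fin powR_ge0.
have mW : measurable_fun setT W.
  apply: emeasurable_funM; first exact: measurable_plane_normX.
  apply: measurable_poweRr; apply: measurable_plane_integral; last exact: absf_ge0.
  exact: measurable_absf.
have iW : dtau.-integrable setT W.
  apply/integrableP; split => //.
  under eq_integral do rewrite gee0_abs//.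
  apply: (le_lt_trans B); rewrite lte_mul_pinfty//.
  by rewrite lee_fin mulr_ge0 ?powR_ge0// ltW// area_ratio_gt0.
have := integrable_ae measurableT iW.
apply: filterS2 (ae_plane_norm_gt0 dxi hk) => tau t0 /(_ Logic.I) Wfin.
apply/kplane_integrableP => //; rewrite ltNge leye_eq; apply/negP => /eqP Poo.
move: Wfin; rewrite /W Poo poweRyr ?gt_eqF// gt0_muley//.
by rewrite lte_fin powR_gt0.
Qed.

(** The total mass dominates the integral of the Gaussian, which is at most 1 everywhere. *)
Lemma lebesgue_rV_setT_gt0 d : (0 < lebesgue_rV R d setT)%E.
Proof.
apply: (@lt_le_trans _ _ (\int[lebesgue_rV R d]_x gaussv x)%E).
  by rewrite integral_gaussv lte_fin powR_gt0// pi_gt0.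
rewrite -[leRHS]mul1e -integral_cst//; apply: ge0_le_integral => //.
- by move=> x _; exact: gaussv_ge0.
- exact: measurable_gaussv.
- by move=> x _; rewrite lee_fin -expR0 ler_expR oppr_le0 dotv_ge0.
Qed.

Lemma plane_measure_setT_gt0 : (0 < dtau setT)%E.
Proof.
have mc : measurable_fun (setT : set Pi) (cst 1%E : Pi -> \bar R) by exact: measurable_cst.
have := integral_plane_measure dxi mc (fun=> lee01).
rewrite integral_cst// mul1e => ->.
have c1 xi : (\int[lebesgue_rV R (n - k')]_u (cst 1 (plane_param (xi, u)) : \bar R) =
    lebesgue_rV R (n - k') setT)%E.
  by apply: (etrans (integral_cst (lebesgue_rV R (n - k')) measurableT 1%E)); rewrite mul1e.
under eq_integral do rewrite c1.
rewrite (integral_cst dxi measurableT) [X in (_ * X)%E](_ : _ = 1%E).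
  by rewrite mule1 lebesgue_rV_setT_gt0.
exact: probability_setT.
Qed.

Lemma ae_plane_bound_infty (mu e : R) f : k%:R < mu -> 0 <= e ->
  measurable_fun setT f ->
  {ae lam, forall x, `|enorm x `^ mu * f x| <= e} ->
  {ae dtau, forall tau, 0 < plane_norm tau /\ (plane_integral (absf f) tau <=
     (e * (cauchy_integral k mu * plane_norm tau `^ (k%:R - mu)))%:E)%E}.
Proof.
move=> kmu e0 mf fe.
pose B := [set x : 'rV[R]_n | e * enorm x `^ (- mu) < `|f x|].
have mB : measurable B.
  rewrite -[B]setTI; apply: measurable_fun_ltr => //.
    apply: measurable_funM => //; apply: (measurableT_comp (measurable_powR _)).
    exact: measurable_enorm.
  exact: measurableT_comp.
have fe0 : {ae lam, forall x, (\1_B x : R) = 0}.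
  apply: filterS2 (ae_rV_neq0 R n0) fe => x x0 fx.
  rewrite indicE memNset//= /B/= => h; move: fx; apply/negP; rewrite -ltNge.
  have ex : 0 < enorm x by rewrite enorm_gt0.
  by rewrite normrM ger0_norm ?powR_ge0// mulrC -ltr_pdivrMr ?powR_gt0// -powRN.
(* [|f| <= e |x|^-mu + F] everywhere, and [F] integrates to 0 over almost every plane. *)
pose F x : \bar R := (+oo * (\1_B x : R)%:E)%E.
have mI : measurable_fun setT (fun x => (\1_B x : R)%:E) by exact/measurable_EFinP/measurable_indic.
have mF : measurable_fun setT F by apply: emeasurable_funM => //; exact: measurable_cst.
have F0 x : (0 <= F x)%E by rewrite mule_ge0// lee_fin.
have nk0 : k%:R - n%:R < 0 :> R by rewrite subr_lt0 ltr_nat; case/andP: hk.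
(* The exponent 0 is admissible because k < n. The identity then says that the null set [B] meets
   almost every plane in a null set. *)
have := integral_plane_weightE hdxi hk nk0 mF F0.
rewrite [X in (_ * X)%E](_ : _ = 0%E); last first.
  rewrite (ge0_ae_eq_integral (g := cst 0%E))//; first by rewrite integral0.
  - by apply: emeasurable_funM => //; exact: measurable_enormX.
  - by move=> x _; rewrite mule_ge0 ?enormX_ge0.
  - by apply: filterS fe0 => x h _; rewrite /F h !mule0.
rewrite mule0.
pose V tau := ((plane_norm tau `^ 0)%:E * plane_integral F tau)%E.
have mV : measurable_fun setT V.
  by apply: emeasurable_funM; [exact: measurable_plane_normX|exact: measurable_plane_integral].
have V0 tau : (0 <= V tau)%E by rewrite mule_ge0 ?plane_integral_ge0// lee_fin powR_ge0.
move=> IV; have : (\int[dtau]_tau `|V tau| = 0)%E.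
  by under eq_integral do rewrite gee0_abs//.
move=> IV0; have := (ae_eq_integral_abs dtau measurableT mV).1 IV0.
apply: filterS2 (ae_plane_norm_gt0 dxi hk) => tau t0 /(_ Logic.I).
rewrite /V powRr0 mul1e /= => PF0; split => //.
pose H (x : 'rV[R]_n) := (e%:E * (enorm x `^ (- mu))%:E)%E.
have mH : measurable_fun setT H by apply: emeasurable_funM => //; exact: measurable_enormX.
have H0 x : (0 <= H x)%E by rewrite mule_ge0 ?enormX_ge0.
have PH : plane_integral H tau = (e * (cauchy_integral k mu * plane_norm tau `^ (k%:R - mu)))%:E.
  rewrite EFinM -(plane_integral_enormN hk kmu t0).
  have me := measurable_translate_offset tau (@measurable_enormX R n (- mu)).
  exact: (ge0_integralZl _ measurableT me (fun x _ => enormX_ge0 _ _)).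
have PHF : plane_integral (fun x => H x + F x)%E tau = (plane_integral H tau + plane_integral F tau)%E.
  exact: (ge0_integralD _ measurableT (fun _ _ => H0 _) (measurable_translate_offset tau mH)
    (fun _ _ => F0 _) (measurable_translate_offset tau mF)).
rewrite -PH -[leRHS]adde0 -PF0 -PHF; apply: (ge0_le_integral _ measurableT).
- by move=> y _; exact: absf_ge0.
- exact: (measurable_translate_offset tau (measurable_absf mf)).
- exact: (measurable_translate_offset tau (emeasurable_funD mH mF)).
- move=> y _; move: (y + offset tau) => x; rewrite /F /absf indicE.
  have [xB|xB] := boolP (x \in B).
    by rewrite mule1 addey ?leey// gt_eqF// (lt_le_trans _ (H0 x)).
  rewrite mule0 adde0 /H -EFinM lee_fin leNgt; apply/negP => h.
  by move/negP: xB; apply; apply/mem_set.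
Qed.

Lemma ae_le_weighted_norm_infty (mu e : R) f :
  (weighted_norm lam +oo (wx mu) f <= e%:E)%E ->
  {ae lam, forall x, `|enorm x `^ mu * f x| <= e}.
Proof.
by rewrite weighted_norm_infty ?lebesgue_rV_setT_gt0// => /ess_supP; apply: filterS => x; rewrite lee_fin.
Qed.

Lemma ae_kplane_integrable_infty (mu : R) f : k%:R < mu ->
  measurable_fun setT f -> (weighted_norm lam +oo (wx mu) f < +oo)%E ->
  {ae dtau, forall tau, kplane_integrable f tau}.
Proof.
move=> kmu mf foo; have f0 : (0 <= weighted_norm lam +oo (wx mu) f)%E by exact: Lnorm_ge0.
have ff : weighted_norm lam +oo (wx mu) f \is a fin_num by rewrite ge0_fin_numE.
have := @ae_plane_bound_infty mu (fine (weighted_norm lam +oo (wx mu) f)) f kmu (fine_ge0 f0) mf.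
move=> /(_ (ae_le_weighted_norm_infty _)); rewrite fineK// => /(_ (lexx _)).
apply: filterS => tau [_ h]; apply/kplane_integrableP => //.
by apply: (le_lt_trans h); rewrite ltry.
Qed.

Lemma kplane_norm_infty (mu : R) f : k%:R < mu -> measurable_fun setT f ->
  (weighted_norm dtau +oo (wtau (mu - k%:R)) (@kplane_transform R n k f) <=
   (cauchy_integral k mu)%:E * weighted_norm lam +oo (wx mu) f)%E.
Proof.
move=> kmu mf; have f0 : (0 <= weighted_norm lam +oo (wx mu) f)%E by exact: Lnorm_ge0.
have c0 := cauchy_integral_gt0 kmu.
have [foo|] := eqVneq (weighted_norm lam +oo (wx mu) f) +oo%E.
  by rewrite foo gt0_muley ?lte_fin// leey.
move=> foo; have ff : weighted_norm lam +oo (wx mu) f \is a fin_num by rewrite ge0_fin_numE// lt_neqAle foo leey.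
have := @ae_plane_bound_infty mu (fine (weighted_norm lam +oo (wx mu) f)) f kmu (fine_ge0 f0) mf.
move=> /(_ (ae_le_weighted_norm_infty _)); rewrite fineK// => /(_ (lexx _)) B.
rewrite weighted_norm_infty ?plane_measure_setT_gt0//; apply/ess_supP.
apply: filterS B => tau [t0 h].
have {}h := le_trans (le_kplane_transform tau mf) h; rewrite lee_fin in h.
rewrite -(fineK ff) -EFinM lee_fin normrM ger0_norm ?powR_ge0//.
apply: (le_trans (ler_wpM2l (powR_ge0 _ _) h)).
rewrite mulrCA [_ `^ _ * _]mulrCA -powRD; last by rewrite (gt_eqF t0) implybT.
by rewrite addrC subrKA subrr powRr0 mulr1 mulrC.
Qed.

End norm_bounds.

(** * The lower bound *)

Section cauchy_limit.
Variable R : realType.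

Lemma cvg_powR_exponent (c a : R) (u : R^nat) : 0 < c -> u @ \oo --> a ->
  c `^ u j @[j --> \oo] --> c `^ a.
Proof.
move=> c0 ua; rewrite /powR gt_eqF//.
apply: continuous_cvg; first exact: continuous_expR.
by apply: cvgMl.
Qed.

(** As e decreases to 0 along 1/(j+1), the integrands (|y|^2 + 1)^(-(a+e)/2) increase, their base
    being at least 1. Monotone convergence thus gives the limit of C(a+e) with no continuity of the
    Gamma function. *)
Lemma cauchy_integral_limit (k : nat) (a q : R) (Y : \bar R) : k%:R < a -> 0 < q ->
  (forall e, 0 < e -> ((q * cauchy_integral k (a + e))%:E <= Y)%E) ->
  ((q * cauchy_integral k a)%:E <= Y)%E.
Proof.
move=> ka q0 h; rewrite EFinM -lee_pdivlMl// -(integral_cauchy1 ka).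
pose e (j : nat) : R := j.+1%:R^-1.
have e0 j : 0 < e j by rewrite invr_gt0 ltr0n.
pose g (j : nat) (y : 'rV[R]_k) : \bar R := ((dotv y y + 1) `^ (- ((a + e j) / 2)))%:E.
have d1 (y : 'rV[R]_k) : 1 <= dotv y y + 1 by rewrite lerDr dotv_ge0.
have d0 (y : 'rV[R]_k) : 0 < dotv y y + 1 by rewrite (lt_le_trans ltr01).
have mg j : measurable_fun setT (g j).
  apply/measurable_EFinP; apply: (measurableT_comp (measurable_powR _)).
  by apply: measurable_funD => //; exact: measurable_dotvv.
have g0 j y : setT y -> (0 <= g j y)%E by move=> _; rewrite lee_fin powR_ge0.
have ndg y : setT y -> {homo g^~ y : i j / (i <= j)%N >-> (i <= j)%E}.
  move=> _ i j ij; rewrite lee_fin; apply: ler_powR => //.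
  rewrite lerN2 ler_pM2r// lerD2l lef_pV2 ?posrE ?ltr0n//.
  by rewrite ler_nat.
have cvg := @cvg_monotone_convergence _ _ _ (lebesgue_rV R k) _ measurableT g mg g0 ndg.
have -> : (\int[lebesgue_rV R k]_y ((dotv y y + 1) `^ (- (a / 2)))%:E =
    \int[lebesgue_rV R k]_y limn (g^~ y))%E.
  apply: eq_integral => y _; apply/esym/cvg_lim => //.
  apply: cvg_EFin; first exact: nearW.
  apply: cvg_powR_exponent => //; apply: cvgN; apply: cvgMl.
  by rewrite -[X in _ --> X]addr0; apply: cvgD; [exact: cvg_cst|exact: cvg_harmonic].
rewrite -(cvg_lim _ cvg)//; apply: lime_le; first by apply/cvg_ex; eexists; exact: cvg.
apply: nearW => j; have kaj : k%:R < a + e j by rewrite (lt_trans ka)// ltrDl.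
rewrite (integral_cauchy1 kaj) lee_pdivlMl//.
exact: h.
Qed.

End cauchy_limit.

Section lower_bound.
Variables (R : realType) (n k : nat).
Local Notation G := (grassmannian R n k).
Local Notation Pi := (affine_plane R n k).
Local Notation k' := (minn k n).
Local Notation m := (n - minn k n)%N.
Implicit Types (tau : Pi) (f : 'rV[R]_n -> R).
Hypothesis hk : (0 < k < n)%N.
Variable dxi : probability G R.
Local Notation dtau := (plane_measure dxi).
Local Notation lam := (lebesgue_rV R n).
Local Notation wx mu := (fun x : 'rV[R]_n => enorm x `^ mu).
Local Notation wtau nu := (fun tau : Pi => plane_norm tau `^ nu).

Let n0 : (0 < n)%N. Proof. by case/andP: hk => /ltn_trans; apply. Qed.
Let k'E : k' = k. Proof. by apply/minn_idPl/ltnW; case/andP: hk. Qed.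
Let mE : m = (n - k)%N. Proof. by rewrite k'E. Qed.
Let m0 : (0 < m)%N. Proof. by rewrite mE subn_gt0; case/andP: hk. Qed.

(** The cut at |x| = 1 removes the singularity at 0. The dimension is a parameter because the
    function serves on R^n as test function and on the offsets, in dimension n - k, as a lower bound
    for its transform. *)
Definition tail d (b : R) (x : 'rV[R]_d) : R :=
  if 1 <= dotv x x then enorm x `^ (- b) else 0.

Lemma tail_ge0 d b (x : 'rV[R]_d) : 0 <= tail b x.
Proof. by rewrite /tail; case: ifP => // _; rewrite powR_ge0. Qed.

Lemma measurable_tail d b : measurable_fun setT (@tail d b).
Proof.
apply: measurable_fun_ifT => //; first by apply: measurable_fun_ler => //; exact: measurable_dotvv.
by apply: (measurableT_comp (measurable_powR _)); exact: measurable_enorm.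
Qed.

Lemma integral_tail d (e : R) : (0 < d)%N -> 0 < e ->
  (\int[lebesgue_rV R d]_x (tail (d%:R + e) x)%:E = (sphere_area R d / e)%:E)%E.
Proof.
move=> d0 e0; pose F t : \bar R := (if 1 <= t then t `^ (- ((d%:R + e) / 2)) else 0)%:E.
transitivity (\int[lebesgue_rV R d]_x F (dotv x x))%E.
  by apply: eq_integral => x _; rewrite /tail /F enorm_powR mulNr.
rewrite integral_radial//; last 2 first.
- exact: measurable_if_ge1.
- by move=> t; rewrite lee_fin; case: ifP => // _; rewrite powR_ge0.
have e2 : 0 < e / 2 by rewrite divr_gt0.
rewrite (@eq_mint _ _ (fun t => (if 1 <= t then t `^ (- (e / 2)) else 0)%:E)).
  rewrite mint_powRN_ge1// -EFinM; congr EFin; field; rewrite gt_eqF//.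
move=> t t0; rewrite /F -EFinM; congr EFin; case: ifP => _; last by rewrite mulr0.
rewrite -powRD; last by rewrite (gt_eqF t0) implybT.
by congr (_ `^ _); field.
Qed.

Lemma powf_tail (mu r b s : R) (x : 'rV[R]_n) : 0 <= s -> r != 0 ->
  powf (mu * r) r (fun x => s * tail b x) x = ((s `^ r)%:E * (tail (b * r - mu * r) x)%:E)%E.
Proof.
move=> s0 r0; rewrite /powf -EFinM; congr EFin.
rewrite ger0_norm ?mulr_ge0 ?tail_ge0// powRM ?tail_ge0// mulrCA; congr (_ * _).
rewrite /tail; case: ifPn => x1; last by rewrite powR0// mulr0.
have x0 : x != 0 by rewrite -dotv_gt0 (lt_le_trans ltr01).
rewrite -powRrM -powRD; last by rewrite enorm_neq0 x0 implybT.
by rewrite opprB mulNr addrC.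
Qed.

(** A plane at distance at least 1 from the origin does not see the cut, so the full power can be
    integrated instead. *)
Lemma kplane_transform_tail (b s : R) tau : k%:R < b -> 0 <= s -> 1 <= plane_norm tau ->
  kplane_transform (fun x => s * tail b x) tau = s * (cauchy_integral k b * plane_norm tau `^ (k%:R - b)).
Proof.
move=> kb s0 t1; have t0 : 0 < plane_norm tau by rewrite (lt_le_trans ltr01).
pose F (x : 'rV[R]_n) : \bar R := (s * tail b x)%:E.
have mF : measurable_fun setT F.
  by apply/measurable_EFinP; apply: measurable_funM => //; exact: measurable_tail.
have F0 x : (0 <= F x)%E by rewrite lee_fin mulr_ge0 ?tail_ge0.
transitivity (fine (plane_integral F tau)); first by [].
pose H (x : 'rV[R]_n) : \bar R := (enorm x `^ (- b))%:E.
have mHt := measurable_translate_offset tau (@measurable_enormX R n (- b)).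
suff -> : plane_integral F tau = (s%:E * plane_integral H tau)%E by rewrite (plane_integral_enormN hk kb t0).
rewrite (plane_integralE tau mF F0) (plane_integralE tau (@measurable_enormX R n (- b)) (enormX_ge0 (- b))).
have mHz : measurable_fun setT (fun y : 'rV[R]_k' => H (y *m onb k' (val (direction tau)) + offset tau)).
  apply: (measurableT_comp (@measurable_enormX R n (- b))).
  by apply: measurable_addmx; [exact: measurable_mulmx_cst|exact: measurable_cst].
have s0' : (0 <= s%:E)%E by rewrite lee_fin.
rewrite -[RHS](ge0_integralZl _ measurableT mHz (fun _ _ => enormX_ge0 _ _) s0').
apply: eq_integral => y _; rewrite /F /H /tail dotv_plane_point.
by rewrite ifT -?EFinM// (le_trans _ (_ : plane_norm tau ^+ 2 <= _)) ?lerDr ?dotv_ge0// exprn_ege1.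
Qed.

(** Planes with |tau| < 1 are discarded; on the others the transform is explicit. *)
Lemma kplane_tail_bound (mu r e s : R) : 1 <= r -> k%:R - n%:R / r < mu -> 0 < e -> 0 <= s ->
  (((s * cauchy_integral k (mu + n%:R / r + e)) `^ r * (sphere_area R (n - k) / (e * r)))%:E <=
   \int[dtau]_tau ((plane_norm tau `^ (mu - k%:R + k%:R / r)) `^ r *
     `|kplane_transform (fun x => s * tail (mu + n%:R / r + e) x) tau| `^ r)%:E)%E.
Proof.
move=> r1 kmu e0 s0; have r0 : 0 < r by rewrite (lt_le_trans ltr01).
have ka : k%:R < mu + n%:R / r by rewrite -ltrBlDr.
set b := mu + n%:R / r + e; have kb : k%:R < b by rewrite (lt_trans ka)// ltrDl.
have c0 := cauchy_integral_gt0 kb; set c := cauchy_integral k b in c0 *.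
have er0 : 0 < e * r by rewrite mulr_gt0.
pose q := (s * c) `^ r; have q0 : 0 <= q by exact: powR_ge0.
(* The exponent is (nu + k - b) r = -(n - k) - e r with nu = mu - k + k/r, so the integral over the
   offsets is that of a [tail] in dimension n - k. *)
pose L tau : \bar R := (q%:E * (tail (m%:R + e * r) (offset tau))%:E)%E.
have mTl : measurable_fun setT (fun tau => (tail (m%:R + e * r) (offset tau))%:E).
  apply/measurable_EFinP; apply: (measurableT_comp (measurable_tail _)).
  exact: measurable_offset.
have mL : measurable_fun setT L by apply: emeasurable_funM => //; exact: measurable_cst.
have L0 tau : (0 <= L tau)%E by rewrite mule_ge0// lee_fin// tail_ge0.
have LE : (\int[dtau]_tau L tau = (q * (sphere_area R (n - k) / (e * r)))%:E)%E.
  apply: (etrans (integral_plane_measure dxi mL L0)).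
  rewrite -mE EFinM -(integral_tail m0 er0).
  have mt : measurable_fun setT (fun u : 'rV[R]_m => (tail (m%:R + e * r) u)%:E).
    by apply/measurable_EFinP; exact: measurable_tail.
  have q0' : (0 <= q%:E)%E by [].
  rewrite -[RHS](ge0_integralZl _ measurableT mt (fun u _ => tail_ge0 _ u) q0').
  set J := (\int[lebesgue_rV R m]_u (_ * _))%E.
  transitivity (\int[dxi]_xi (cst J xi))%E; last first.
    rewrite (integral_cst dxi measurableT) [X in (_ * X)%E](_ : _ = 1%E) ?mule1//.
    exact: probability_setT.
  apply: eq_integral => xi _; apply: eq_integral => u _.
  have oE : dotv (offset (plane_param (xi, u))) (offset (plane_param (xi, u))) = dotv u u.
    exact: (dotv_mul_onb _ (dim_orthc_grass xi)).
  by rewrite /L /tail /enorm oE.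
rewrite -LE; apply: (ge0_le_integral dtau measurableT).
- by move=> tau _; exact: L0.
- exact: mL.
- apply/measurable_EFinP; apply: measurable_funM.
    apply: (measurableT_comp (measurable_powR _)); apply: (measurableT_comp (measurable_powR _)).
    exact: measurable_plane_norm.
  apply: (measurableT_comp (measurable_powR _)); apply: (measurableT_comp (@normr_measurable R setT)).
  apply: measurable_kplane_transform; apply: measurable_funM => //; exact: measurable_tail.
move=> tau _; rewrite /L -EFinM lee_fin /tail; case: ifPn => t1; last by rewrite mulr0 mulr_ge0 ?powR_ge0.
have t1' : 1 <= plane_norm tau by rewrite /plane_norm /enorm -[1]sqrtr1 ler_wsqrtr.
have t0 : 0 < plane_norm tau by rewrite (lt_le_trans ltr01).
rewrite (kplane_transform_tail kb s0 t1') -/c -/(plane_norm tau).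
rewrite ger0_norm; last by rewrite mulr_ge0// mulr_ge0 ?powR_ge0// ltW.
set T := plane_norm tau `^ (k%:R - b).
have -> : (s * (c * T)) `^ r = q * T `^ r.
  by rewrite mulrA powRM ?powR_ge0// mulr_ge0// ltW.
rewrite mulrCA ler_wpM2l// /T.
rewrite -!powRrM -powRD; last by rewrite (gt_eqF t0) implybT.
rewrite le_eqVlt; apply/orP; left; apply/eqP; congr (_ `^ _).
rewrite k'E natrB; last by apply: ltnW; case/andP: hk.
by rewrite /b; field; rewrite gt_eqF.
Qed.

Lemma operator_norm_ge_fin (mu r e : R) : 1 <= r -> k%:R - n%:R / r < mu -> 0 < e ->
  ((area_ratio R n k `^ r^-1 * cauchy_integral k (mu + n%:R / r + e))%:E <=
   operator_norm lam dtau r%:E (wx mu) (wtau (mu - k%:R + k%:R / r)) (@kplane_transform R n k))%E.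
Proof.
move=> r1 kmu e0; have r0 : 0 < r by rewrite (lt_le_trans ltr01).
have ka : k%:R < mu + n%:R / r by rewrite -ltrBlDr.
have kb : k%:R < mu + n%:R / r + e by rewrite (lt_trans ka)// ltrDl.
have c0 := cauchy_integral_gt0 kb.
have S0 := @sphere_area_gt0 R n n0.
have Sm0 : 0 < sphere_area R (n - k) by rewrite sphere_area_gt0// subn_gt0; case/andP: hk.
have er0 : 0 < e * r by rewrite mulr_gt0.
(* [N] is the integral of the r-th power of the weighted [tail], so the factor [s] normalizes [f] to
   norm 1. *)
pose N := sphere_area R n / (e * r); have N0 : 0 < N by rewrite divr_gt0.
pose s := N `^ (- r^-1); have s0 : 0 < s by rewrite powR_gt0.
have sr : s `^ r = N^-1 by rewrite -powRrM mulNr mulVf ?gt_eqF// powR_inv1// ltW.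
pose f (x : 'rV[R]_n) := s * tail (mu + n%:R / r + e) x.
have mf : measurable_fun setT f by apply: measurable_funM => //; exact: measurable_tail.
have Nf : weighted_norm lam r%:E (wx mu) f = 1%E.
  rewrite (weighted_norm_rV mu f r0).
  suff -> : (\int[lam]_x powf (mu * r) r f x = 1)%E by rewrite poweR1r.
  have mt : measurable_fun setT (fun x : 'rV[R]_n => (tail (n%:R + e * r) x)%:E).
    by apply/measurable_EFinP; exact: measurable_tail.
  have sr0 : (0 <= (s `^ r)%:E)%E by rewrite lee_fin powR_ge0.
  transitivity ((s `^ r)%:E * \int[lam]_x (tail (n%:R + e * r) x)%:E)%E.
    rewrite -(ge0_integralZl _ measurableT mt (fun x _ => tail_ge0 _ x) sr0).
    apply: eq_integral => x _; rewrite (powf_tail _ _ _ (ltW s0)) ?gt_eqF//.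
    by congr (_ * (tail _ _)%:E)%E; field; rewrite gt_eqF.
  by rewrite (integral_tail n0 er0) sr -EFinM -/N mulVf ?gt_eqF.
apply: ereal_sup_ge; exists (weighted_norm dtau r%:E (wtau (mu - k%:R + k%:R / r)) (@kplane_transform R n k f)).
  exists f => //; split; last by rewrite Nf.
  by split => //; rewrite Nf ltry.
set nu := mu - _ + _; have w0 tau : 0 <= plane_norm tau `^ nu by exact: powR_ge0.
rewrite (weighted_norm_fin dtau _ r0 w0).
set c := cauchy_integral k _ in c0 *.
have -> : (area_ratio R n k `^ r^-1 * c)%:E =
    (((s * c) `^ r * (sphere_area R (n - k) / (e * r)))%:E `^ r^-1)%E.
  have A0 := area_ratio_gt0 R hk.
  (* The factors [e * r], responsible for the blow-up of both norms, cancel and leave the ratio of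
     the areas. *)
  have XE : N^-1 * (sphere_area R (n - k) / (e * r)) = area_ratio R n k.
    have fld (s1 s2 q : R) : s2 != 0 -> q != 0 -> (s2 / q)^-1 * (s1 / q) = s1 / s2.
      by move=> s20 q0; field; rewrite s20 q0.
    by apply: fld; rewrite gt_eqF.
  rewrite poweR_EFin (powRM _ (ltW s0) (ltW c0)) sr mulrAC XE (powRM _ (ltW A0) (powR_ge0 _ _)).
  by rewrite -(powRrM c) mulfV ?gt_eqF// (powRr1 (ltW c0)).
apply: gt0_ler_poweR.
- by rewrite invr_ge0 ltW.
- by rewrite in_itv/= leey andbT lee_fin (mulr_ge0 (powR_ge0 _ _) (ltW (divr_gt0 Sm0 er0))).
- rewrite in_itv/= leey andbT; apply: integral_ge0 => x _.
  by rewrite lee_fin mulr_ge0 ?powR_ge0.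
exact: kplane_tail_bound r1 kmu e0 (ltW s0).
Qed.

Lemma operator_norm_ge_infty (mu : R) : k%:R < mu ->
  ((cauchy_integral k mu)%:E <=
   operator_norm lam dtau +oo (wx mu) (wtau (mu - k%:R)) (@kplane_transform R n k))%E.
Proof.
move=> kmu; have mu0 : 0 < mu by rewrite (le_lt_trans _ kmu)// ler0n.
have c0 := cauchy_integral_gt0 kmu.
pose f (x : 'rV[R]_n) := enorm x `^ (- mu).
have mf : measurable_fun setT f.
  by apply: (measurableT_comp (measurable_powR _)); exact: measurable_enorm.
have Nf : (weighted_norm lam +oo (wx mu) f <= 1)%E.
  rewrite weighted_norm_infty ?lebesgue_rV_setT_gt0//; apply/ess_supP.
  apply: filterS (ae_rV_neq0 R n0) => x x0; rewrite lee_fin /f -powRD; last first.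
    by rewrite enorm_neq0 x0 implybT.
  by rewrite addrN powRr0 normr1.
apply: ereal_sup_ge; exists (weighted_norm dtau +oo (wtau (mu - k%:R)) (@kplane_transform R n k f)).
  exists f => //; split => //; split => //.
  by apply: (le_lt_trans Nf); rewrite ltry.
rewrite (weighted_norm_infty _ _ (plane_measure_setT_gt0 dxi)).
apply: ess_sup_gee; first exact: plane_measure_setT_gt0.
apply: filterS (ae_plane_norm_gt0 dxi hk) => tau t0.
(* Off the planes through the origin, |tau|^(mu-k) times the transform is the constant C(mu), hence
   so is its essential supremum. *)
have -> : kplane_transform f tau = cauchy_integral k mu * plane_norm tau `^ (k%:R - mu).
  transitivity (fine (plane_integral (fun x => (enorm x `^ (- mu))%:E) tau)); first by [].
  by rewrite (plane_integral_enormN hk kmu t0).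
rewrite lee_fin mulrCA -powRD; last by rewrite (gt_eqF t0) implybT.
by rewrite addrC subrKA subrr powRr0 mulr1 ger0_norm// ltW.
Qed.

End lower_bound.

(** * From the estimates to the bounded operator and its norm *)

Section bounded_operator.
Variables (R : realType) (n k : nat).
Variable dxi : probability (grassmannian R n k) R.
Local Notation dtau := (plane_measure dxi).
Local Notation lam := (lebesgue_rV R n).
Variables (p : \bar R) (wx : 'rV[R]_n -> R) (wtau : affine_plane R n k -> R) (C : R).
Local Notation K := (@kplane_transform R n k).

(** Additivity relies on both integrals being finite; for functions of the weighted space this holds
    only for almost every plane. *)
Lemma kplane_transform_linear (a b : R) f g (tau : affine_plane R n k) :
  kplane_integrable f tau -> kplane_integrable g tau ->
  K (fun x => a * f x + b * g x) tau = a * K f tau + b * K g tau.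
Proof.
move=> fi gi.
have mT := @measurableT _ 'rV[R]_n.
have ai := integrableZl mT a fi; have bi := integrableZl mT b gi.
rewrite /kplane_transform (RintegralD mT ai bi).
by rewrite (RintegralZl a mT fi) (RintegralZl b mT gi).
Qed.

Hypothesis C0 : 0 <= C.
Hypothesis ae_int : forall f, weighted_Lp lam p wx f ->
  {ae dtau, forall tau, kplane_integrable f tau}.
Hypothesis bound : forall f, measurable_fun setT f ->
  (weighted_norm dtau p wtau (K f) <= C%:E * weighted_norm lam p wx f)%E.
Hypothesis lower : (C%:E <= operator_norm lam dtau p wx wtau K)%E.

Lemma kplane_bounded_linear : bounded_linear_operator lam dtau p wx wtau K.
Proof.
split.
- move=> f [mf foo]; split; first exact: measurable_kplane_transform.
  by apply: (le_lt_trans (bound mf)); rewrite lte_mul_pinfty.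
- move=> a b f g /ae_int fi /ae_int gi; apply: filterS2 fi gi => tau.
  exact: kplane_transform_linear.
- by exists C => f [mf _]; exact: bound.
Qed.

Lemma kplane_operator_normE : operator_norm lam dtau p wx wtau K = C%:E.
Proof.
apply/eqP; rewrite eq_le lower andbT; apply: ge_ereal_sup => _ [f [[mf _] f1] <-].
apply: (le_trans (bound mf)); rewrite -[leRHS]mule1.
by apply: lee_wpmul2l; rewrite ?lee_fin.
Qed.

End bounded_operator.

Unset Implicit Arguments.
Set Strict Implicit.
Set Printing Implicit Defensive.

Theorem theorem1p1 (R : realType) (n k : nat) (p p' : \bar R) (mu nu : R)
    (dxi : probability (grassmannian R n k) R)
    (hn : (2 <= n)%N) (hk : (1 <= k <= n - 1)%N)
    (hp : (1 <= p)%E) (hpp' : (p^-1 + p'^-1 = 1)%E)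
    (hmu : k%:R - n%:R * fine p^-1%E < mu)
    (hnu : nu = mu - k%:R * fine p'^-1%E)
    (hdxi : rotation_invariant dxi) :
  let dtau := plane_measure dxi in
  let wx := fun x : 'rV[R]_n => enorm x `^ mu in
  let wtau := fun tau : affine_plane R n k => plane_norm tau `^ nu in
  [/\ forall f, weighted_Lp (lebesgue_rV R n) p wx f ->
        {ae dtau, forall tau, kplane_integrable f tau},
      bounded_linear_operator (lebesgue_rV R n) dtau p wx wtau
        (@kplane_transform R n k)
    & operator_norm (lebesgue_rV R n) dtau p wx wtau (@kplane_transform R n k) =
      (pi `^ (k%:R / 2) *
       (sphere_area R (n - k) / sphere_area R n) `^ fine p^-1%E *
       (Gamma_fun ((mu + n%:R * fine p^-1%E - k%:R) / 2) /
        Gamma_fun ((mu + n%:R * fine p^-1%E) / 2)))%:E].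
Proof.
move=> dtau wx wtau.
have kn : (0 < k < n)%N.
  by case/andP: hk => -> /leq_ltn_trans; apply; rewrite subn1 ltn_predL ltnW.
have A0 := area_ratio_gt0 R kn.
pose C := area_ratio R n k `^ fine p^-1%E * cauchy_integral k (mu + n%:R * fine p^-1%E).
have ka : k%:R < mu + n%:R * fine p^-1%E by rewrite -ltrBlDr.
have C0 : 0 <= C by rewrite mulr_ge0 ?powR_ge0// ltW// cauchy_integral_gt0.
(* These three facts have the same form for finite and infinite p and contain all the analysis; the
   conclusions follow from them formally. *)
suff [ai bd lo] : [/\ forall f, weighted_Lp (lebesgue_rV R n) p wx f ->
      {ae dtau, forall tau, kplane_integrable f tau},
    forall f, measurable_fun setT f ->
      (weighted_norm dtau p wtau (@kplane_transform R n k f) <=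
       C%:E * weighted_norm (lebesgue_rV R n) p wx f)%E &
    (C%:E <= operator_norm (lebesgue_rV R n) dtau p wx wtau (@kplane_transform R n k))%E].
  split => //; first exact: kplane_bounded_linear C0 ai bd.
  rewrite (kplane_operator_normE C0 bd lo) /C /cauchy_integral /area_ratio; congr EFin.
  by rewrite mulrCA mulrA.
rewrite {}/C in C0 *.
case: p hp hpp' hmu hnu @wx @wtau ka C0 => [r|_|//].
- rewrite lee_fin => r1.
  have r0 : r != 0 by rewrite gt_eqF// (lt_le_trans ltr01).
  rewrite inver (negbTE r0) /=.
  (* Only the reciprocal of p' matters: the conjugacy relation forces it to be the real number 1 -
     1/r, whether p' is finite or not. *)
  case: (p'^-1)%E => [q||//]; last by rewrite addey.
  rewrite -EFinD => -[rq] kmu nuE ka C0.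
  have {nuE} nuE : nu = mu - k%:R + k%:R / r.
    have qE : q = 1 - r^-1 by rewrite -rq addrAC subrr add0r.
    by rewrite nuE qE -[fine _]/(1 - r^-1); ring.
  rewrite nuE; split.
  + by move=> f [mf foo]; exact: (ae_kplane_integrable_fin kn hdxi r1 kmu mf foo).
  + by move=> f mf; exact: (kplane_norm_fin kn hdxi r1 kmu mf).
  + apply: cauchy_integral_limit => //; first by rewrite powR_gt0.
    by move=> e e0; exact: (operator_norm_ge_fin kn dxi r1 kmu e0).
(* Here 1/p = 0 and 1/p' = 1, so nu = mu - k, a = mu, and the area ratio appears with exponent 0. *)
- rewrite invey add0e => -> /=; rewrite !mulr0 subr0 addr0 mulr1 powRr0 mul1r => kmu -> _ _.
  split.
  + by move=> f [mf foo]; exact: (ae_kplane_integrable_infty kn hdxi kmu mf foo).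
  + by move=> f mf; exact: (kplane_norm_infty kn hdxi kmu mf).
  + exact: (operator_norm_ge_infty kn dxi kmu).
Qed.
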